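(* Let $N$ be a complete umbilic, not totally geodesic $n$-dimensional hypersurface in the space form $M_\kappa$ of constant sectional curvature $\kappa$, let $U$ be the exterior of $N$, and let $v$ be a smooth bifoliating unit vector field on $N$. For $p\in N$ let $Q_p(s)=\det\big(s\,\mathrm{id}_{T_pN}-(\nabla v)_p\big)$ be the characteristic polynomial of $(\nabla v)_p : T_pN\to T_pN$, $x\mapsto\nabla_xv$, where $\nabla$ is the Levi-Civita connection of $N$. Then the associated outer billiard map $B:U\to U$ preserves volume if and only if, for all $p\in N$ and $s\in\mathbb{R}$, $$Q_p(-s)=(-1)^nQ_p(s);$$ that is, for all $p$, the parity of $Q_p$ coincides with the parity of $n$.
   Context: Setting. $M_\kappa$ is the $(n+1)$-dimensional space form of constant sectional curvature $\kappa$: Euclidean space $\mathbb{R}^{n+1}$ if $\kappa=0$, the round sphere of radius $1/\sqrt{\kappa}$ if $\kappa>0$, and hyperbolic space if $\kappa<0$, for which one uses the upper half-space model $\{(x_0,\dots,x_n)\in\mathbb{R}^{n+1}: x_0>0\}$ with metric $(dx_0^2+\cdots+dx_n^2)/(-\kappa x_0^2)$. A hypersurface is umbilic if all its principal curvatures are equal. The complete umbilic, not totally geodesic hypersurfaces $N\subset M_\kappa$ considered are exactly: (1) $\kappa=0$: round $n$-spheres; (2) $\kappa>0$: geodesic spheres which are not great spheres; (3) $\kappa<0$: (3a) geodesic spheres, (3b) horospheres (congruent by an isometry to $x_0=1$), (3c) hypersurfaces congruent by an isometry to the intersection of the half-space with a hyperplane through the origin that is not orthogonal to $\{x_0=0\}$.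 Exterior. The exterior $U$ of $N$ is the connected component of $M_\kappa\setminus N$ into which the opposite of the mean curvature vector field of $N$ points, except that for $\kappa>0$, $U$ is further restricted to be the open zone between $N$ and its antipodal image $-N$. Bifoliation. For $u\in TM_\kappa$, $\gamma_u$ is the geodesic of $M_\kappa$ with initial velocity $u$. Put $T_\kappa=\infty$ if $\kappa\le0$ and $T_\kappa=\pi/\sqrt{\kappa}$ if $\kappa>0$. A smooth unit vector field $v$ on $N$ is bifoliating if the geodesic rays $\gamma_{v(p)}(0,T_\kappa)$, $p\in N$, are the leaves of a smooth foliation of $U$, and likewise the rays $\gamma_{-v(p)}(0,T_\kappa)$, $p\in N$, are the leaves of a smooth foliation of $U$. Outer billiard map. A bifoliating $v$ induces the outer billiard map $B:U\to U$ defined by $B(\gamma_{v(p)}(-t))=\gamma_{v(p)}(t)$ for $(p,t)\in N\times(0,T_\kappa)$; it is a well-defined diffeomorphism. ''Preserves volume'' means that $B$ preserves the Riemannian volume form of $M_\kappa$ on $U$. *)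

(* Defs.v *)
From HB Require Import structures.
From mathcomp Require Import all_boot all_order all_algebra.
From mathcomp Require Import all_classical all_reals all_analysis.

Set Implicit Arguments.
Unset Strict Implicit.
Unset Printing Implicit Defensive.

Import Order.TTheory GRing.Theory Num.Theory.
Import numFieldNormedType.Exports.

Local Open Scope classical_set_scope.
Local Open Scope ring_scope.

Section Smooth.
Context {R : realType}.

(* Meant for open [O]: all iterated directional derivatives of order at most
   [k] exist and are continuous on [O]. *)
Fixpoint Ck {V W : normedModType R} (k : nat) (O : set V) (f : V -> W) : Prop :=
  (forall x, O x -> {for x, continuous f}) /\
  if k is k'.+1 then
    forall u, (forall x, O x -> derivable f x u) /\ Ck k' O ('D_u f)
  else True.

(* A map on an arbitrary subset is smooth when it extends locally to a smooth
   map on an open set of the ambient space. *)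
Definition smooth_on {V W : normedModType R} (A : set V) (f : V -> W) : Prop :=
  forall x, A x -> exists (O : set V) (F : V -> W),
    [/\ open O, O x, (forall k, Ck k O F) & forall y, A y -> O y -> F y = f y].

Definition path_at {V : normedModType R} (S : set V) (x u : V) (c : R^o -> V) :
    Prop :=
  [/\ exists2 e : R, 0 < e & smooth_on [set t : R^o | `|t| < e] c /\
                             (forall t : R^o, `|t| < e -> S (c t)),
      c 0 = x & derive1 c 0 = u].

(* The tangent space at [x] of an embedded submanifold [S]. *)
Definition tangent {V : normedModType R} (S : set V) (x : V) : set V :=
  [set u | exists c, path_at S x u c].

(* The differential at [x] of a map defined on the submanifold [S], applied to
   [u] in the tangent space. *)
Definition tdiff {V W : normedModType R} (S : set V) (f : V -> W) (x u : V) : W :=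
  xget 0 [set w | exists c : R^o -> V,
    [/\ path_at S x u c, derivable (f \o c) 0 1 & w = derive1 (f \o c) 0]].

End Smooth.

Section SpaceForm.
Context {R : realType} (n : nat) (kappa : R).

(* The (n + 1)-dimensional space form [Mk] is a round sphere in R^(n+2) when
   kappa > 0, and an open subset of R^(n+1) otherwise. *)
Definition ambient := 'rV[R]_(n + (0 < kappa)%R).+1.

Definition edot (u w : ambient) : R := \sum_i u 0 i * w 0 i.

Definition Mk : set ambient :=
  [set x | if 0 < kappa then edot x x = kappa^-1
           else (kappa < 0 -> 0 < x 0 ord0)].

(* The metric is [conf x] times the Euclidean one. *)
Definition conf (x : ambient) : R :=
  if kappa < 0 then (- kappa * x 0 ord0 ^+ 2)^-1 else 1.

Definition metric (x u w : ambient) : R := conf x * edot u w.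

(* The Christoffel symbols of a conformally flat metric l <.,.>, that is
   (dl(u) w + dl(w) u - <u, w> grad l) / (2 l), with grad l Euclidean. *)
Definition christoffel (x u w : ambient) : ambient :=
  (2 * conf x)^-1 *:
    ('D_u conf x *: w + 'D_w conf x *: u
     - edot u w *: \row_i 'D_(delta_mx 0 i) conf x).

(* Orthogonal projection onto the tangent space of [S] at [x]. *)
Definition tproj (S : set ambient) (x w : ambient) : ambient :=
  xget 0 [set y | tangent S x y /\
                  forall z, tangent S x z -> metric x (w - y) z = 0].

(* By the Gauss formula, the Levi-Civita connection of a submanifold is the
   tangential part of the ambient one. *)
Definition nabla (S : set ambient) (v : ambient -> ambient) (p x : ambient) :
    ambient :=
  tproj S p (tdiff S v p x + christoffel p x (v p)).

(* Covariant acceleration of a curve for the ambient conformally flat metric. *)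
Definition acceleration (c : R^o -> ambient) (t : R^o) : ambient :=
  derive1n 2 c t + christoffel (c t) (derive1 c t) (derive1 c t).

Definition is_geodesic (c : R^o -> ambient) : Prop :=
  smooth_on setT c /\
  forall t, Mk (c t) /\ tproj Mk (c t) (acceleration c t) = 0.

Definition geod (p u : ambient) : R^o -> ambient :=
  xget (cst p) [set c | [/\ is_geodesic c, c 0 = p & derive1 c 0 = u]].

Definition Tk : \bar R := if 0 < kappa then (pi / Num.sqrt kappa)%:E else +oo%E.

Definition isometry (f : ambient -> ambient) : Prop :=
  [/\ smooth_on Mk f, set_bij Mk Mk f &
      forall x u w, Mk x -> tangent Mk x u -> tangent Mk x w ->
        metric (f x) (tdiff Mk f x u) (tdiff Mk f x w) = metric x u w].

Definition geodesic_sphere (c : ambient) (r : R) : set ambient :=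
  [set geod c u r | u in [set u | tangent Mk c u /\ metric c u u = 1]].

Definition horosphere (N : set ambient) : Prop :=
  exists2 f, isometry f & N = f @` [set x : ambient | x 0 ord0 = 1].

(* Congruent to the trace on the half-space of a hyperplane through the origin
   with normal [a]; the hyperplane is orthogonal to {x_0 = 0} iff a_0 = 0, and
   it misses the half-space iff it is {x_0 = 0}. *)
Definition equidistant (N : set ambient) : Prop :=
  exists (f : ambient -> ambient) (a : ambient),
    [/\ isometry f, a 0 ord0 != 0, Mk `&` [set x | edot a x = 0] !=set0 &
        N = f @` (Mk `&` [set x | edot a x = 0])].

(* The complete umbilic, not totally geodesic hypersurfaces: geodesic spheres
   (great spheres, of radius Tk / 2, being excluded), horospheres, and
   hypersurfaces equidistant from a totally geodesic one. *)
Definition umbilic_hypersurface (N : set ambient) : Prop :=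
  (exists (c : ambient) (r : R),
     [/\ Mk c, 0 < r, (r%:E < Tk)%E, ((2 * r)%:E != Tk)%E &
         N = geodesic_sphere c r])
  \/ (kappa < 0 /\ (horosphere N \/ equidistant N)).

(* The rows form an orthonormal basis of the tangent space of [N] at [p]. *)
Definition tbasis (N : set ambient) (p : ambient) :
    'M[R]_(n, (n + (0 < kappa)%R).+1) :=
  xget 0 [set E | (forall u : ambient, tangent N p u <-> (u <= E)%MS) /\
                  forall i j, metric p (row i E) (row j E) = (i == j)%:R].

(* II(u, u) for the second fundamental form II of [N] in [Mk]: the part normal
   to [N] of the covariant acceleration in [Mk] of a curve of [N] with initial
   velocity [u]. *)
Definition sff (N : set ambient) (p u : ambient) : ambient :=
  xget 0 [set h | exists2 c : R^o -> ambient, path_at N p u c &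
    h = tproj Mk p (acceleration c 0) - tproj N p (acceleration c 0)].

Definition mean_curvature (N : set ambient) (p : ambient) : ambient :=
  n%:R^-1 *: \sum_(i < n) sff N p (row i (tbasis N p)).

(* For kappa > 0, [E `&` - E] is the open zone between [N] and [- N], where [E]
   is the component of the complement of [N] opposite to the mean curvature. *)
Definition exterior (N : set ambient) : set ambient :=
  let E := [set x | exists2 p, N p &
    \forall t \near (0 : R)^'+,
      connected_component (Mk `\` N) (geod p (- mean_curvature N p) t) x] in
  [set x | E x /\ (0 < kappa -> E (- x))].

Definition cube : set 'rV[R]_n.+1 := [set z | forall i, `|z 0 i| < 1].

(* [F] is the set of leaves of a smooth one-dimensional foliation of the open
   subset [U] of [Mk]. The leaves are connected and one-dimensional: a connected
   immersed one-dimensional submanifold is a line or a circle, hence the range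
   of an immersion of the real line. Around each point of [U] there is a chart
   [phi], with inverse [psi], from [W] onto an open cube, in which each leaf is
   a countable union of slices parallel to the first axis. *)
Definition smooth_foliation (U : set ambient) (F : set (set ambient)) : Prop :=
  [/\ forall L, F L -> L `<=` U /\
        (exists c : R^o -> ambient,
           [/\ smooth_on setT c, forall t, derive1 c t != 0 & L = range c]),
      forall x, U x -> exists2 L, F L & L x,
      forall L L' x, F L -> F L' -> L x -> L' x -> L = L' &
      forall x, U x -> exists (O : set ambient) (phi : ambient -> 'rV[R]_n.+1)
                              (psi : 'rV[R]_n.+1 -> ambient),
        let W := Mk `&` O in
        [/\ open O, O x, W `<=` U, smooth_on W phi /\ smooth_on cube psi &
          [/\ forall y, W y -> cube (phi y) /\ psi (phi y) = y,
              forall z, cube z -> W (psi z) /\ phi (psi z) = z &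
              forall L, F L -> exists2 A : set 'rV[R]_n, countable A &
                L `&` W = W `&` [set y | A (col' ord0 (phi y))]]]].

Definition ray (p u : ambient) : set ambient :=
  [set geod p u t | t in [set t : R^o | 0 < t /\ (t%:E < Tk)%E]].

Definition smooth_unit_field (N : set ambient) (v : ambient -> ambient) : Prop :=
  smooth_on N v /\
  forall p, N p -> tangent N p (v p) /\ metric p (v p) (v p) = 1.

Definition bifoliating (N : set ambient) (v : ambient -> ambient) : Prop :=
  smooth_foliation (exterior N) [set ray p (v p) | p in N] /\
  smooth_foliation (exterior N) [set ray p (- v p) | p in N].

(* Only meaningful on the exterior of [N], where [p] and [t] exist uniquely when
   [v] is bifoliating. *)
Definition billiard (N : set ambient) (v : ambient -> ambient) (x : ambient) :
    ambient :=
  xget x [set y | exists p (t : R), [/\ N p, 0 < t, (t%:E < Tk)%E,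
                    x = geod p (v p) (- t) & y = geod p (v p) t]].

(* The Riemannian volume form of [Mk] on the tangent vectors u_0, ..., u_n. For
   kappa > 0 the matrix has one more row, the unit normal of the sphere. *)
Definition volume_form (x : ambient) (u : 'I_n.+1 -> ambient) : R :=
  Num.sqrt (conf x) ^+ n.+1 *
  \det (\matrix_(i, j) (if insub (i : nat) is Some k then u k
                        else Num.sqrt kappa *: x) 0 j).

Definition preserves_volume (U : set ambient) (B : ambient -> ambient) : Prop :=
  forall (x : ambient) (u : 'I_n.+1 -> ambient), U x ->
    (forall i, tangent Mk x (u i)) ->
    volume_form (B x) (fun i => tdiff U B x (u i)) = volume_form x u.

(* det (s id - nabla v) on the tangent space of [N] at [p], computed in an
   orthonormal basis. *)
Definition nabla_char_poly (N : set ambient) (v : ambient -> ambient)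
    (p : ambient) : {poly R} :=
  let E := tbasis N p in
  char_poly (\matrix_(i < n, j < n) metric p (nabla N v p (row i E)) (row j E)).

End SpaceForm.

(* Main.v *)
Require Import Defs.
From HB Require Import structures.
From mathcomp Require Import all_boot all_order all_algebra.
From mathcomp Require Import all_classical all_reals all_analysis.
From mathcomp Require Import ring lra.

Set Implicit Arguments.
Unset Strict Implicit.
Unset Printing Implicit Defensive.

Import Order.TTheory GRing.Theory Num.Theory.
Import numFieldNormedType.Exports.

Local Open Scope classical_set_scope.
Local Open Scope ring_scope.

(** The space form is realised as a piece of a quadric [q z z = 1] of R^(n+2),
    where unit speed geodesics read [cK t *: z + sK t *: xi] and an umbilic
    hypersurface is the trace of a hyperplane [q a z = 1]. The differential of
    the outer billiard map carries the variation of [gamma (- t)], for [gamma]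
    running through the geodesics with initial velocity in [v], to the variation
    of [gamma t]. Written in an orthonormal frame of the hypersurface completed
    by its normal and by the position vector, the two variations differ by the
    sign of [sK t], so that [B] preserves volume at [gamma (- t)] if and only if
    a determinant [D (cK t) (sK t)] equals [- D (cK t) (- sK t)]. Since [v] is a
    unit field, [cK t * D] is [sK t] times [det (cK t + sK t (nabla v))] up to a
    constant. Both sides are homogeneous, and [cK t / sK t] takes infinitely
    many values, whence the condition on the parity of the characteristic
    polynomial.

    That the billiard map can be differentiated, and that the variations span
    the tangent space, is extracted from the foliation without an inverse
    function theorem: near each point of the exterior, the directions of the
    leaves extend to a differentiable field. *)

(** * Calculus *)

Section Calculus.
Context {R : realType}.
Implicit Types V W : normedModType R.

Lemma is_derive_mx V (m n : nat) (M : V -> 'M[R]_(m, n)) x v (d : 'M[R]_(m, n)) :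
  (forall i j, is_derive x v (fun y => M y i j : R^o) (d i j)) ->
  is_derive x v M d.
Proof.
move=> dM; have Mx : derivable M x v.
  by apply/derivable_mxP => i j; case: (dM i j).
apply: DeriveDef => //; rewrite derive_mx //; apply/matrixP => i j.
by rewrite mxE; case: (dM i j).
Qed.

Lemma is_derive_coord V (m n : nat) (M : V -> 'M[R]_(m, n)) x v (d : 'M[R]_(m, n)) i j :
  is_derive x v M d -> is_derive x v (fun y => M y i j : R^o) (d i j).
Proof.
move=> [Mx <-]; apply: DeriveDef; first by move/derivable_mxP : Mx; exact.
by rewrite derive_mx // mxE.
Qed.

Lemma is_derive_line V W (f : V -> W) x v d :
  is_derive x v f d <-> is_derive (0 : R^o) 1 (fun h : R^o => f (x + h *: v)) d.
Proof.
have E : 'D_v f x = 'D_1 (fun h : R^o => f (x + h *: v)) 0.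
  rewrite /derive; apply: (congr1 (fun g : R -> W => lim (g @ 0^'))).
  apply/funext => h /=.
  by rewrite [_%:A]mulr1 [h + 0]addr0 scale0r addr0 [_ + x]addrC.
have F : derivable f x v <-> derivable (fun h : R^o => f (x + h *: v)) 0 1.
  rewrite derivable1P; split; apply: near_eq_derivable;
    by near=> h; rewrite addrC.
by split=> [[? <-]|[? <-]]; apply: DeriveDef; rewrite ?E //; apply/F.
Unshelve. all: by end_near. Qed.

Lemma is_derive_differentiable V W (f : V -> W) x v :
  differentiable f x -> is_derive x v f ('d f x v).
Proof.
by move=> fx; apply: DeriveDef; [exact: diff_derivable|rewrite deriveE].
Qed.

Lemma is_derive_comp_diff V W (U : normedModType R) (F : V -> W) (g : U -> V) x v dg :
  differentiable F (g x) -> is_derive x v g dg ->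
  is_derive x v (F \o g) ('D_dg F (g x)).
Proof.
move=> dF /is_derive_line [/derivable1_diffP dl El]; apply/is_derive_line.
set l := (fun h : R^o => _) in dl El.
have l0 : l 0 = g x by rewrite /l scale0r addr0.
have dF' : differentiable F (l 0) by rewrite l0.
have := is_derive_differentiable (1 : R^o) (differentiable_comp dl dF').
by rewrite diff_comp //= -(deriveE _ dl) El -deriveE // l0.
Qed.

Lemma is_derive_linear V W (L : {linear V -> W}) (U : normedModType R) (g : U -> V)
    x v dg :
  continuous L -> is_derive x v g dg -> is_derive x v (L \o g) (L dg).
Proof.
move=> cL dg'.
have dL : differentiable L (g x) by exact: linear_differentiable.
by have := is_derive_comp_diff dL dg'; rewrite deriveE // diff_lin.
Qed.

Lemma is_derive_ext V W (f g : V -> W) x v d :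
  f =1 g -> is_derive x v f d -> is_derive x v g d.
Proof. by move=> /funext ->. Qed.

Lemma is_derive_scale V W (f : V -> R^o) (g : V -> W) x v df dg :
  is_derive x v f df -> is_derive x v g dg ->
  is_derive x v (fun y => f y *: g y) (df *: g x + f x *: dg).
Proof.
move=> /is_derive_line [dfx fE] /is_derive_line [dgx gE]; apply/is_derive_line.
set f' := (fun h : R^o => _) in dfx fE; set g' := (fun h : R^o => _) in dgx gE.
have [f0 g0] : f' 0 = f x /\ g' 0 = g x by rewrite /f' /g' !scale0r !addr0.
have K : h^-1 *: (f' (h *: 1 + 0) *: g' (h *: 1 + 0) - f' 0 *: g' 0) @[h --> 0^']
    --> df *: g x + f x *: dg.
  rewrite -f0 -g0.
  have -> : (fun h : R => h^-1 *: (f' (h *: 1 + 0) *: g' (h *: 1 + 0) - f' 0 *: g' 0)) =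
    (fun h : R => (h^-1 *: (f' (h *: 1 + 0) - f' 0)) *: g' (h *: 1 + 0) +
       f' 0 *: (h^-1 *: (g' (h *: 1 + 0) - g' 0))).
    apply/funext => h; rewrite scalerBr [in RHS]scalerBr !scalerBl !scalerBr.
    by rewrite !scalerA [f' 0 * h^-1]mulrC subrKA.
  apply: cvgD; last by apply: cvgZl_tmp; rewrite -gE; exact: dgx.
  apply: cvgZ; first by rewrite -fE; exact: dfx.
  have /derivable1_diffP/differentiable_continuous cg := dgx.
  have H : (fun h : R => h *: (1 : R^o) + 0) x @[x --> 0^'] --> (0 : R^o).
    have -> : (fun h : R => h *: (1 : R^o) + 0) = id.
      by apply/funext => h; rewrite addr0 [_ *: _]mulr1.
    exact: nbhs_dnbhs.
  exact: (cvg_comp _ _ H cg).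
have D : derivable (fun h : R^o => f (x + h *: v) *: g (x + h *: v)) 0 1.
  by apply/cvg_ex; eexists; exact: K.
by apply: DeriveDef => //; apply: cvg_lim.
Qed.

Lemma is_derive_mul V (f g : V -> R^o) x v df dg :
  is_derive x v f df -> is_derive x v g dg ->
  is_derive x v (fun y => f y * g y : R^o) (df * g x + f x * dg).
Proof. exact: is_derive_scale. Qed.

Lemma is_derive_inv V (f : V -> R^o) x v df : f x != 0 ->
  is_derive x v f df -> is_derive x v (fun y => (f y)^-1 : R^o) (- df / f x ^+ 2).
Proof.
move=> fx0 [fd <-]; apply: DeriveDef; first exact: derivableV.
by rewrite deriveV // [LHS]/(_ * _) mulNr mulrC -mulNr.
Qed.

Lemma is_derive_bigsum V W (I : finType) (h : I -> V -> W) x v dh :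
  (forall i, is_derive x v (h i) (dh i)) ->
  is_derive x v (fun y => \sum_i h i y) (\sum_i dh i).
Proof.
move=> H.
have -> : (fun y => \sum_i h i y) = \sum_i h i by apply/funext=> y; rewrite fct_sumE.
elim/big_ind2 : _ => // *; [exact: is_derive_cst|exact: is_deriveD].
Qed.

Lemma is_derive_unique V W (f : V -> W) x v d d' :
  is_derive x v f d -> is_derive x v f d' -> d = d'.
Proof. by move=> [_ <-] [_ <-]. Qed.

Lemma is_derive_continuous W (f : R^o -> W) (t : R^o) d :
  is_derive t (1 : R^o) f d -> {for t, continuous f}.
Proof. by move=> [/derivable1_diffP/differentiable_continuous]. Qed.

Lemma is_derive_dirZ V W (f : V -> W) x v d (a : R) :
  is_derive x v f d -> is_derive x (a *: v) f (a *: d).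
Proof.
move=> /is_derive_line fd; apply/is_derive_line.
have [/derivable1_diffP dl El] := fd.
set l := (fun h : R^o => _) in fd dl El.
have [dl' El'] := @is_derive_differentiable _ _ l 0 (a : R^o) dl.
have E : 'd l 0 (a : R^o) = a *: d.
  by rewrite -El deriveE // -linearZ; congr ('d l 0 _); rewrite [RHS]mulr1.
rewrite -E; have H : is_derive (0 : R^o) (1 : R^o) (fun h : R^o => h * a : R^o) a.
  have := is_derive_mul (@is_derive_id R R^o (0 : R^o) (1 : R^o)) (@is_derive_cst R R^o R^o (a : R^o) 0 1).
  by rewrite mul1r mulr0 addr0.
have := @is_derive_comp_diff R^o W R^o l (fun h : R^o => h * a : R^o) 0 1 a.
rewrite mul0r => /(_ dl H); rewrite deriveE //.
by apply: is_derive_ext => h; rewrite /l /= scalerA.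
Qed.

Lemma line_mvt V (f : V -> R^o) (x v : V) :
  (forall t : R, 0 <= t <= 1 -> derivable f (x + t *: v) v) ->
  exists2 c : R, 0 <= c <= 1 & f (x + v) - f x = 'D_v f (x + c *: v).
Proof.
move=> fd; pose g (t : R) := f (x + t *: v) : R.
have gd t : 0 <= t <= 1 -> is_derive (t : R^o) (1 : R^o) g ('D_v f (x + t *: v)).
  move=> /fd /derivableP /is_derive_line H; apply/is_derive_line.
  by apply: is_derive_ext H => h; rewrite /g scalerDl [h *: 1]mulr1 addrA.
have [||c + E] := @MVT_segment R g (fun t => 'D_v f (x + t *: v)) 0 1 ler01.
- by move=> t; rewrite in_itv /= => /andP[t0 t1]; apply: gd; rewrite !ltW.
- apply: derivable_within_continuous => t; rewrite in_itv /= => t01.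
  by case: (gd t t01).
rewrite in_itv /= => c01; exists c => //.
by move: E; rewrite /g scale1r scale0r addr0 subr0 mulr1.
Qed.

Lemma rV_linear_continuous (m : nat) W (L : {linear 'rV[R]_m -> W}) : continuous L.
Proof.
have -> : (L : 'rV[R]_m -> W) = \sum_i (fun h : 'rV[R]_m => h 0 i *: L (delta_mx 0 i)).
  apply/funext => h; rewrite {1}[h]row_sum_delta linear_sum fct_sumE.
  by apply: eq_bigr => i _; rewrite linearZ.
move=> h; apply: differentiable_continuous; apply: differentiable_sum => i.
exact: (differentiableZl _ (differentiable_coord h 0 i)).
Qed.

Lemma differentiable_of_littleo V W (f : V -> W) (L : {linear V -> W}) x :
  continuous L ->
  (forall e : R, 0 < e -> exists2 r : R, 0 < r &
     forall h, `|h| < r -> `|f (h + x) - (f x + L h)| <= e * `|h|) ->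
  differentiable f x.
Proof.
move=> cL LE.
have dE : f \o shift x = cst (f x) + L +o_ 0 id.
  apply/eqaddoP => e e0; have [r r0 Hr] := LE e e0.
  apply/nbhs_ballP; exists r => //= h.
  by rewrite -ball_normE /= sub0r normrN => /Hr.
by apply/diff_locallyP; rewrite (diff_unique cL dE).
Qed.

Lemma finite_continuity_radius V (I : finType) (O : set V) (D : I -> V -> R^o) x (e : R) :
  open O -> O x -> 0 < e -> (forall i, {for x, continuous (D i)}) ->
  exists2 r : R, 0 < r & forall y, `|y - x| < r -> O y /\ forall i, `|D i x - D i y| < e.
Proof.
move=> oO Ox e0 cD.
have : \forall y \near x, O y /\ forall i, `|D i x - D i y| < e.
  apply: filterI; first exact: open_nbhs_nbhs.
  by apply: filter_forall => i; have /cvgrPdist_lt/(_ _ e0) := cD i.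
move=> /nbhs_ballP[r r0 Hr]; exists r => // y yr.
by apply: Hr; rewrite -ball_normE /= distrC.
Qed.

Lemma coord_le_norm (m k : nat) (M : 'M[R]_(m, k)) i j : `|M i j| <= `|M|.
Proof.
rewrite [leRHS]/Num.Def.normr /= mx_normrE.
exact: (le_trans _ (le_bigmax _ (fun p => `|M p.1 p.2|) (i, j))).
Qed.

Lemma norm_le_coord (m k : nat) (M : 'M[R]_(m, k)) (c : R) : 0 <= c ->
  (forall i j, `|M i j| <= c) -> `|M| <= c.
Proof.
move=> c0 Mc; rewrite [leLHS]/Num.Def.normr /= mx_normrE.
by apply: bigmax_le => // -[i j] _; exact: Mc.
Qed.

Lemma C1_differentiable_real (m : nat) (O : set 'rV[R]_m) (f : 'rV[R]_m -> R^o)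
    (D : 'rV[R]_m -> 'rV[R]_m -> R^o) x :
  open O -> O x -> (forall u y, O y -> is_derive y u f (D u y)) ->
  (forall u, {for x, continuous (D u)}) -> differentiable f x.
Proof.
move=> oO Ox fd fc.
pose e_ i : 'rV[R]_m := delta_mx 0 i.
pose L (h : 'rV[R]_m) : R^o := \sum_i h 0 i * D (e_ i) x.
have Llin : linear L.
  move=> a u w; rewrite /L scaler_sumr -big_split; apply: eq_bigr => i _.
  by rewrite !mxE mulrDl [_ *: _]mulrA.
pose Lm := HB.pack_for {linear 'rV[R]_m -> R^o} L (GRing.isLinear.Build _ _ _ _ _ Llin).
have cL : continuous Lm by exact: rV_linear_continuous.
apply: (differentiable_of_littleo cL) => _/posnumP[e].
  have e0 : 0 < e%:num / (m.+1)%:R by rewrite divr_gt0.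
  have [r r0 Hr] := finite_continuity_radius oO Ox e0 (fun i => fc (e_ i)).
  exists r => // h hr.
  pose p (k : nat) : 'rV[R]_m := x + \row_i (if (i < k)%N then h 0 i else 0).
  have p0 : p 0%N = x by rewrite /p; apply/rowP => i; rewrite !mxE addr0.
  have pm : p m = h + x.
    by rewrite /p addrC; congr (_ + _); apply/rowP => i; rewrite !mxE ltn_ord.
  have pS (i : 'I_m) : p i.+1 = p i + h 0 i *: e_ i.
    rewrite /p -addrA; congr (_ + _); apply/rowP => j; rewrite !mxE eqxx /= ltnS leq_eqVlt.
    rewrite val_eqE [j == i]eq_sym; case: eqVneq => [->|] /=; rewrite ?ltnn ?mulr1 ?add0r //.
    by rewrite mulr0 addr0.
  have near_x (i : 'I_m) t : 0 <= t <= 1 -> `|p i + t *: (h 0 i *: e_ i) - x| < r.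
    move=> /andP[t0 t1]; rewrite /p addrC !addrA addNr add0r.
    apply: le_lt_trans hr; apply: norm_le_coord => // a j.
    rewrite !mxE /= (ord1 a) eqxx /=; apply: (le_trans _ (coord_le_norm _ 0 j)).
    case: (eqVneq j i) => [->|_]; last by rewrite !mulr0 addr0; case: ifP => _ //; rewrite normr0.
    by rewrite ltnn add0r mulr1 normrM ger0_norm // ler_piMl.
  have step (i : 'I_m) : `|f (p i.+1) - f (p i) - h 0 i * D (e_ i) x| <= `|h 0 i| * (e%:num / (m.+1)%:R).
    have [|c c01] := @line_mvt _ f (p i) (h 0 i *: e_ i).
      by move=> t t01; case: (fd (h 0 i *: e_ i) (p i + t *: (h 0 i *: e_ i))) => //; case: (Hr _ (near_x i t t01)).
    rewrite pS => ->.
    have [Oy Dy] := Hr _ (near_x i c c01).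
    have [_ ->] := is_derive_dirZ (h 0 i) (fd (e_ i) _ Oy).
    by rewrite [_ *: _]/(_ * _) -mulrBr normrM ler_wpM2l // distrC ltW.
  have -> : f (h + x) - (f x + Lm h) =
     \sum_(i < m) (f (p i.+1) - f (p i) - h 0 i * D (e_ i) x).
    rewrite sumrB -(big_mkord xpredT (fun k => f (p k.+1) - f (p k))) telescope_sumr //.
    by rewrite pm p0 /= opprD addrA.
  apply: (le_trans (ler_norm_sum _ _ _)).
  apply: (@le_trans _ _ (\sum_(i < m) `|h| * (e%:num / (m.+1)%:R))).
    apply: ler_sum => i _; apply: (le_trans (step i)); rewrite ler_wpM2r ?(ltW e0) //.
    exact: coord_le_norm.
  rewrite sumr_const card_ord -[X in X <= _]mulr_natl.
  have -> : m%:R * (`|h| * (e%:num / m.+1%:R)) = (e%:num * `|h|) * (m%:R / m.+1%:R) by ring.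
  rewrite ler_piMr ?mulr_ge0 // ler_pdivrMr ?ltr0n // mul1r ler_nat.
  exact: leqnSn.
Qed.

Lemma C1_differentiable (m k : nat) (O : set 'rV[R]_m) (f : 'rV[R]_m -> 'rV[R]_k) x :
  open O -> O x -> (forall u y, O y -> derivable f y u) ->
  (forall u, {for x, continuous ('D_u f)}) -> differentiable f x.
Proof.
move=> oO Ox fd fc.
have -> : f = \sum_i (fun y => f y 0 i *: delta_mx 0 i).
  by apply/funext => y; rewrite fct_sumE -row_sum_delta.
apply: differentiable_sum => i; apply: (@differentiableZl _ _ _ (fun y => f y 0 i)).
apply: (@C1_differentiable_real _ O _ (fun u y => 'D_u f y 0 i)) => // [u y Oy|u].
  by apply: is_derive_coord; apply/derivableP/fd.
apply: (@continuous_comp _ _ _ ('D_u f) (fun M : 'rV[R]_k => M 0 i : R^o)).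
  exact: fc.
exact: differentiable_continuous (differentiable_coord _ _ _).
Qed.

End Calculus.

Section CkTheory.
Context {R : realType}.
Implicit Types V W : normedModType R.

Lemma CkS_intro V W k (O : set V) (f : V -> W) (D : V -> V -> W) :
  (forall x, O x -> {for x, continuous f}) ->
  (forall u x, O x -> is_derive x u f (D u x)) ->
  (forall u, Ck k O ('D_u f) ) -> Ck k.+1 O f.
Proof.
by move=> fc fD fk; split=> // u; split=> [x Ox|]; [case: (fD u x Ox)|exact: fk].
Qed.

Lemma Ck_continuous V W k (O : set V) (f : V -> W) x :
  Ck k O f -> O x -> {for x, continuous f}.
Proof. by case: k => [|k] [fc _] /fc. Qed.

Lemma Ck_is_derive V W k (O : set V) (f : V -> W) x u :
  Ck k.+1 O f -> O x -> is_derive x u f ('D_u f x).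
Proof. by move=> [_ /(_ u)[fd _]] Ox; apply/derivableP/fd. Qed.

Lemma Ck_derive V W k (O : set V) (f : V -> W) u : Ck k.+1 O f -> Ck k O ('D_u f).
Proof. by case=> _ /(_ u)[]. Qed.

Lemma Ck_sub V W k (O O' : set V) (f : V -> W) :
  O' `<=` O -> Ck k O f -> Ck k O' f.
Proof.
elim: k f => [|k IH] f OO' [fc fk]; split=> //; try by move=> x /OO'/fc.
by move=> u; have [fd fk'] := fk u; split=> [x /OO'/fd //|]; exact: IH.
Qed.

Lemma CkW V W k (O : set V) (f : V -> W) : Ck k.+1 O f -> Ck k O f.
Proof.
elim: k f => [|k IH] f [fc fk]; split=> //.
by move=> u; have [fd fk'] := fk u; split=> //; exact: IH.
Qed.

Lemma Ck_eq V W k (O : set V) (f g : V -> W) :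
  open O -> (forall x, O x -> f x = g x) -> Ck k O f -> Ck k O g.
Proof.
move=> oO; have nearE (f1 g1 : V -> W) x : (forall y, O y -> f1 y = g1 y) -> O x ->
    \forall y \near x, f1 y = g1 y.
  by move=> fg Ox; apply: filterS fg _; apply: open_nbhs_nbhs.
have contE (f1 g1 : V -> W) : (forall y, O y -> f1 y = g1 y) ->
    (forall x, O x -> {for x, continuous f1}) -> forall x, O x -> {for x, continuous g1}.
  move=> fg fc x Ox; have := fc x Ox; rewrite /prop_for /continuous_at -(fg x Ox).
  by apply: cvg_trans; apply: near_eq_cvg; exact: nearE fg Ox.
elim: k f g => [|k IH] f g fg [fc fk]; split=> //; try exact: contE fg fc.
move=> u; have [fd fk'] := fk u; split=> [x Ox|].
  exact: near_eq_derivable (nearE _ _ _ fg Ox) (fd x Ox).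
apply: IH fk' => x Ox; apply: near_eq_derive; exact: nearE fg Ox.
Qed.

Lemma CkS_der V W k (O : set V) (f : V -> W) (D : V -> V -> W) :
  open O -> (forall x, O x -> {for x, continuous f}) ->
  (forall u x, O x -> is_derive x u f (D u x)) ->
  (forall u, Ck k O (D u)) -> Ck k.+1 O f.
Proof.
move=> oO fc fD Dk; apply: (CkS_intro fc fD) => u; apply: Ck_eq (Dk u) => // x Ox.
by case: (fD u x Ox).
Qed.

Lemma Ck_local V W k (O : set V) (f : V -> W) :
  (forall x, O x -> exists2 U : set V, U x & Ck k U f) -> Ck k O f.
Proof.
elim: k f => [|k IH] f H; split=> //.
- by move=> x /H[U Ux [fc _]]; exact: fc.
- by move=> x /H[U Ux [fc _]]; exact: fc.
move=> u; split=> [x /H[U Ux [_ /(_ u)[fd _]]]|]; first exact: fd.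
by apply: IH => x /H[U Ux /(Ck_derive u)]; exists U.
Qed.

Lemma Ck_cst V W k (O : set V) (a : W) : Ck k O (fun _ : V => a).
Proof.
elim: k a => [|k IH] a; split=> //; try by move=> x _; exact: cst_continuous.
move=> u; split=> [x _|]; first exact: derivable_cst.
have -> : 'D_u (fun _ : V => a) = (fun=> 0) by apply/funext => x; exact: derive_cst.
exact: IH.
Qed.

Lemma CkD V W k (O : set V) (f g : V -> W) : open O ->
  Ck k O f -> Ck k O g -> Ck k O (fun x => f x + g x).
Proof.
move=> oO; elim: k f g => [|k IH] f g cf cg.
  by split=> // x Ox; apply: cvgD; [exact: Ck_continuous cf Ox|exact: Ck_continuous cg Ox].
apply: (CkS_der (D := fun u x => 'D_u f x + 'D_u g x)) => // [x Ox|u x Ox|u].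
- by apply: cvgD; [exact: Ck_continuous cf Ox|exact: Ck_continuous cg Ox].
- by apply: is_deriveD; [exact: Ck_is_derive cf Ox|exact: Ck_is_derive cg Ox].
- by apply: IH; exact: Ck_derive.
Qed.

Lemma Ck_scale V W k (O : set V) (f : V -> R^o) (g : V -> W) : open O ->
  Ck k O f -> Ck k O g -> Ck k O (fun x => f x *: g x).
Proof.
move=> oO; elim: k f g => [|k IH] f g cf cg.
  by split=> // x Ox; apply: cvgZ; [exact: Ck_continuous cf Ox|exact: Ck_continuous cg Ox].
apply: (CkS_der (D := fun u x => 'D_u f x *: g x + f x *: 'D_u g x)) => // [x Ox|u x Ox|u].
- by apply: cvgZ; [exact: Ck_continuous cf Ox|exact: Ck_continuous cg Ox].
- by apply: is_derive_scale; [exact: Ck_is_derive cf Ox|exact: Ck_is_derive cg Ox].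
- by apply: CkD => //; apply: IH; [exact: Ck_derive|exact: CkW|exact: CkW|exact: Ck_derive].
Qed.

Lemma Ck_sum V W k (I : finType) (O : set V) (f : I -> V -> W) : open O ->
  (forall i, Ck k O (f i)) -> Ck k O (fun x => \sum_i f i x).
Proof.
move=> oO fk; have -> : (fun x => \sum_i f i x) = \sum_i f i.
  by apply/funext=> y; rewrite fct_sumE.
elim/big_ind : _ => // [|g h cg ch]; [exact: Ck_cst|exact: CkD].
Qed.

Lemma Ck_inv V k (O : set V) (f : V -> R^o) : open O ->
  (forall x, O x -> f x != 0) -> Ck k O f -> Ck k O (fun x => (f x)^-1 : R^o).
Proof.
move=> oO f0; elim: k => [|k IH] cf.
  by split=> // x Ox; apply: cvgV; [exact: f0|exact: Ck_continuous cf Ox].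
apply: (CkS_der (D := fun u x => - 'D_u f x / f x ^+ 2)) => // [x Ox|u x Ox|u].
- by apply: cvgV; [exact: f0|exact: Ck_continuous cf Ox].
- by apply: is_derive_inv; [exact: f0|exact: Ck_is_derive cf Ox].
have cV := IH (CkW cf).
have -> : (fun x => - 'D_u f x / f x ^+ 2) =
   (fun x => (-1 : R^o) *: 'D_u f x *: ((f x)^-1 *: (f x)^-1)).
  by apply/funext => x; rewrite expr2 invfM /GRing.scale /= mulN1r.
by do 2?[apply: Ck_scale => //]; [exact: Ck_cst|exact: Ck_derive].
Qed.

Lemma Ck_linear V W k (O : set V) (L : {linear V -> W}) : continuous L -> Ck k O L.
Proof.
move=> cL; case: k => [|k]; first by split => // x _; exact: cL.
split=> [x _|u]; first exact: cL.
have dL x : is_derive x u L (L u).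
  have [_ <-] := is_derive_linear cL (@is_derive_id _ _ x u).
  apply/derivableP; exact/diff_derivable/linear_differentiable.
split=> [x _|]; first by case: (dL x).
have -> : 'D_u L = (fun=> L u) by apply/funext => x; case: (dL x).
exact: Ck_cst.
Qed.

Lemma Ck_coord V k (m l : nat) (O : set V) (f : V -> 'M[R]_(m, l)) i j : open O ->
  Ck k O f -> Ck k O (fun x => f x i j : R^o).
Proof.
move=> oO; have cc x (g : V -> 'M[R]_(m, l)) : {for x, continuous g} ->
    {for x, continuous (fun x => g x i j : R^o)}.
  move=> cg; apply: (@continuous_comp _ _ _ g (fun M => M i j : R^o)) => //.
  exact: differentiable_continuous (differentiable_coord _ _ _).
elim: k f => [|k IH] f cf.
  by split=> // x Ox; apply: cc; exact: Ck_continuous cf Ox.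
apply: (CkS_der (D := fun u x => 'D_u f x i j)) => // [x Ox|u x Ox|u].
- by apply: cc; exact: Ck_continuous cf Ox.
- by apply: is_derive_coord; exact: Ck_is_derive cf Ox.
- by apply: IH; exact: Ck_derive.
Qed.

Lemma Ck_differentiable (m l k : nat) (O : set 'rV[R]_m) (f : 'rV[R]_m -> 'rV[R]_l) x :
  open O -> Ck k.+1 O f -> O x -> differentiable f x.
Proof.
move=> oO fk Ox; apply: (C1_differentiable oO Ox) => [u y Oy|u].
  by case: (Ck_is_derive u fk Oy).
exact: Ck_continuous (Ck_derive u fk) Ox.
Qed.

Lemma derive_sum_coord (m l : nat) (f : 'rV[R]_m -> 'rV[R]_l) x u :
  differentiable f x -> 'D_u f x = \sum_i u 0 i *: 'D_(delta_mx 0 i) f x.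
Proof.
move=> df; rewrite deriveE // {1}[u]row_sum_delta linear_sum.
by apply: eq_bigr => i _; rewrite linearZ deriveE.
Qed.

Lemma derive_lin V W (f : V -> W) x (a : R) u w :
  differentiable f x -> 'D_(a *: u + w) f x = a *: 'D_u f x + 'D_w f x.
Proof. by move=> df; rewrite !deriveE // linearP. Qed.

Lemma Ck_comp V k (m l : nat) (O : set V) (OF : set 'rV[R]_m) (F : 'rV[R]_m -> 'rV[R]_l)
    (g : V -> 'rV[R]_m) : open O -> open OF -> (forall x, O x -> OF (g x)) ->
  Ck k OF F -> Ck k O g -> Ck k O (fun x => F (g x)).
Proof.
move=> oO oF gO; elim: k F => [|k IH] F cF cg.
  split=> // x Ox; apply: continuous_comp; first exact: Ck_continuous cg Ox.
  exact: Ck_continuous cF (gO _ Ox).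
apply: (CkS_der (D := fun u x => \sum_i ('D_u g x) 0 i *: 'D_(delta_mx 0 i) F (g x))) => //.
- move=> x Ox; apply: continuous_comp; first exact: Ck_continuous cg Ox.
  exact: Ck_continuous cF (gO _ Ox).
- move=> u x Ox; have dF := Ck_differentiable oF cF (gO _ Ox).
  by rewrite -(derive_sum_coord _ dF); exact: (is_derive_comp_diff dF (Ck_is_derive u cg Ox)).
move=> u; apply: Ck_sum => // i; apply: Ck_scale => //.
  by apply: Ck_coord => //; exact: Ck_derive.
exact: (IH _ (Ck_derive _ cF) (CkW cg)).
Qed.

End CkTheory.

Section Bilinear.
Context {R : realType}.

Definition bil (m : nat) (Q : 'M[R]_m) (z w : 'rV[R]_m) : R := (z *m Q *m w^T) 0 0.

Variables (m : nat) (Q : 'M[R]_m).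
Implicit Types (z w : 'rV[R]_m).

Lemma bilDl z z' w : bil Q (z + z') w = bil Q z w + bil Q z' w.
Proof. by rewrite /bil !mulmxDl mxE. Qed.
Lemma bilDr z w w' : bil Q z (w + w') = bil Q z w + bil Q z w'.
Proof. by rewrite /bil linearD mulmxDr mxE. Qed.
Lemma bilZl a z w : bil Q (a *: z) w = a * bil Q z w.
Proof. by rewrite /bil -!scalemxAl mxE. Qed.
Lemma bilZr a z w : bil Q z (a *: w) = a * bil Q z w.
Proof. by rewrite /bil linearZ -scalemxAr mxE. Qed.
Lemma bil0l w : bil Q 0 w = 0.
Proof. by rewrite /bil !mul0mx mxE. Qed.
Lemma bil0r z : bil Q z 0 = 0.
Proof. by rewrite /bil trmx0 mulmx0 mxE. Qed.
Lemma bilNl z w : bil Q (- z) w = - bil Q z w.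
Proof. by rewrite -scaleN1r bilZl mulN1r. Qed.
Lemma bilNr z w : bil Q z (- w) = - bil Q z w.
Proof. by rewrite -scaleN1r bilZr mulN1r. Qed.
Lemma bilC z w : Q^T = Q -> bil Q z w = bil Q w z.
Proof.
move=> sQ; rewrite /bil -[in RHS]sQ -[in RHS](trmxK w) -!trmx_mul mulmxA.
by rewrite [RHS]mxE.
Qed.
Definition bilE := (bilDl, bilDr, bilZl, bilZr, bilNl, bilNr, bil0l, bil0r).

Lemma bil_coord z w : bil Q z w = \sum_i (z *m Q) 0 i * w 0 i.
Proof. by rewrite /bil mxE; apply: eq_bigr => i _; rewrite [w^T _ _]mxE. Qed.

Context {V : normedModType R}.

Lemma is_derive_bil (f g : V -> 'rV[R]_m) x v df dg :
  is_derive x v f df -> is_derive x v g dg ->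
  is_derive x v (fun y => bil Q (f y) (g y) : R^o) (bil Q df (g x) + bil Q (f x) dg).
Proof.
move=> fd gd; have fQ := is_derive_linear (@rV_linear_continuous _ _ _ (mulmxr Q)) fd.
apply: (is_derive_ext (f := fun y => \sum_i (f y *m Q) 0 i * g y 0 i)).
  by move=> y; rewrite bil_coord.
rewrite !bil_coord -big_split; apply: is_derive_bigsum => i.
by apply: is_derive_mul; apply: is_derive_coord.
Qed.

Lemma Ck_bil k (O : set V) (f g : V -> 'rV[R]_m) : open O ->
  Ck k O f -> Ck k O g -> Ck k O (fun y => bil Q (f y) (g y) : R^o).
Proof.
move=> oO fk gk; have -> : (fun y => bil Q (f y) (g y) : R^o) =
    (fun y => \sum_i (f y *m Q) 0 i *: (g y 0 i : R^o)).
  by apply/funext => y; rewrite bil_coord.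
apply: Ck_sum => // i; apply: Ck_scale => //; last exact: Ck_coord.
apply: Ck_coord => //; apply: (@Ck_comp _ _ _ _ _ _ setT (mulmxr Q)) => //.
  exact: openT.
exact: Ck_linear (@rV_linear_continuous _ _ _ _).
Qed.

End Bilinear.

Section SmoothMaps.
Context {R : realType}.
Implicit Types V W : normedModType R.

Lemma smooth_on_open V W (A : set V) (f : V -> W) : open A ->
  smooth_on A f <-> forall k, Ck k A f.
Proof.
move=> oA; split=> [fA k|fA x Ax]; last by exists A, f.
apply: Ck_local => x Ax; have [U [F [openU Ux cF FE]]] := fA x Ax.
exists (A `&` U); first by [].
apply: (Ck_eq (f := F)); first exact: openI.
  by move=> y [Ay Uy]; exact: FE.
by apply: Ck_sub (cF k) => y [].
Qed.

Lemma open_interval (e : R) : open [set t : R^o | `|t| < e].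
Proof.
have -> : [set t : R^o | `|t| < e] = ball (0 : R^o) e.
  by apply/funext => t; rewrite /ball /= sub0r normrN.
have [e0|e0] := ltP 0 e; first exact: ball_open.
suff -> : ball (0 : R^o) e = set0 by exact: open0.
apply/seteqP; split=> // t; rewrite /ball /= sub0r normrN => te.
by have := le_lt_trans (normr_ge0 t) (lt_le_trans te e0); rewrite ltxx.
Qed.

Lemma path_atP V (S : set V) x u (c : R^o -> V) : path_at S x u c ->
  exists2 e : R, 0 < e & [/\ forall k, Ck k [set t : R^o | `|t| < e] c,
    forall t, `|t| < e -> S (c t), c 0 = x & is_derive (0 : R^o) (1 : R^o) c u].
Proof.
move=> [[e e0 [sc Sc]] c0 cu]; exists e => //.
have ck := (smooth_on_open _ (@open_interval e)).1 sc.
split=> //; rewrite -cu derive1E; apply: (Ck_is_derive _ (ck 1%N)).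
by rewrite /= normr0.
Qed.

Lemma path_at_intro V (S : set V) x u (c : R^o -> V) (e : R) : 0 < e ->
  (forall k, Ck k [set t : R^o | `|t| < e] c) -> (forall t, `|t| < e -> S (c t)) ->
  c 0 = x -> is_derive (0 : R^o) (1 : R^o) c u -> path_at S x u c.
Proof.
move=> e0 ck Sc c0 [_ cu]; split; rewrite // ?derive1E //.
by exists e => //; split=> //; apply/smooth_on_open => //; exact: open_interval.
Qed.

Lemma near0P (P : R^o -> Prop) : (\forall t \near (0 : R^o), P t) <->
  exists2 e : R, 0 < e & forall t : R^o, `|t| < e -> P t.
Proof.
split=> [/nbhs_ballP[e e0 He]|[e e0 He]].
  by exists e => // t te; apply: He; rewrite /ball /= sub0r normrN.
apply/nbhs_ballP; exists e => // t; rewrite /ball /= sub0r normrN; exact: He.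
Qed.

Lemma smooth_on_chain (m l : nat) (A : set 'rV[R]_m) (f : 'rV[R]_m -> 'rV[R]_l) x :
  smooth_on A f -> A x -> exists D : {linear 'rV[R]_m -> 'rV[R]_l},
    forall (c : R^o -> 'rV[R]_m) (t0 : R^o) u, is_derive t0 (1 : R^o) c u -> c t0 = x ->
      (\forall t \near t0, A (c t)) -> is_derive t0 (1 : R^o) (f \o c) (D u).
Proof.
move=> fA Ax; have [U [F [oU Ux cF FE]]] := fA x Ax.
have dF := Ck_differentiable oU (cF 1%N) Ux.
exists ('d F x) => c t0 u dc ct0 cA.
rewrite -deriveE //.
have H : is_derive t0 (1 : R^o) (F \o c) ('D_u F x).
  by rewrite -ct0; apply: is_derive_comp_diff dc; rewrite ct0.
apply: near_eq_is_derive H; have Oc : \forall t \near t0, U (c t).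
  by apply: (is_derive_continuous dc); rewrite ct0; exact: open_nbhs_nbhs.
near=> t; apply: FE; [near: t; exact: cA|near: t; exact: Oc].
Unshelve. all: by end_near. Qed.

Lemma tdiff_chain (m l : nat) (A : set 'rV[R]_m) (f : 'rV[R]_m -> 'rV[R]_l) x
    (D : {linear 'rV[R]_m -> 'rV[R]_l}) u :
  (forall (c : R^o -> 'rV[R]_m) (t0 : R^o) u, is_derive t0 (1 : R^o) c u -> c t0 = x ->
      (\forall t \near t0, A (c t)) -> is_derive t0 (1 : R^o) (f \o c) (D u)) ->
  tangent A x u -> tdiff A f x u = D u.
Proof.
move=> HD [c cP]; have HP c' : path_at A x u c' -> is_derive (0 : R^o) (1 : R^o) (f \o c') (D u).
  move=> /path_atP[e e0 [_ Ac c0 dc]]; apply: HD => //.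
  by apply/near0P; exists e.
rewrite /tdiff; case: xgetP => [w -> [c' [/HP[_ <-] _ ->]]|/(_ (D u))].
  by rewrite derive1E.
by have [d E] := HP _ cP; case; exists c; split; rewrite ?derive1E.
Qed.

Lemma tangent_open V (A : set V) x u : open A -> A x -> tangent A x u.
Proof.
move=> oA Ax; pose c (t : R^o) : V := x + t *: u.
have dc (t : R^o) : is_derive t (1 : R^o) c u.
  have H := is_deriveD (@is_derive_cst R R^o V x t 1)
    (is_derive_scale (@is_derive_id R R^o t 1) (@is_derive_cst R R^o V u t 1)).
  by rewrite scale1r scaler0 addr0 add0r in H.
have ck k : Ck k setT c.
  apply: CkD; [exact: openT|exact: Ck_cst|apply: Ck_scale; [exact: openT| |exact: Ck_cst]].
  by apply: (@Ck_linear _ _ _ _ _ idfun) => t; exact.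
have c0 : c 0 = x by rewrite /c scale0r addr0.
have : \forall t \near (0 : R^o), A (c t).
  by apply: (is_derive_continuous (dc 0)); rewrite c0; exact: open_nbhs_nbhs.
move=> /near0P[e e0 He]; exists c; apply: (path_at_intro e0) => //.
by move=> k; apply: Ck_sub (ck k).
Qed.

Lemma tdiff_open (m l : nat) (A : set 'rV[R]_m) (f : 'rV[R]_m -> 'rV[R]_l) x u :
  open A -> (forall k, Ck k A f) -> A x -> tdiff A f x u = 'D_u f x.
Proof.
move=> oA fk Ax; have dF := Ck_differentiable oA (fk 1%N) Ax.
rewrite deriveE //; apply: (tdiff_chain (A := A)); last exact: tangent_open.
move=> c t0 w dc ct0 _; rewrite -deriveE // -ct0.
by apply: is_derive_comp_diff dc; rewrite ct0.
Qed.

Lemma second_difference V (f : V -> R^o) (O : set V) x u w :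
  (forall s t : R, 0 <= s <= 1 -> 0 <= t <= 1 -> O (x + s *: u + t *: w)) ->
  Ck 2 O f -> exists s t : R, [/\ 0 <= s <= 1, 0 <= t <= 1 &
    f (x + u + w) - f (x + u) - (f (x + w) - f x) = 'D_w ('D_u f) (x + s *: u + t *: w)].
Proof.
move=> HO fk; pose F y : R^o := f (y + w) - f y.
have O0 s : 0 <= s <= 1 -> O (x + s *: u).
  by move=> s01; have := HO s 0 s01; rewrite scale0r addr0; apply; rewrite lexx ler01.
have O1 s : 0 <= s <= 1 -> O (x + s *: u + w).
  by move=> s01; have := HO s 1 s01; rewrite scale1r; apply; rewrite lexx ler01.
have dF s : 0 <= s <= 1 -> is_derive (x + s *: u) u F ('D_u f (x + s *: u + w) - 'D_u f (x + s *: u)).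
  move=> s01; apply: is_deriveB; last exact: Ck_is_derive fk (O0 _ s01).
  have := Ck_is_derive u fk (O1 _ s01) => /is_derive_line H; apply/is_derive_line.
  by apply: is_derive_ext H => h; rewrite addrAC.
have [s s01|s s01 E] := @line_mvt _ _ F x u; first by case: (dF s s01).
have [t t01|t t01 E'] := @line_mvt _ _ ('D_u f) (x + s *: u) w.
  by case: (Ck_is_derive w (Ck_derive u fk) (HO s t s01 t01)).
exists s, t; split=> //; rewrite -E'; case: (dF s s01) => _ <-.
by rewrite -E /F.
Qed.

Lemma derive_dirZ V W (f : V -> W) x v (a : R) :
  derivable f x v -> 'D_(a *: v) f x = a *: 'D_v f x.
Proof. by move=> /derivableP /(is_derive_dirZ a)[]. Qed.

Lemma schwarz_real V (f : V -> R^o) (O : set V) x u w : open O -> O x -> Ck 2 O f ->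
  'D_w ('D_u f) x = 'D_u ('D_w f) x.
Proof.
move=> oO Ox fk; apply/eqP; rewrite -subr_eq0 -normr_eq0; apply/negPn/negP => ne.
pose A u w := 'D_w ('D_u f); pose e := `|A u w x - A w u x| / 2.
have e0 : 0 < e by rewrite divr_gt0 // lt0r ne /=.
have Ak a b : Ck 0 O (A a b) by apply: Ck_derive; apply: Ck_derive.
have [r r0 Hr] := finite_continuity_radius (D := fun b : bool => if b then A u w else A w u)
  oO Ox e0 (fun b => match b with true => Ck_continuous (Ak u w) Ox
                            | false => Ck_continuous (Ak w u) Ox end).
pose M := `|u| + `|w| + 1; have M0 : 0 < M by rewrite /M; have := normr_ge0 u; have := normr_ge0 w; lra.
have [h h0 rE] : exists2 h : R, 0 < h & r = 2 * h * M.
  by exists (r / M / 2); [rewrite !divr_gt0|field; exact: lt0r_neq0].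
have small a b s t : (a = u /\ b = w) \/ (a = w /\ b = u) -> 0 <= s <= 1 -> 0 <= t <= 1 ->
    `|x + s *: (h *: a) + t *: (h *: b) - x| < r.
  move=> ab s01 t01; rewrite addrC !addrA addNr add0r.
  apply: (le_lt_trans (ler_normD _ _)); rewrite !normrZ.
  have na := normr_ge0 a; have nb := normr_ge0 b.
  rewrite rE.
  have E : `|a| + `|b| = M - 1 by rewrite /M; case: ab => -[-> ->]; ring.
  rewrite (ger0_norm (ltW h0)).
  case/andP: s01 => s0 s1; case/andP: t01 => t0 t1; rewrite !ger0_norm //.
  have : s * (h * `|a|) <= h * `|a| by rewrite ler_piMl // mulr_ge0 // ltW.
  have : t * (h * `|b|) <= h * `|b| by rewrite ler_piMl // mulr_ge0 // ltW.
  have : 0 < h * M by rewrite mulr_gt0.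
  nra.
have key a b : (a = u /\ b = w) \/ (a = w /\ b = u) -> exists2 y, `|y - x| < r &
    f (x + h *: a + h *: b) - f (x + h *: a) - (f (x + h *: b) - f x) = h * (h * A a b y).
  move=> ab.
  have [| |s [t [s01 t01 ->]]] := @second_difference V f O x (h *: a) (h *: b).
  - by move=> s t s01 t01; case: (Hr _ (small _ _ _ _ ab s01 t01)).
  - exact: fk.
  exists (x + s *: (h *: a) + t *: (h *: b)); first exact: small.
  set y := x + _ + _; have Oy : O y by case: (Hr _ (small _ _ _ _ ab s01 t01)).
  have E z : O z -> 'D_(h *: a) f z = h *: 'D_a f z.
    by move=> Oz; apply: derive_dirZ; case: (Ck_is_derive a fk Oz).
  have -> : 'D_(h *: b) ('D_(h *: a) f) y = 'D_(h *: b) (fun z => h *: 'D_a f z) y.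
    by apply: near_eq_derive; apply: filterS E _; exact: open_nbhs_nbhs.
  have db := Ck_is_derive b (Ck_derive a fk) Oy.
  have [_ ->] := is_deriveZ h (is_derive_dirZ h db).
  by [].
have [y1 y1r E1] := key u w (or_introl (conj erefl erefl)).
have [y2 y2r E2] := key w u (or_intror (conj erefl erefl)).
have E : A u w y1 = A w u y2.
  move: (A u w y1) (A w u y2) E1 E2 => a b E1 E2.
  have H : h * (h * a) = h * (h * b).
    by rewrite -E1 -E2 [x + h *: u + h *: w]addrAC; ring.
  by move/(mulfI (lt0r_neq0 h0))/(mulfI (lt0r_neq0 h0)): H.
have [_ /(_ true) /= H1] := Hr _ y1r; have [_ /(_ false) /= H2] := Hr _ y2r.
suff : `|A u w x - A w u x| < e + e by rewrite /e -splitr ltxx.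
move: H1 H2; rewrite E.
move: (A u w x) (A w u x) (A w u y2) => a b d H1 H2.
have -> : a - b = (a - d) - (b - d) by ring.
by apply: (le_lt_trans (ler_normB _ _)); exact: ltrD.
Qed.

Lemma schwarz V (l : nat) (f : V -> 'rV[R]_l) (O : set V) x u w : open O -> O x -> Ck 2 O f ->
  'D_w ('D_u f) x = 'D_u ('D_w f) x.
Proof.
move=> oO Ox fk; apply/rowP => i.
have E a b : ('D_b ('D_a f) x) 0 i = 'D_b ('D_a (fun y => f y 0 i : R^o)) x.
  have [_ <-] := is_derive_coord 0 i (Ck_is_derive b (Ck_derive a fk) Ox).
  apply: near_eq_derive; apply: filterS (open_nbhs_nbhs (conj oO Ox)) => y Oy.
  by have [_ <-] := is_derive_coord 0 i (Ck_is_derive a fk Oy).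
have gk := @Ck_coord R V 2 1 l O f 0 i oO fk.
have H := @schwarz_real V _ O x u w oO Ox gk.
exact: etrans (E u w) (etrans H (esym (E w u))).
Qed.

End SmoothMaps.

Lemma is_derive_conv (R : realType) (V W : normedModType R) (f g : V -> W) x v d d' :
  is_derive x v f d -> f =1 g -> d = d' -> is_derive x v g d'.
Proof. by move=> fd fg <-; exact: is_derive_ext fg fd. Qed.

(** * Generalised trigonometric functions *)

Section Oscillator.
Context {R : realType} (k : R).

(* The solutions of [f'' = - k f] with initial data [(1, 0)] and [(0, 1)]. *)
Definition cK (t : R^o) : R^o :=
  if k < 0 then (expR (Num.sqrt (- k) * t) + expR (- (Num.sqrt (- k) * t))) / 2
  else if 0 < k then cos (Num.sqrt k * t) else 1.

Definition sK (t : R^o) : R^o :=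
  if k < 0 then (expR (Num.sqrt (- k) * t) - expR (- (Num.sqrt (- k) * t))) / 2 / Num.sqrt (- k)
  else if 0 < k then sin (Num.sqrt k * t) / Num.sqrt k else t.

Lemma is_derive_dilate (f : R^o -> R^o) (w t d : R^o) :
  is_derive (w * t) (1 : R^o) f d -> is_derive t (1 : R^o) (fun s : R^o => f (w * s)) (w * d).
Proof.
move=> fd; have [/derivable1_diffP df _] := fd.
have gd : is_derive t (1 : R^o) (fun s : R^o => w * s : R^o) (w : R^o).
  have := is_derive_mul (@is_derive_cst R R^o R^o w t 1) (@is_derive_id R R^o t 1).
  by rewrite mul0r add0r mulr1.
have := is_derive_comp_diff df gd.
have [_ E] := is_derive_dirZ w fd.
have -> : 'D_w f (w * t) = w *: d by rewrite -E; congr ('D_ _ f _); rewrite [RHS]mulr1.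
by [].
Qed.

Lemma is_derive_c a (t : R) : is_derive (t : R^o) (1 : R^o) (fun _ : R^o => a : R^o) 0.
Proof. exact: is_derive_cst. Qed.

Lemma is_derive_expRw (w t : R^o) :
  is_derive t (1 : R^o) (fun s : R^o => expR (w * s) : R^o) (w * expR (w * t)).
Proof. by apply: (@is_derive_dilate expR); exact: is_derive_expR. Qed.

Lemma is_derive_expRNw (w t : R^o) :
  is_derive t (1 : R^o) (fun s : R^o => expR (- (w * s)) : R^o) (- w * expR (- (w * t))).
Proof.
rewrite -mulNr; apply: is_derive_ext (is_derive_expRw (- w) t) => s.
by rewrite mulNr.
Qed.

Lemma is_derive_cK (t : R^o) : is_derive t (1 : R^o) cK (- k * sK t).
Proof.
rewrite /cK /sK; case: (ltrgtP k 0) => [kN|k0|k0].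
- have w0 : Num.sqrt (- k) != 0 by rewrite gt_eqF // sqrtr_gt0 oppr_gt0.
  have E : - k = Num.sqrt (- k) * Num.sqrt (- k) by rewrite -expr2 sqr_sqrtr // oppr_ge0 ltW.
  apply: (is_derive_conv (is_derive_mul (is_deriveD (is_derive_expRw (Num.sqrt (- k)) t)
    (is_derive_expRNw (Num.sqrt (- k)) t)) (is_derive_c 2^-1 t))) => //.
  by rewrite mulr0 addr0 [X in _ = X * _]E; field.
- have w0 : Num.sqrt k != 0 by rewrite gt_eqF // sqrtr_gt0.
  have E : k = Num.sqrt k * Num.sqrt k by rewrite -expr2 sqr_sqrtr // ltW.
  apply: (is_derive_conv (@is_derive_dilate cos (Num.sqrt k) t _ (is_derive_cos _))) => //.
  by rewrite [X in _ = - X * _]E; field.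
- by rewrite k0 oppr0 mul0r; exact: is_derive_cst.
Qed.

Lemma is_derive_sK (t : R^o) : is_derive t (1 : R^o) sK (cK t).
Proof.
rewrite /cK /sK; case: (ltrgtP k 0) => [kN|k0|k0].
- have w0 : Num.sqrt (- k) != 0 by rewrite gt_eqF // sqrtr_gt0 oppr_gt0.
  apply: (is_derive_conv (is_derive_mul (is_deriveB (is_derive_expRw (Num.sqrt (- k)) t)
    (is_derive_expRNw (Num.sqrt (- k)) t)) (is_derive_c (2^-1 / Num.sqrt (- k)) t))).
    by move=> s; rewrite [LHS]mulrA.
  by rewrite mulr0 addr0; field.
- have w0 : Num.sqrt k != 0 by rewrite gt_eqF // sqrtr_gt0.
  apply: (is_derive_conv (is_derive_mul (@is_derive_dilate sin (Num.sqrt k) t _ (is_derive_sin _))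
    (is_derive_c (Num.sqrt k)^-1 t))) => //.
  by field.
- exact: is_derive_id.
Qed.

Lemma cK0 : cK 0 = 1.
Proof.
rewrite /cK !mulr0 oppr0 expR0 cos0; case: ifP => _; last by case: ifP.
by field.
Qed.

Lemma sK0 : sK 0 = 0.
Proof. by rewrite /sK !mulr0 oppr0 expR0 sin0 subrr !mul0r; do 2?case: ifP. Qed.

Lemma cK_sK t : cK t ^+ 2 + k * sK t ^+ 2 = 1.
Proof.
rewrite /cK /sK; case: (ltrgtP k 0) => [kN|k0|k0]; last by rewrite k0 mul0r addr0 expr1n.
- have w0 : Num.sqrt (- k) != 0 by rewrite gt_eqF // sqrtr_gt0 oppr_gt0.
  set w := Num.sqrt (- k) in w0 *; have E : k = - (w * w).
    by rewrite -expr2 sqr_sqrtr ?opprK // oppr_ge0 ltW.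
  have := expRxMexpNx_1 (w * t); set x := expR _; set y := expR _ => xy.
  transitivity (x * y) => //; rewrite E; field.
  exact: w0.
- have w0 : Num.sqrt k != 0 by rewrite gt_eqF // sqrtr_gt0.
  have := cos2Dsin2 (Num.sqrt k * t) => <-; congr (_ + _).
  set w := Num.sqrt k in w0 *; have E : k = w * w by rewrite -expr2 sqr_sqrtr // ltW.
  by rewrite E; field.
Qed.

Lemma Ck_cK_sK m (O : set R^o) : Ck m O cK /\ Ck m O sK.
Proof.
suff [H1 H2] : Ck m setT cK /\ Ck m setT sK by split; [apply: Ck_sub H1|apply: Ck_sub H2].
have cc (t : R^o) : {for t, continuous cK} := is_derive_continuous (is_derive_cK t).
have cs (t : R^o) : {for t, continuous sK} := is_derive_continuous (is_derive_sK t).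
elim: m => [|m [IHc IHs]]; first by split; split.
split.
- apply: (CkS_der (D := fun (u t : R^o) => u *: (- k * sK t))) => //; first exact: openT.
    move=> u t _; have := is_derive_dirZ u (is_derive_cK t).
    by rewrite [u *: (1 : R^o)]mulr1.
  move=> u; apply: Ck_scale; [exact: openT|exact: Ck_cst|].
  by apply: Ck_scale; [exact: openT|exact: Ck_cst|].
- apply: (CkS_der (D := fun (u t : R^o) => u *: cK t)) => //; first exact: openT.
    move=> u t _; have := is_derive_dirZ u (is_derive_sK t).
    by rewrite [u *: (1 : R^o)]mulr1.
  by move=> u; apply: Ck_scale; [exact: openT|exact: Ck_cst|].
Qed.

Lemma derive0_constant (m : nat) (f : R^o -> 'rV[R]_m) t :
  (forall s, is_derive s (1 : R^o) f 0) -> f t = f 0.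
Proof.
move=> fd; apply/rowP => i; apply: (@is_derive_0_is_cst R (fun s => f s 0 i)) => s.
by have := is_derive_coord 0 i (fd s); rewrite mxE.
Qed.

(* Both [C f - S f'] and [k S f + C f'] are constant. *)
Lemma oscillator_unique (m : nat) (f g : R^o -> 'rV[R]_m) :
  (forall t, is_derive t (1 : R^o) f (g t)) ->
  (forall t, is_derive t (1 : R^o) g (- k *: f t)) ->
  forall t, f t = cK t *: f 0 + sK t *: g 0.
Proof.
move=> fd gd t.
have A : cK t *: f t - sK t *: g t = f 0.
  have -> : f 0 = cK 0 *: f 0 - sK 0 *: g 0 by rewrite cK0 sK0 scale1r scale0r subr0.
  apply: (@derive0_constant m (fun t => cK t *: f t - sK t *: g t)) => s.
  have := is_deriveB (is_derive_scale (is_derive_cK s) (fd s))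
                     (is_derive_scale (is_derive_sK s) (gd s)).
  move=> H'; apply: (is_derive_conv H') => //; apply/rowP => i; rewrite !mxE; ring.
have B : (k * sK t) *: f t + cK t *: g t = g 0.
  have -> : g 0 = (k * sK 0) *: f 0 + cK 0 *: g 0 by rewrite cK0 sK0 mulr0 scale1r scale0r add0r.
  apply: (@derive0_constant m (fun t => (k * sK t) *: f t + cK t *: g t)) => s.
  have H : is_derive s (1 : R^o) (fun s : R^o => k * sK s : R^o) (k * cK s).
    have := is_derive_mul (is_derive_c k s) (is_derive_sK s).
    by rewrite mul0r add0r.
  have := is_deriveD (is_derive_scale H (fd s)) (is_derive_scale (is_derive_cK s) (gd s)).
  move=> H'; apply: (is_derive_conv H') => //; apply/rowP => i; rewrite !mxE; ring.
rewrite -[LHS]scale1r -(cK_sK t) -A -B; apply/rowP => i; rewrite !mxE; ring.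
Qed.

Lemma oscillator_unique_real (f g : R^o -> R^o) :
  (forall t, is_derive t (1 : R^o) f (g t)) ->
  (forall t, is_derive t (1 : R^o) g (- k * f t)) ->
  forall t, f t = cK t * f 0 + sK t * g 0.
Proof.
move=> fd gd t.
have H := @oscillator_unique 1 (fun s => const_mx (f s)) (fun s => const_mx (g s)).
have E u : const_mx (f u) = cK u *: const_mx (f 0) + sK u *: const_mx (g 0) :> 'rV[R]_1.
  apply: H => s; apply: is_derive_mx => i j; rewrite mxE.
    by apply: is_derive_ext (fd s) => r; rewrite mxE.
  by rewrite mxE; apply: is_derive_ext (gd s) => r; rewrite mxE.
by have /rowP/(_ 0) := E t; rewrite !mxE.
Qed.

Lemma is_derive_translate (W : normedModType R) (f : R^o -> W) (s t : R^o) d :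
  is_derive (t + s) (1 : R^o) f d -> is_derive t (1 : R^o) (fun u : R^o => f (u + s)) d.
Proof.
move=> fd; have gd := is_deriveD (@is_derive_id R R^o t 1) (@is_derive_cst R R^o R^o s t 1).
have [/derivable1_diffP df E] := fd.
have := is_derive_comp_diff (F := f) (g := fun u : R^o => u + s : R^o) df gd.
by rewrite addr0 E.
Qed.

Lemma sKD t s : sK (t + s) = cK t * sK s + sK t * cK s.
Proof.
have := @oscillator_unique_real (fun u => sK (u + s)) (fun u => cK (u + s)).
rewrite add0r; apply=> u; apply: is_derive_translate.
  exact: is_derive_sK.
exact: is_derive_cK.
Qed.

Lemma cKD t s : cK (t + s) = cK t * cK s - k * (sK t * sK s).
Proof.
have -> : cK t * cK s - k * (sK t * sK s) = cK t * cK s + sK t * (- k * sK s) by ring.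
have := @oscillator_unique_real (fun u => cK (u + s)) (fun u => - k * sK (u + s)).
rewrite add0r; apply=> u.
  exact/is_derive_translate/is_derive_cK.
have := is_derive_mul (is_derive_c (- k) u) (is_derive_translate (is_derive_sK (u + s))).
by rewrite mul0r add0r.
Qed.

Lemma cKN t : cK (- t) = cK t.
Proof.
by rewrite /cK !mulrN opprK cosN; case: ifP => // _; rewrite addrC.
Qed.

Lemma sKN t : sK (- t) = - sK t.
Proof.
rewrite /sK !mulrN opprK sinN; do 2?[case: ifP => _] => //; last by rewrite mulNr.
by rewrite -!mulNr opprB.
Qed.

Lemma sK_gt0 t : 0 < t -> (t%:E < Tk k)%E -> 0 < sK t.
Proof.
rewrite /sK /Tk; case: (ltrgtP k 0) => [kN|k0|k0] t0 // tT.
- have w0 : 0 < Num.sqrt (- k) by rewrite sqrtr_gt0 oppr_gt0.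
  rewrite !divr_gt0 // subr_gt0 ltr_expR; have := mulr_gt0 w0 t0; lra.
- have w0 : 0 < Num.sqrt k by rewrite sqrtr_gt0.
  rewrite divr_gt0 // sin_gt0_pi // mulr_gt0 //=.
  by rewrite mulrC -ltr_pdivlMr // -lte_fin.
Qed.

Lemma sK_eq0 t : (`|t|%:E < Tk k)%E -> sK t = 0 -> t = 0.
Proof.
case: (ltrgtP t 0) => // [tN|t0].
  rewrite ltr0_norm // => tT /eqP; rewrite -oppr_eq0 -sKN.
  by rewrite gt_eqF // sK_gt0 // oppr_gt0.
by rewrite gtr0_norm // => tT /eqP; rewrite gt_eqF // sK_gt0.
Qed.

Lemma Tk_gt0 : (0 < Tk k)%E.
Proof.
by rewrite /Tk; case: ifP => // k0; rewrite lte_fin divr_gt0 ?pi_gt0 ?sqrtr_gt0.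
Qed.

Lemma cK_pi : 0 < k -> cK (pi / Num.sqrt k) = -1.
Proof.
move=> k0; rewrite /cK ltNge (ltW k0) /= k0 mulrC divfK ?cospi //.
by rewrite gt_eqF // sqrtr_gt0.
Qed.

Lemma sK_pi : 0 < k -> sK (pi / Num.sqrt k) = 0.
Proof.
move=> k0; rewrite /sK ltNge (ltW k0) /= k0 [X in sin X]mulrC divfK ?sinpi ?mul0r //.
by rewrite gt_eqF // sqrtr_gt0.
Qed.

Lemma cK_gt0 t : k <= 0 -> 0 < cK t.
Proof.
move=> k0; rewrite /cK; case: ifP => _; last by rewrite (ltNge 0 k) k0 ltr01.
by rewrite divr_gt0 // addr_gt0 // expR_gt0.
Qed.

Lemma cK_sK_surj (c s : R) : k < 0 -> 0 < c -> c ^+ 2 + k * s ^+ 2 = 1 ->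
  exists t, cK t = c /\ sK t = s.
Proof.
move=> k0 c0 cs; have w0 : 0 < Num.sqrt (- k) by rewrite sqrtr_gt0 oppr_gt0.
have E : k = - (Num.sqrt (- k) * Num.sqrt (- k)).
  by rewrite -expr2 sqr_sqrtr ?opprK // oppr_ge0 ltW.
pose w := Num.sqrt (- k); rewrite -/w in w0 E.
have W : (c + w * s) * (c - w * s) = 1 by rewrite -cs E; ring.
have P : 0 < c + w * s.
  case: (ltrgtP (c + w * s) 0) => // H; last by move: W; rewrite H mul0r => /eqP; rewrite eq_sym oner_eq0.
  have : 0 < c - w * s by nra.
  move=> H'; have : (c + w * s) * (c - w * s) < 0 by rewrite nmulr_rlt0.
  by rewrite W; lra.
have wT : w * (ln (c + w * s) / w) = ln (c + w * s) by rewrite mulrC divfK ?gt_eqF.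
exists (ln (c + w * s) / w); rewrite /cK /sK k0 -/w wT expRN lnK ?posrE //.
have -> : (c + w * s)^-1 = c - w * s.
  by apply: (mulfI (lt0r_neq0 P)); rewrite mulfV ?gt_eqF.
by split; field; rewrite ?gt_eqF.
Qed.

End Oscillator.

(** * Space forms as quadrics *)

(* Each space form is realised as a piece of the quadric [bil mQ z z = 1] of a
   vector space of dimension [n + 2]. The form [mB] induces the metric; it
   satisfies [mQ = kappa mB] unless [kappa = 0], when the quadric is a pair of
   affine hyperplanes. In all cases geodesics are linear combinations of
   [mX p] and of their initial velocity. *)
Record linear_model (R : realType) (n : nat) (kappa : R) := LinearModel {
  mX : ambient n kappa -> 'rV[R]_n.+2;
  mY : 'rV[R]_n.+2 -> ambient n kappa;
  domX : set (ambient n kappa);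
  domY : set 'rV[R]_n.+2;
  mQ : 'M[R]_n.+2;
  mB : 'M[R]_n.+2;
  vol_cst : R;
  open_domX : open domX;
  open_domY : open domY;
  Mk_domX : forall x, Mk x -> domX x;
  Ck_mX : forall k, Ck k domX mX;
  Ck_mY : forall k, Ck k domY mY;
  mXK : forall x, domX x -> mY (mX x) = x;
  domY_mX : forall x, Mk x -> domY (mX x);
  mYK : forall z, domY z -> bil mQ z z = 1 -> Mk (mY z) /\ mX (mY z) = z;
  mQ_sym : mQ^T = mQ;
  mB_sym : mB^T = mB;
  mQ_mX : forall x, Mk x -> bil mQ (mX x) (mX x) = 1;
  mQ_flat : forall x y, kappa = 0 -> Mk x -> Mk y -> bil mQ (mX x) (mX y) = 1;
  mQB : kappa *: mQ = kappa ^+ 2 *: mB;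
  mQ_tangent : forall x xi zeta, Mk x -> bil mQ (mX x) xi = 0 ->
    bil mQ xi zeta = kappa * bil mB xi zeta;
  metricE : forall x u w, Mk x -> metric x u w = bil mB ('D_u mX x) ('D_w mX x);
  connE : forall x u w z, Mk x ->
    bil mB ('D_u ('D_w mX) x) ('D_z mX x) = metric x (christoffel x u w) z;
  domY_geod : forall x xi t, Mk x -> bil mQ (mX x) xi = 0 -> bil mB xi xi = 1 ->
    domY (cK kappa t *: mX x + sK kappa t *: xi);
  vol_cst_neq0 : vol_cst != 0;
  volE : forall x (u : 'I_n.+1 -> ambient n kappa), Mk x ->
    volume_form x u = vol_cst *
      \det (\matrix_(i < n.+2, j < n.+2)
        (if insub (i : nat) is Some k then 'D_(u k) mX x else mX x) 0 j)
}.

Arguments open_domX {R n kappa} l.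
Arguments open_domY {R n kappa} l.
Arguments Mk_domX {R n kappa} l {x}.
Arguments domY_mX {R n kappa} l {x}.
Arguments mYK {R n kappa} l {z}.
Arguments mXK {R n kappa} l {x}.
Arguments mQ_mX {R n kappa} l {x}.
Arguments mQ_flat {R n kappa} l {x y}.
Arguments mQ_tangent {R n kappa} l {x xi} zeta.
Arguments metricE {R n kappa} l {x} u w.
Arguments connE {R n kappa} l {x} u w z.
Arguments domY_geod {R n kappa} l {x xi} t.
Arguments volE {R n kappa} l {x} u.
Arguments Ck_mX {R n kappa} l k.
Arguments Ck_mY {R n kappa} l k.

Section DirectionalDerivative.
Context {R : realType}.

Lemma derive_directionD (m l : nat) (G : 'rV[R]_m -> 'rV[R]_l) x u w :
  differentiable G x -> 'D_(u + w) G x = 'D_u G x + 'D_w G x.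
Proof. by move=> dG; rewrite !deriveE // linearD. Qed.

Lemma derive_directionZ (m l : nat) (G : 'rV[R]_m -> 'rV[R]_l) x (a : R) u :
  differentiable G x -> 'D_(a *: u) G x = a *: 'D_u G x.
Proof. by move=> dG; rewrite !deriveE // linearZ. Qed.

Lemma is_derive_moving_direction (m l : nat) (O : set 'rV[R]_m) (G : 'rV[R]_m -> 'rV[R]_l)
    (c w : R^o -> 'rV[R]_m) t c' w' :
  open O -> Ck 2 O G -> O (c t) ->
  is_derive t (1 : R^o) c c' -> is_derive t (1 : R^o) w w' ->
  is_derive t (1 : R^o) (fun s => 'D_(w s) G (c s)) ('D_w' G (c t) + 'D_c' ('D_(w t) G) (c t)).
Proof.
move=> oO Gk Oc dc dw.
have dG y : O y -> differentiable G y by exact: Ck_differentiable oO Gk.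
have dDG u : differentiable ('D_u G) (c t) := Ck_differentiable oO (Ck_derive u Gk) Oc.
have nearO : \forall s \near t, O (c s).
  by apply: (is_derive_continuous dc); exact: open_nbhs_nbhs.
have H : is_derive t (1 : R^o)
    (fun s => \sum_i (w s) 0 i *: 'D_(delta_mx 0 i) G (c s))
    (\sum_i (w' 0 i *: 'D_(delta_mx 0 i) G (c t)
            + (w t) 0 i *: 'D_c' ('D_(delta_mx 0 i) G) (c t))).
  apply: is_derive_bigsum => i; apply: is_derive_scale; first exact: is_derive_coord.
  exact: is_derive_comp_diff (dDG _) dc.
have E : 'D_w' G (c t) + 'D_c' ('D_(w t) G) (c t) = \sum_i (w' 0 i *: 'D_(delta_mx 0 i) G (c t)
            + (w t) 0 i *: 'D_c' ('D_(delta_mx 0 i) G) (c t)).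
  rewrite big_split /= -(derive_sum_coord w' (dG _ Oc)); congr (_ + _).
  have K : is_derive (c t) c' (fun y => \sum_i (w t) 0 i *: 'D_(delta_mx 0 i) G y)
      (\sum_i (w t) 0 i *: 'D_c' ('D_(delta_mx 0 i) G) (c t)).
    apply: is_derive_bigsum => i; apply: is_deriveZ.
    by apply/derivableP/diff_derivable/dDG.
  case: K => _ <-; apply: near_eq_derive.
  apply: filterS (open_nbhs_nbhs (conj oO Oc)) => y Oy.
  exact: derive_sum_coord (dG _ Oy).
rewrite E; apply: near_eq_is_derive H.
by apply: filterS nearO => s Os; rewrite -derive_sum_coord //; exact: dG.
Qed.

End DirectionalDerivative.

Section Model.
Context {R : realType} (n : nat) (kappa : R) (M : linear_model n kappa).
Local Notation A := (ambient n kappa).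
Local Notation E := 'rV[R]_n.+2.
Local Notation X := (mX M).
Local Notation Y := (mY M).
Local Notation q := (bil (mQ M)).
Local Notation b := (bil (mB M)).
Local Notation Mk := (@Mk R n kappa).
Implicit Types (x p u w : A) (z xi zeta : E).

Lemma qC z zeta : q z zeta = q zeta z.
Proof. exact: bilC (mQ_sym M). Qed.

Lemma bC z zeta : b z zeta = b zeta z.
Proof. exact: bilC (mB_sym M). Qed.

Lemma qb z zeta : kappa * q z zeta = kappa ^+ 2 * b z zeta.
Proof.
have H : (kappa *: mQ M) = (kappa ^+ 2 *: mB M) by exact: mQB.
have E1 (a : R) (Q : 'M[R]_(n.+2)) : bil (a *: Q) z zeta = a * bil Q z zeta.
  by rewrite /bil -scalemxAr -scalemxAl mxE.
by rewrite -!E1 H.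
Qed.

Lemma qb_neq0 z zeta : kappa != 0 -> q z zeta = kappa * b z zeta.
Proof. by move=> k0; apply: (mulfI k0); rewrite qb; ring. Qed.

Lemma edot_ge0 u : 0 <= edot u u.
Proof. by apply: sumr_ge0 => i _; rewrite -expr2 sqr_ge0. Qed.

Lemma edot_eq0 u : edot u u = 0 -> u = 0.
Proof.
move=> /eqP; rewrite psumr_eq0 => [/allP H|i _]; last by rewrite -expr2 sqr_ge0.
apply/rowP => i; rewrite mxE; apply/eqP.
by have := H i (mem_index_enum _); rewrite -expr2 sqrf_eq0.
Qed.

Lemma Mk_halfspace x : kappa < 0 -> Mk x -> 0 < x 0 ord0.
Proof.
move=> k0; have E : (0 < kappa) = false by apply/negbTE; rewrite -leNgt ltW.
have H (c : bool) (P Q : Prop) : c = false -> (if c then P else Q) -> Q by move=> ->.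
by rewrite /Defs.Mk /mkset => /(H _ _ _ E); apply.
Qed.

Lemma conf_gt0 x : Mk x -> 0 < conf x.
Proof.
rewrite /conf => Mx; case: (ltP kappa 0) => // k0.
by rewrite invr_gt0 mulr_gt0 ?oppr_gt0 // exprn_gt0 // Mk_halfspace.
Qed.

Lemma metric_ge0 x u : Mk x -> 0 <= metric x u u.
Proof. by move=> Mx; rewrite mulr_ge0 ?edot_ge0 // ltW // conf_gt0. Qed.

Lemma metric_eq0 x u : Mk x -> metric x u u = 0 -> u = 0.
Proof.
move=> /conf_gt0 c0 /eqP; rewrite mulf_eq0 gt_eqF //= => /eqP; exact: edot_eq0.
Qed.

Lemma X_differentiable x : Mk x -> differentiable X x.
Proof.
move=> Mx; apply: (Ck_differentiable (open_domX M) (Ck_mX M 1%N)); exact: Mk_domX.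
Qed.

Lemma Y_differentiable z : domY M z -> differentiable Y z.
Proof. exact: (Ck_differentiable (open_domY M) (Ck_mY M 1%N)). Qed.

Lemma dXD x u w : Mk x -> 'D_(u + w) X x = 'D_u X x + 'D_w X x.
Proof. by move=> Mx; apply: derive_directionD; exact: X_differentiable. Qed.

Lemma dXZ x (a : R) u : Mk x -> 'D_(a *: u) X x = a *: 'D_u X x.
Proof. by move=> Mx; apply: derive_directionZ; exact: X_differentiable. Qed.

Lemma dXB x u w : Mk x -> 'D_(u - w) X x = 'D_u X x - 'D_w X x.
Proof. by move=> Mx; rewrite dXD // -scaleN1r dXZ // scaleN1r. Qed.

Lemma chain_X (c : R^o -> A) (t : R^o) u : Mk (c t) ->
  is_derive t (1 : R^o) c u -> is_derive t (1 : R^o) (X \o c) ('D_u X (c t)).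
Proof. by move=> Mc; apply: is_derive_comp_diff; exact: X_differentiable. Qed.

Lemma chain_Y (Z : R^o -> E) (t : R^o) xi : domY M (Z t) ->
  is_derive t (1 : R^o) Z xi -> is_derive t (1 : R^o) (Y \o Z) ('D_xi Y (Z t)).
Proof. by move=> DZ; apply: is_derive_comp_diff; exact: Y_differentiable. Qed.

Lemma dYK x u : Mk x -> 'D_('D_u X x) Y (X x) = u.
Proof.
move=> Mx; have dX := is_derive_differentiable u (X_differentiable Mx).
rewrite -deriveE in dX; last exact: X_differentiable.
have H := is_derive_comp_diff (Y_differentiable (domY_mX M Mx)) dX.
apply: is_derive_unique H _; apply: near_eq_is_derive (@is_derive_id _ _ x u).
have Dx : domX M x by exact: Mk_domX.
apply: filterS (open_nbhs_nbhs (conj (open_domX M) Dx)) => y Dy.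
by rewrite /= mXK.
Qed.

Lemma dX_inj x u w : Mk x -> 'D_u X x = 'D_w X x -> u = w.
Proof. by move=> Mx H; rewrite -(dYK u Mx) H dYK. Qed.

Lemma X_inj x y : Mk x -> Mk y -> X x = X y -> x = y.
Proof. by move=> Mx My H; rewrite -(mXK M (Mk_domX M Mx)) H mXK //; exact: Mk_domX. Qed.

Lemma lift_path (S : set A) x (Z : R^o -> E) xi (e : R) :
  Mk x -> 0 < e -> (forall k, Ck k [set t : R^o | `|t| < e] Z) ->
  (forall t : R^o, `|t| < e -> q (Z t) (Z t) = 1) ->
  (forall t : R^o, `|t| < e -> domY M (Z t) -> S (Y (Z t))) ->
  Z 0 = X x -> is_derive (0 : R^o) (1 : R^o) Z xi ->
  path_at S x ('D_xi Y (X x)) (Y \o Z) /\ 'D_('D_xi Y (X x)) X x = xi.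
Proof.
move=> Mx e0 Zk qZ SZ Z0 dZ; have DZ0 : domY M (Z 0) by rewrite Z0; exact: domY_mX.
have dYZ := chain_Y DZ0 dZ; rewrite Z0 in dYZ.
have YZ0 : (Y \o Z) 0 = x by rewrite /= Z0 mXK //; exact: Mk_domX.
have : \forall t \near (0 : R^o), domY M (Z t).
  by apply: (is_derive_continuous dZ); apply: open_nbhs_nbhs; split=> //; exact: open_domY.
move=> /near0P[e1 e10 De1].
have em0 : 0 < Num.min e e1 by rewrite lt_min e0.
have emP t : `|t| < Num.min e e1 -> `|t| < e /\ `|t| < e1 by rewrite lt_min => /andP.
split.
  apply: (path_at_intro em0) => //.
    move=> k; apply: (Ck_comp (@open_interval R _) (open_domY M) _ (Ck_mY M k)).
      by move=> t /emP[_ /De1].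
    by apply: Ck_sub (Zk k) => t /emP[].
  by move=> t /emP[te /De1]; exact: SZ.
apply: is_derive_unique dZ.
have := @chain_X (Y \o Z) 0 _ _ dYZ; rewrite YZ0 => /(_ Mx).
apply: near_eq_is_derive; apply/near0P; exists (Num.min e e1) => // t /emP[te /De1 Dt].
by case: (mYK M Dt (qZ t te)).
Qed.

Lemma path_X (S : set A) x u c : S `<=` Mk -> path_at S x u c ->
  is_derive (0 : R^o) (1 : R^o) (X \o c) ('D_u X x).
Proof.
move=> SM /path_atP[e e0 [_ Sc c0 dc]]; rewrite -c0; apply: chain_X => //.
by apply/SM/Sc; rewrite normr0.
Qed.

Lemma path_q0 (S : set A) x u c : S `<=` Mk -> path_at S x u c ->
  Mk x /\ q (X x) ('D_u X x) = 0.
Proof.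
move=> SM cP; have := path_X SM cP; have [e e0 [_ Sc c0 dc]] := path_atP cP.
have Mc t : `|t| < e -> Mk (c t) by move=> /Sc/SM.
have Mx : Mk x by rewrite -c0; apply: Mc; rewrite normr0.
move=> dXc; split=> //.
have := is_derive_bil (mQ M) dXc dXc.
rewrite /= c0 qC => H; have H0 : is_derive (0 : R^o) (1 : R^o) (fun t => q (X (c t)) (X (c t)) : R^o) 0.
  apply: near_eq_is_derive (@is_derive_cst R R^o R^o 1 0 1).
  by apply/near0P; exists e => // t te; rewrite mQ_mX //; exact: Mc.
have := is_derive_unique H H0; rewrite /=; lra.
Qed.

Lemma quadric_path x xi : Mk x -> q (X x) xi = 0 ->
  exists2 u, tangent Mk x u & 'D_u X x = xi.
Proof.
move=> Mx q0; pose c := q xi xi.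
pose d (t : R^o) : R^o := 1 + c / 4 * t * t.
pose Z (t : R^o) : E := (d t)^-1 *: ((1 - c / 4 * t * t) *: X x + t *: xi).
have idk m O : Ck m O (fun t : R^o => t).
  by apply: (@Ck_linear _ _ _ _ _ idfun) => t; exact.
have oT : open (setT : set R^o) by exact: openT.
have dk m : Ck m setT d.
  apply: CkD => //; first exact: Ck_cst.
  by do 2 (apply: Ck_scale => //); exact: Ck_cst.
have d0 : d 0 = 1 by rewrite /d mulr0 addr0.
have : \forall t \near (0 : R^o), d t > 0.
  have cd := Ck_continuous (dk 0%N) (I : setT (0 : R^o)).
  have /cvgrPdist_lt/(_ 1 ltr01) := cd; apply: filterS => t; rewrite d0 ltr_norml.
  by move=> /andP[_]; lra.
move=> /near0P[e e0 He].
have Zk m : Ck m [set t : R^o | `|t| < e] Z.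
  have oI := @open_interval R e.
  apply: Ck_scale => //.
    by apply: Ck_inv => // [t /He d1|]; [rewrite gt_eqF|apply: Ck_sub (dk m)].
  apply: CkD => //; apply: Ck_scale => //; try exact: Ck_cst.
  have -> : (fun t : R^o => 1 - c / 4 * t * t) = (fun t : R^o => 1 + (- (c / 4)) *: t *: t).
    by apply/funext => t; rewrite -!mulNr.
  apply: CkD => //; first exact: Ck_cst.
  by do 2 (apply: Ck_scale => //); exact: Ck_cst.
have Z0 : Z 0 = X x by rewrite /Z d0 invr1 scale1r mulr0 subr0 scale1r scale0r addr0.
have dZ : is_derive (0 : R^o) (1 : R^o) Z xi.
  have id0 := @is_derive_id R R^o (0 : R^o) 1.
  have dc a := @is_derive_cst R R^o R^o (a : R^o) (0 : R^o) 1.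
  have dcE a := @is_derive_cst R R^o E (a : E) (0 : R^o) 1.
  have dd := is_deriveD (dc 1) (is_derive_mul (is_derive_mul (dc (c / 4)) id0) id0).
  have dn := is_deriveB (dc 1) (is_derive_mul (is_derive_mul (dc (c / 4)) id0) id0).
  have d00 : d 0 != 0 by rewrite d0 oner_neq0.
  have := is_derive_scale (is_derive_inv d00 dd)
    (is_deriveD (is_derive_scale dn (dcE (X x))) (is_derive_scale id0 (dcE xi))).
  move=> H; apply: (is_derive_conv H) => //.
  by apply/rowP => i; rewrite !mxE /= d0; field.
have qZ (t : R^o) : `|t| < e -> q (Z t) (Z t) = 1.
  move=> /He dt; rewrite /Z !bilE (qC xi (X x)) q0 mQ_mX // -/c /d.
  have dn : 1 + c / 4 * t * t != 0 by rewrite gt_eqF.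
  have c4 : c = 4 * (c / 4) by field.
  by move: (c / 4) dn c4 => c' dn ->; field.
have [cP dE] := @lift_path Mk x Z xi e Mx e0 Zk qZ
  (fun t te Dt => (mYK M Dt (qZ t te)).1) Z0 dZ.
by exists ('D_xi Y (X x)) => //; exists (Y \o Z).
Qed.

Lemma tangentMk x u : tangent Mk x u <-> Mk x /\ q (X x) ('D_u X x) = 0.
Proof.
split=> [[c cP]|[Mx /(quadric_path Mx)[w wT wE]]]; first exact: path_q0 cP.
by rewrite -(dX_inj Mx wE).
Qed.

Lemma b_ge0 x xi : Mk x -> q (X x) xi = 0 -> 0 <= b xi xi.
Proof. by move=> Mx /(quadric_path Mx)[w _ <-]; rewrite -metricE // metric_ge0. Qed.

Lemma b_eq0 x xi : Mk x -> q (X x) xi = 0 -> b xi xi = 0 -> xi = 0.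
Proof.
move=> Mx /(quadric_path Mx)[w _ <-]; rewrite -metricE // => /(metric_eq0 Mx) ->.
by rewrite -(scale0r (0 : A)) dXZ // scale0r.
Qed.

Lemma b_X x xi : Mk x -> q (X x) xi = 0 -> kappa * b (X x) xi = 0.
Proof. by move=> Mx q0; rewrite bC -(mQ_tangent M _ Mx q0) qC. Qed.

End Model.

Section Geodesics.
Context {R : realType} (n : nat) (kappa : R) (M : linear_model n kappa).
Local Notation A := (ambient n kappa).
Local Notation E := 'rV[R]_n.+2.
Local Notation X := (mX M).
Local Notation Y := (mY M).
Local Notation q := (bil (mQ M)).
Local Notation b := (bil (mB M)).
Local Notation Mk := (@Mk R n kappa).
Implicit Types (x p u w : A) (xi zeta : E).

Lemma tprojP (S : set A) p w :
  (exists2 y, tangent S p y & forall z, tangent S p z -> metric p (w - y) z = 0) ->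
  tangent S p (tproj S p w) /\
  forall z, tangent S p z -> metric p (tproj S p w) z = metric p w z.
Proof.
move=> [y Ty yP]; rewrite /tproj; case: xgetP => [y' -> [Ty' yP']|/(_ y)]; last by case.
split=> // z /yP'; rewrite /metric /edot => /eqP.
under eq_bigr do rewrite !mxE mulrBl.
by rewrite sumrB mulrBr subr_eq0 => /eqP.
Qed.

Lemma tproj_MkP p w : Mk p ->
  tangent Mk p (tproj Mk p w) /\
  forall z, tangent Mk p z -> metric p (tproj Mk p w) z = metric p w z.
Proof.
move=> Mp; apply: tprojP.
pose zeta := 'D_w X p; have [|y Ty yE] := @quadric_path _ _ _ M p (zeta - q (X p) zeta *: X p) Mp.
  by rewrite !bilE mQ_mX // mulr1 subrr.
exists y => // z /(tangentMk M)[_ qz].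
rewrite (metricE M) // dXB // yE -/zeta opprB addrC addrNK bilZl.
have [k0|k0] := eqVneq kappa 0; last first.
  by have /eqP := b_X Mp qz; rewrite mulf_eq0 (negbTE k0) /= => /eqP ->; rewrite mulr0.
suff -> : q (X p) zeta = 0 by rewrite mul0r.
have oM : open Mk.
  suff -> : Mk = setT by exact: openT.
  apply/seteqP; split=> // y' _; rewrite /Defs.Mk /mkset.
  have H (c d : bool) (P Q : Prop) : c = false -> d = false -> (if c then P else (d -> Q)) by move=> -> ->.
  by apply: (H _ (kappa < 0)); rewrite k0 ltxx.
by case: (tangentMk M p w).1 => //; exact: tangent_open.
Qed.

Lemma tproj_Mk_eq0 p w : Mk p ->
  tproj Mk p w = 0 <-> forall z, tangent Mk p z -> metric p w z = 0.
Proof.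
move=> Mp; have [Tt tE] := tproj_MkP w Mp; split=> [t0 z Tz|H].
  rewrite -tE // t0 /metric /edot big1 ?mulr0 // => i _.
  by rewrite mxE mul0r.
by apply: (metric_eq0 Mp); rewrite tE // H.
Qed.

Lemma derive2_derive1 (V : normedModType R) (c : R^o -> V) (t : R^o) :
  Ck 2 setT c -> is_derive t (1 : R^o) (derive1 c) (derive1n 2 c t) /\
    is_derive t (1 : R^o) c (derive1 c t).
Proof.
move=> ck; have E : derive1 c = 'D_1 c by apply/funext => s; rewrite derive1E.
rewrite derive1nS /= derive1E !E; split; last exact: (Ck_is_derive _ ck I).
exact: (Ck_is_derive _ (Ck_derive _ ck) I).
Qed.

(* What the embedding [mX] shares with its composites with isometries. *)
Definition isometric_immersion (G : A -> E) : Prop :=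
  [/\ exists O, [/\ open O, forall x, Mk x -> O x & Ck 2 O G],
      forall x, Mk x -> q (G x) (G x) = 1,
      forall x u z, Mk x -> tangent Mk x u -> q (G x) ('D_u G x) = 0 /\
        q ('D_u G x) z = kappa * b ('D_u G x) z,
      forall x u w, Mk x -> metric x u w = b ('D_u G x) ('D_w G x) &
      (forall x u w z, Mk x ->
        b ('D_u ('D_w G) x) ('D_z G x) = metric x (christoffel x u w) z) /\
      forall x xi, Mk x -> q (G x) xi = 0 -> exists2 u, tangent Mk x u & 'D_u G x = xi].

Lemma mX_isometric : isometric_immersion X.
Proof.
split.
- by exists (domX M); split; [exact: open_domX|move=> x; exact: Mk_domX|exact: Ck_mX].
- by move=> x; exact: mQ_mX.
- move=> x u z Mx /(tangentMk M)[_ q0]; split=> //; exact: (mQ_tangent M _ Mx q0).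
- by move=> x u w Mx; exact: metricE.
- split; first by move=> x u w z Mx; exact: connE.
  by move=> x xi Mx q0; exact: quadric_path.
Qed.

Lemma velocity_tangent (c : R^o -> A) t : (forall k, Ck k setT c) -> (forall s, Mk (c s)) ->
  tangent Mk (c t) (derive1 c t).
Proof.
move=> ck Mc; exists (fun s : R^o => c (s + t)).
have H : is_derive (0 : R^o) (1 : R^o) (fun s : R^o => c (s + t)) (derive1 c t).
  apply: is_derive_translate; rewrite add0r; exact: (derive2_derive1 t (ck 2%N)).2.
apply: (path_at_intro ltr01) => //; last by rewrite add0r.
move=> k; apply: (@Ck_sub _ _ _ _ setT) => //.
have E : (fun s : R^o => c (s + t)) = (fun s => c ((s : R^o) + t)) by [].
elim: k c {Mc H E} ck => [|k IH] c ck.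
  split=> // s _; have [ds _] := derive2_derive1 (s + t) (ck 2%N).
  have := (derive2_derive1 (s + t) (ck 2%N)).2 => /is_derive_translate.
  exact: is_derive_continuous.
apply: (CkS_der (D := fun u s : R^o => u *: 'D_(1 : R^o) c (s + t))) => //; first exact: openT.
- move=> s _; have := (derive2_derive1 (s + t) (ck 2%N)).2 => /is_derive_translate.
  exact: is_derive_continuous.
- move=> u s _; have := (derive2_derive1 (s + t) (ck 2%N)).2 => /is_derive_translate.
  by move=> /(is_derive_dirZ u); rewrite [u *: (1 : R^o)]mulr1 derive1E.
move=> u; apply: Ck_scale; [exact: openT|exact: Ck_cst|].
by apply: (IH ('D_(1 : R^o) c)) => m; apply: Ck_derive.
Qed.

Lemma immersion_acceleration (G : A -> E) (c : R^o -> A) t : isometric_immersion G ->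
  Ck 2 setT c -> (forall s, Mk (c s)) ->
  exists a, [/\ is_derive t (1 : R^o) (fun s => 'D_(derive1 c s) G (c s)) a &
    forall z, b a ('D_z G (c t)) = metric (c t) (acceleration c t) z].
Proof.
move=> [[U [oO MO Gk]] _ _ mE [cE _]] ck Mc.
have [d2 d1] := derive2_derive1 t ck.
exists ('D_(derive1n 2 c t) G (c t) + 'D_(derive1 c t) ('D_(derive1 c t) G) (c t)).
split; first exact: (is_derive_moving_direction oO Gk (MO _ (Mc t)) d1 d2).
move=> z; rewrite bilDl cE // -mE // /acceleration /metric -mulrDr /edot -big_split.
by congr (_ * _); apply: eq_bigr => i _; rewrite [in RHS]mxE mulrDl.
Qed.

Lemma immersion_geodesic (G : A -> E) (c : R^o -> A) : isometric_immersion G ->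
  is_geodesic c -> metric (c 0) (derive1 c 0) (derive1 c 0) = 1 ->
  forall t, G (c t) = cK kappa t *: G (c 0) + sK kappa t *: 'D_(derive1 c 0) G (c 0).
Proof.
move=> GI [/(smooth_on_open _ openT) ck geo] u1; have Mc t : Mk (c t) by case: (geo t).
have [[U [oO MO Gk]] G1 Gt mE [_ surj]] := GI.
pose Z t := G (c t); pose Z' t := 'D_(derive1 c t) G (c t).
have dZ t : is_derive t (1 : R^o) Z (Z' t).
  have dG := Ck_differentiable oO Gk (MO _ (Mc t)).
  exact: is_derive_comp_diff dG (derive2_derive1 t (ck 2%N)).2.
have accP t : exists a, is_derive t (1 : R^o) Z' a /\ forall xi, q (Z t) xi = 0 -> b a xi = 0.
  have [a [da aP]] := immersion_acceleration t GI (ck 2%N) Mc.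
  exists a; split=> // xi /(surj _ _ (Mc t))[w Tw <-]; rewrite aP.
  by apply: (tproj_Mk_eq0 _ (Mc t)).1 => //; case: (geo t).
pose Z2 t := sval (cid (accP t)).
have dZ' t : is_derive t (1 : R^o) Z' (Z2 t) by case: (svalP (cid (accP t))).
have bZ2 t xi : q (Z t) xi = 0 -> b (Z2 t) xi = 0 by case: (svalP (cid (accP t))) => _; apply.
have qZZ' t : q (Z t) (Z' t) = 0 by case: (Gt _ _ 0 (Mc t) (velocity_tangent t ck Mc)).
have qZ' t z : q (Z' t) z = kappa * b (Z' t) z.
  by case: (Gt _ _ z (Mc t) (velocity_tangent t ck Mc)).
have speed t : b (Z' t) (Z' t) = 1.
  have -> : 1 = b (Z' 0) (Z' 0) by rewrite -mE.
  apply: (@is_derive_0_is_cst R (fun s => b (Z' s) (Z' s))) => s.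
  have := is_derive_bil (mB M) (dZ' s) (dZ' s).
  by rewrite (bC M (Z' s) (Z2 s)) bZ2 // addr0.
have qZZ2 t : q (Z t) (Z2 t) = - kappa.
  have := is_derive_bil (mQ M) (dZ t) (dZ' t).
  have H0 : is_derive t (1 : R^o) (fun s => q (Z s) (Z' s) : R^o) 0.
    by apply: is_derive_ext (@is_derive_cst R R^o R^o 0 t 1) => s; rewrite qZZ'.
  by move=> /(is_derive_unique H0)/esym/eqP; rewrite qZ' speed mulr1 addrC addr_eq0 => /eqP.
apply: (@oscillator_unique R kappa n.+2 Z Z') => // t.
suff -> : - kappa *: Z t = Z2 t by [].
apply/eqP; rewrite -subr_eq0 -oppr_eq0 opprB; apply/eqP.
set zeta := Z2 t - - kappa *: Z t.
have qz : q (Z t) zeta = 0.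
  by rewrite /zeta !bilE qZZ2 G1 // mulr1 subrr.
have [w Tw wE] := surj _ _ (Mc t) qz.
suff b0 : b zeta zeta = 0.
  have w0 : w = 0 by apply: (metric_eq0 (Mc t)); rewrite mE // wE.
  by rewrite -wE w0 derive0.
rewrite {1}/zeta bilDl bilNl bilZl bZ2 // add0r mulNr opprK.
have [/eqP k0|k0] := eqVneq kappa 0; first by apply/eqP; rewrite mulf_eq0 k0.
by rewrite -(qb_neq0 M _ _ k0).
Qed.

Lemma quadric_geodesic p u t : Mk p -> tangent Mk p u -> metric p u u = 1 ->
  let z := cK kappa t *: X p + sK kappa t *: 'D_u X p in
  [/\ Mk (Y z), X (Y z) = z & q z z = 1].
Proof.
move=> Mp /(tangentMk M)[_ q0] u1 z; have bu : b ('D_u X p) ('D_u X p) = 1.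
  by rewrite -metricE.
have qz : q z z = 1.
  rewrite /z !bilE (qC M ('D_u X p) (X p)) q0 mQ_mX // (mQ_tangent M _ Mp q0) bu.
  by have := cK_sK kappa t; lra.
by have [Mz zE] := mYK M (domY_geod M t Mp q0 bu) qz.
Qed.

Lemma is_derive_osc (m : nat) (z xi : 'rV[R]_m) (t : R^o) :
  is_derive t (1 : R^o) (fun s => cK kappa s *: z + sK kappa s *: xi)
    ((- kappa * sK kappa t) *: z + cK kappa t *: xi).
Proof.
have dc a := @is_derive_cst R R^o ('rV[R]_m) a t 1.
have := is_deriveD (is_derive_scale (is_derive_cK kappa t) (dc z))
   (is_derive_scale (is_derive_sK kappa t) (dc xi)).
by move=> H; apply: (is_derive_conv H) => //; rewrite !scaler0 !addr0.
Qed.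

Lemma is_derive_osc' (m : nat) (z xi : 'rV[R]_m) (t : R^o) :
  is_derive t (1 : R^o) (fun s => (- kappa * sK kappa s) *: z + cK kappa s *: xi)
    (- kappa *: (cK kappa t *: z + sK kappa t *: xi)).
Proof.
have dc a := @is_derive_cst R R^o ('rV[R]_m) a t 1.
have dk := @is_derive_cst R R^o R^o (- kappa : R^o) t 1.
have := is_deriveD (is_derive_scale (is_derive_mul dk (is_derive_sK kappa t)) (dc z))
   (is_derive_scale (is_derive_cK kappa t) (dc xi)).
move=> H; apply: (is_derive_conv H) => //; apply/rowP => i; rewrite !mxE /cst; ring.
Qed.

Lemma Ck_osc (m k : nat) (z xi : 'rV[R]_m) :
  Ck k (setT : set R^o) (fun s : R^o => cK kappa s *: z + sK kappa s *: xi).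
Proof.
have [cc cs] := @Ck_cK_sK R kappa k setT.
by apply: CkD; [exact: openT|apply: Ck_scale; [exact: openT| |exact: Ck_cst]
  |apply: Ck_scale; [exact: openT| |exact: Ck_cst]].
Qed.

Lemma geod_exists p u : Mk p -> tangent Mk p u -> metric p u u = 1 ->
  let c := fun t => Y (cK kappa t *: X p + sK kappa t *: 'D_u X p) in
  [/\ is_geodesic c, c 0 = p & derive1 c 0 = u].
Proof.
move=> Mp Tu u1 c; pose Z (t : R^o) := cK kappa t *: X p + sK kappa t *: 'D_u X p.
have qg t := quadric_geodesic t Mp Tu u1.
have Mc t : Mk (c t) by case: (qg t).
have Xc t : X (c t) = Z t by case: (qg t).
have [_ q0] := (tangentMk M p u).1 Tu.
have bu : b ('D_u X p) ('D_u X p) = 1 by rewrite -metricE.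
have DZ t : domY M (Z t) := domY_geod M t Mp q0 bu.
have ck k : Ck k setT c.
  by apply: (Ck_comp openT (open_domY M) _ (Ck_mY M k) (Ck_osc k _ _)) => t _; exact: DZ.
have c0 : c 0 = p by rewrite /c cK0 sK0 scale1r scale0r addr0 mXK //; exact: Mk_domX.
split=> //.
  split; first by apply/smooth_on_open => //; exact: openT.
  move=> t; split=> //; apply/tproj_Mk_eq0 => // z Tz.
  have [a [da aP]] := immersion_acceleration t mX_isometric (ck 2%N) Mc.
  rewrite -aP.
  have E : (fun s => 'D_(derive1 c s) X (c s)) =
      (fun s => (- kappa * sK kappa s) *: X p + cK kappa s *: 'D_u X p).
    apply/funext => s; have [_ <-] := chain_X M (Mc s) (derive2_derive1 s (ck 2%N)).2.
    have -> : X \o c = Z by apply/funext => r; exact: Xc.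
    by case: (is_derive_osc (X p) ('D_u X p) s).
  rewrite E in da; rewrite (is_derive_unique da (is_derive_osc' (X p) ('D_u X p) t)).
  have [_ qz] := (tangentMk M _ _).1 Tz.
  by rewrite bilZl -/(Z t) -Xc mulNr b_X // oppr0.
rewrite derive1E; have dZ := is_derive_osc (X p) ('D_u X p) 0.
rewrite sK0 cK0 mulr0 scale0r scale1r add0r in dZ.
have [_ ->] := chain_Y (DZ 0) dZ.
by rewrite /Z cK0 sK0 scale1r scale0r addr0 dYK.
Qed.

Lemma geodP p u : Mk p -> tangent Mk p u -> metric p u u = 1 ->
  [/\ is_geodesic (geod p u), geod p u 0 = p & derive1 (geod p u) 0 = u].
Proof.
move=> Mp Tu u1; have ex := geod_exists Mp Tu u1.
by rewrite /geod; case: xgetP => [c -> []|/(_ _ ex)].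
Qed.

Lemma geodE p u t : Mk p -> tangent Mk p u -> metric p u u = 1 ->
  Mk (geod p u t) /\ X (geod p u t) = cK kappa t *: X p + sK kappa t *: 'D_u X p.
Proof.
move=> Mp Tu u1; have [g g0 gu] := geodP Mp Tu u1.
split; first by have [_ /(_ t)[]] := g.
by rewrite (immersion_geodesic mX_isometric g) ?g0 ?gu.
Qed.

End Geodesics.

(** * Umbilic hypersurfaces *)

Section Umbilic.
Context {R : realType} (n : nat) (kappa : R) (M : linear_model n kappa).
Local Notation A := (ambient n kappa).
Local Notation E := 'rV[R]_n.+2.
Local Notation X := (mX M).
Local Notation Y := (mY M).
Local Notation q := (bil (mQ M)).
Local Notation b := (bil (mB M)).
Local Notation Mk := (@Mk R n kappa).
Implicit Types (x p u w : A) (xi zeta : E).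

(* The affine hyperplane [q a z = 1] cuts the quadric along [N]. *)
Definition umbilic_form (N : set A) (a : E) (rho : R) : Prop :=
  [/\ 0 < rho, N = [set x | Mk x /\ b (X x - a) (X x - a) = rho],
      q a a = 1 + kappa * rho & forall x, N x -> q a (X x) = 1].

Variables (N : set A) (a : E) (rho : R) (HN : umbilic_form N a rho).

Lemma rho_gt0 : 0 < rho. Proof. by case: HN. Qed.

Lemma N_Mk : N `<=` Mk. Proof. by case: HN => _ -> _ _ x []. Qed.

Lemma NP x : N x <-> Mk x /\ b (X x - a) (X x - a) = rho.
Proof. by case: HN => _ -> _ _. Qed.

Lemma q_aX x : N x -> q a (X x) = 1. Proof. by case: HN => _ _ _; apply. Qed.

Lemma b_eta x : N x -> b (X x - a) (X x - a) = rho. Proof. by case/NP. Qed.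

Lemma q_eta x : N x -> q (X x) (X x - a) = 0.
Proof. by move=> Nx; rewrite !bilE mQ_mX ?(qC M (X x) a) ?q_aX ?subrr //; exact: N_Mk. Qed.

Lemma b_etaX x : N x -> kappa * b (X x - a) (X x) = 0.
Proof. by move=> Nx; rewrite bC; apply: b_X; [exact: N_Mk|exact: q_eta]. Qed.

Lemma kkb x : Mk x -> kappa ^+ 2 * b (X x) (X x) = kappa.
Proof. by move=> Mx; rewrite -qb mQ_mX // mulr1. Qed.

Lemma umbilic_path p u : N p -> q (X p) ('D_u X p) = 0 -> b (X p - a) ('D_u X p) = 0 ->
  tangent N p u.
Proof.
move=> Np q0 b0; have Mp := N_Mk Np; set xi := 'D_u X p in q0 b0.
have [be0|be0] := eqVneq (b xi xi) 0.
  have u0 : u = 0.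
    by apply: (dX_inj (M := M) Mp); rewrite -/xi (b_eq0 Mp q0 be0) derive0.
  exists (cst p); rewrite u0; apply: (path_at_intro ltr01) => //.
  by move=> k; exact: Ck_cst.
pose be := b xi xi; have [eta etaE] : {eta | eta = X p - a} by exists (X p - a).
have bee : b eta eta = rho by rewrite etaE b_eta.
have qe : q (X p) eta = 0 by rewrite etaE q_eta.
have kb : kappa * b eta (X p) = 0 by rewrite etaE b_etaX.
rewrite -etaE in b0.
have [w wE] : {w | w = eta + (kappa * rho) *: X p} by eexists.
pose d (t : R^o) : E := xi - (t * (be / (2 * rho))) *: w.
pose D (t : R^o) : R^o := b (d t) (d t).
pose Z (t : R^o) : E := X p + ((D t)^-1 * (t * be)) *: d t.
have rho0 : rho != 0 by rewrite gt_eqF // rho_gt0.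
have be_gt0 : 0 < be by rewrite lt0r be0 (b_ge0 Mp q0).
have idk m O : Ck m O (fun t : R^o => t).
  by apply: (@Ck_linear _ _ _ _ _ idfun) => t; exact.
have oT : open (setT : set R^o) by exact: openT.
have dk m : Ck m setT d.
  have -> : d = (fun t : R^o => xi + (t *: (- (be / (2 * rho)) : R^o)) *: w).
    by apply/funext => t; rewrite /d [t *: _]mulrN scaleNr.
  apply: CkD => //; first exact: Ck_cst.
  by apply: Ck_scale => //; [apply: Ck_scale => //|]; exact: Ck_cst.
have Dk m : Ck m setT D by exact: Ck_bil.
have d0 : d 0 = xi by rewrite /d mul0r scale0r subr0.
have D0 : D 0 = be by rewrite /D d0.
have : \forall t \near (0 : R^o), D t > 0.
  have cd := Ck_continuous (Dk 0%N) (I : setT (0 : R^o)).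
  have /cvgrPdist_lt/(_ be be_gt0) := cd; apply: filterS => t; rewrite D0 ltr_norml.
  by move=> /andP[_]; lra.
move=> /near0P[e e0 He].
have Zk m : Ck m [set t : R^o | `|t| < e] Z.
  have oI := @open_interval R e.
  have DkI := Ck_sub (@subsetT _ _) (Dk m).
  apply: CkD => //; first exact: Ck_cst.
  apply: Ck_scale => //; last exact: Ck_sub (@subsetT _ _) (dk m).
  apply: Ck_scale => //; last by apply: Ck_scale => //; exact: Ck_cst.
  by apply: Ck_inv => // t /He d1; rewrite gt_eqF.
have Z0 : Z 0 = X p by rewrite /Z mul0r mulr0 scale0r addr0.
have dZ : is_derive (0 : R^o) (1 : R^o) Z xi.
  have id0 := @is_derive_id R R^o (0 : R^o) 1.
  have dc (c : R) := @is_derive_cst R R^o R^o (c : R^o) (0 : R^o) 1.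
  have dcE (c : E) := @is_derive_cst R R^o E (c : E) (0 : R^o) 1.
  have dD := Ck_is_derive (1 : R^o) (Dk 1%N) (I : setT (0 : R^o)).
  have dd := Ck_is_derive (1 : R^o) (dk 1%N) (I : setT (0 : R^o)).
  have D00 : D 0 != 0 by rewrite D0.
  have H := is_deriveD (dcE (X p)) (is_derive_scale (is_derive_mul (is_derive_inv D00 dD)
    (is_derive_mul id0 (dc be))) dd).
  apply: (is_derive_conv H) => //.
  by rewrite D0 d0 /cst; apply/rowP => i; rewrite !mxE; field.
have qew : q (X p) w = kappa * rho by rewrite wE bilDr bilZr qe mQ_mX // add0r mulr1.
have qee zeta : q eta zeta = kappa * b eta zeta by exact: (mQ_tangent M zeta Mp qe).
have qxx zeta : q xi zeta = kappa * b xi zeta by exact: (mQ_tangent M zeta Mp q0).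
have bxe : b xi eta = 0 by rewrite bC.
have bew : b eta w = rho.
  by rewrite wE bilDr bilZr bee [_ * rho]mulrC -mulrA kb mulr0 addr0.
have qww : q w w = kappa * b w w.
  rewrite wE !bilE (bC M (X p) eta) (qC M eta (X p)) qe mQ_mX // qee bee.
  have H := kkb Mp; move: (b (X p) (X p)) (b eta (X p)) H kb => B c H kb.
  have -> : kappa * (rho + kappa * rho * c + (kappa * rho * c + kappa * rho * (kappa * rho * B))) =
     kappa * rho + 2 * kappa * rho * (kappa * c) + kappa * rho ^+ 2 * (kappa ^+ 2 * B) by ring.
  by rewrite H kb; ring.
have qdd t : q (d t) (d t) = kappa * D t.
  rewrite /D /d !bilE qww !qxx (qC M w xi) qxx (bC M w xi); ring.
have key t : `|t| < e -> (D t)^-1 * (t * be) * D t = t * be.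
  by move=> /He Dt; rewrite mulrAC mulVf ?mul1r // gt_eqF.
have qpd t : q (X p) (d t) = - (kappa * (t * be)) / 2.
  by rewrite /d bilDr bilNr bilZr q0 qew; field.
have qZ (t : R^o) : `|t| < e -> q (Z t) (Z t) = 1.
  move=> te; move: (qdd t) (qpd t) (key t te); rewrite /Z.
  move: ((D t)^-1 * _) => s; move: (D t) (d t) => D' d' h1 h2 h3.
  by rewrite bilDl !bilDr !bilZl !bilZr (qC M d' (X p)) h1 h2 (mQ_mX M Mp) -h3; field.
have NZ (t : R^o) : `|t| < e -> domY M (Z t) -> N (Y (Z t)).
  move=> te Dt; have [MZ XZ] := mYK M Dt (qZ t te).
  apply/NP; split=> //; rewrite XZ addrAC -etaE.
  have bed : b eta (d t) = - (t * be) / 2 by rewrite /d bilDr bilNr bilZr b0 bew; field.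
  have bdd : b (d t) (d t) = D t by [].
  move: bed bdd (key t te); move: ((D t)^-1 * _) => s; move: (D t) (d t) => D' d' h1 h2 h3.
  by rewrite bilDl !bilDr !bilZl !bilZr (bC M d' eta) bee h1 h2 -h3; field.
have [cP dE] := @lift_path _ _ _ M N p Z xi e Mp e0 Zk qZ NZ Z0 dZ.
have uE : 'D_xi Y (X p) = u by exact: dYK.
by rewrite uE in cP; exists (Y \o Z).
Qed.

Lemma tangentN p u : tangent N p u <->
  [/\ N p, q (X p) ('D_u X p) = 0 & b (X p - a) ('D_u X p) = 0].
Proof.
split=> [[c cP]|[]]; last exact: umbilic_path.
have [Mp q0] := path_q0 M N_Mk cP; have dXc := path_X M N_Mk cP.
have [e e0 [_ Sc c0 dc]] := path_atP cP.
split=> //; first by rewrite -c0; apply: Sc; rewrite normr0.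
have dcE := @is_derive_cst R R^o E a (0 : R^o) 1.
have dd := is_deriveB dXc dcE; rewrite subr0 in dd.
have := is_derive_bil (mB M) dd dd => H.
have H0 : is_derive (0 : R^o) (1 : R^o) (fun t => b (X (c t) - a) (X (c t) - a) : R^o) 0.
  apply: near_eq_is_derive (@is_derive_cst R R^o R^o rho 0 1).
  by apply/near0P; exists e => // t te; rewrite b_eta //; exact: Sc.
have ev : (X \o c - cst a) 0 = X p - a by rewrite -c0.
by have := is_derive_unique H H0; rewrite ev bC; lra.
Qed.

Lemma tproj_NP p w : N p ->
  tangent N p (tproj N p w) /\
  forall z, tangent N p z -> metric p (tproj N p w) z = metric p w z.
Proof.
move=> Np; have Mp := N_Mk Np; apply: tprojP.
have [T1 E1] := tproj_MkP M w Mp; set w1 := tproj Mk p w in T1 E1.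
have [_ q1] := (tangentMk M p w1).1 T1.
set zeta := 'D_w1 X p in q1; pose eta := X p - a.
have rho0 : rho != 0 by rewrite gt_eqF // rho_gt0.
have [|y Ty yE] := @quadric_path _ _ _ M p (zeta - (b zeta eta / rho) *: eta) Mp.
  by rewrite bilDr bilNr bilZr q1 q_eta // mulr0 subr0.
have [_ qy] := (tangentMk M p y).1 Ty.
exists y.
  apply/tangentN; split; [exact: Np|exact: qy|rewrite yE].
  rewrite bilDr bilNr bilZr (b_eta Np) -/eta (bC M eta zeta) divfK; last exact: rho0.
  by rewrite subrr.
move=> z /[dup] Tz /tangentN[_ qz bz].
have Tz' : tangent Mk p z by apply/(tangentMk M).
have mB' u1 u2 : metric p (u1 - u2) z = metric p u1 z - metric p u2 z.
  by rewrite !(metricE M) // dXB // bilDl bilNl.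
rewrite mB' -(E1 z Tz') (metricE M w1 z Mp) (metricE M y z Mp) yE bilDl bilNl bilZl bz.
by rewrite mulr0 subr0 subrr.
Qed.

Variables (v : A -> A) (vP : smooth_unit_field N v).

Lemma v_tangent p : N p ->
  [/\ q (X p) ('D_(v p) X p) = 0, b (X p - a) ('D_(v p) X p) = 0
    & b ('D_(v p) X p) ('D_(v p) X p) = 1].
Proof.
move=> Np; have [_ /(_ p Np)[/tangentN[_ q0 b0] v1]] := vP; split=> //.
by rewrite -metricE //; exact: N_Mk.
Qed.

Lemma field_derivative p : N p -> exists W : A -> E,
  [/\ linear W,
      forall (c : R^o -> A) (t0 : R^o) u, is_derive t0 (1 : R^o) c u -> c t0 = p ->
        (\forall t \near t0, N (c t)) ->
        is_derive t0 (1 : R^o) (fun t => 'D_(v (c t)) X (c t)) (W u),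
      forall u z, tangent N p u -> tangent N p z ->
        metric p (nabla N v p u) z = b (W u) ('D_z X p) &
      forall u, tangent N p u ->
        [/\ q (X p) (W u) = - (kappa * b ('D_u X p) ('D_(v p) X p)),
            b (X p - a) (W u) = - b ('D_u X p) ('D_(v p) X p) &
            b ('D_(v p) X p) (W u) = 0]].
Proof.
move=> Np; have Mp := N_Mk Np; have [sv _] := vP.
have [D HD] := smooth_on_chain sv Np.
have Dp := Mk_domX M Mp.
have dD w : differentiable ('D_w X) p.
  exact: Ck_differentiable (open_domX M) (Ck_derive w (Ck_mX M 2%N)) Dp.
pose W u := 'D_(D u) X p + 'D_u ('D_(v p) X) p.
have HW (c : R^o -> A) (t0 : R^o) u : is_derive t0 (1 : R^o) c u -> c t0 = p ->
    (\forall t \near t0, N (c t)) ->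
    is_derive t0 (1 : R^o) (fun t => 'D_(v (c t)) X (c t)) (W u).
  move=> dc ct0 Nc; have dv := HD c t0 u dc ct0 Nc.
  have Dc : domX M (c t0) by rewrite ct0.
  have := is_derive_moving_direction (open_domX M) (Ck_mX M 2%N) Dc dc dv.
  by rewrite /W /= ct0.
exists W; split=> //.
- move=> k u w; rewrite /W [in LHS]linearP.
  rewrite (derive_lin k (D u) (D w) (X_differentiable M Mp)) (derive_lin k u w (dD (v p))).
  move: ('D_(D u) X p) ('D_(D w) X p) ('D_u _ p) ('D_w _ p) => x1 x2 x3 x4.
  by rewrite scalerDr addrACA.
- move=> u z Tu Tz; have [_ ->] := tproj_NP (tdiff N v p u + christoffel p u (v p)) Np => //.
  rewrite (tdiff_chain HD Tu) /W bilDl connE // -metricE // /metric -mulrDr /edot -big_split.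
  by congr (_ * _); apply: eq_bigr => i _; rewrite [in LHS]mxE mulrDl.
move=> u [c cP]; have [e e0 [_ Nc c0 dc]] := path_atP cP.
have nN : \forall t \near (0 : R^o), N (c t) by apply/near0P; exists e.
have dV := HW c 0 u dc c0 nN.
have dXc := path_X M N_Mk cP.
have dcE := @is_derive_cst R R^o E a (0 : R^o) 1.
have de := is_deriveB dXc dcE; rewrite subr0 in de.
have cstD (f : R^o -> R^o) (k d : R) : is_derive (0 : R^o) (1 : R^o) f d ->
    (forall t, N (c t) -> f t = k) -> d = 0.
  move=> df fk; apply: is_derive_unique df _.
  apply: near_eq_is_derive (@is_derive_cst R R^o R^o k 0 1).
  by apply: filterS nN => t /fk ->.
have /cstD H1 := is_derive_bil (mQ M) dXc dV.
have /cstD H2 := is_derive_bil (mB M) de dV.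
have /cstD H3 := is_derive_bil (mB M) dV dV.
have [_ qu _] := (tangentN p u).1 (ex_intro _ c cP).
split.
- have := H1 0 (fun t Nt => let: And3 e1 _ _ := v_tangent Nt in e1).
  by rewrite /= c0 (mQ_tangent M _ Mp qu) addrC => /eqP; rewrite addr_eq0 => /eqP.
- have ev : (X \o c - cst a) 0 = X p - a by rewrite -c0.
  have := H2 0 (fun t Nt => let: And3 _ e2 _ := v_tangent Nt in e2).
  by rewrite c0 ev addrC => /eqP; rewrite addr_eq0 => /eqP.
- have := H3 1 (fun t Nt => let: And3 _ _ e3 := v_tangent Nt in e3).
  rewrite c0 bC; lra.
Qed.

End Umbilic.

Lemma near_open (R : realType) (V : normedModType R) (P : V -> Prop) y :
  (\forall z \near y, P z) -> exists B : set V, [/\ open B, B y & forall z, B z -> P z].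
Proof.
move=> yP; have : nbhs y P by [].
by rewrite nbhsE => -[B [oB By] BP]; exists B.
Qed.

(** * Leaves and rays *)

Section CountableRange.
Context {R : realType}.

Lemma countable_no_interval (A : set R) (x y : R) : countable A -> x < y ->
  exists2 z, x < z < y & ~ A z.
Proof.
move=> cA xy; apply: contrapT => H.
have sub : `]x, y[%classic `<=` A.
  move=> z; rewrite /= in_itv /= => xzy; apply: contrapT => Az.
  by apply: H; exists z.
have cI := sub_countable (subset_card_le sub) cA.
have := countable_lebesgue_measure0 cI; rewrite lebesgue_measure_itv /= lte_fin xy.
by move=> /eqP; rewrite -EFinD eqe subr_eq0 => /eqP yx; move: xy; rewrite yx ltxx.
Qed.

Lemma countable_range_constant (f : R -> R) (A : set R) (t e : R) : countable A ->
  (forall s : R, `|s - t| < e -> {for s, continuous f} /\ A (f s)) ->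
  forall s, `|s - t| < e -> f s = f t.
Proof.
move=> cA H; suff K (x y : R) : x < y -> `|x - t| < e -> `|y - t| < e -> f x = f y.
  move=> s se; have te : `|t - t| < e by rewrite subrr normr0 (le_lt_trans (normr_ge0 _) se).
  by have [st|ts|->//] := ltgtP s t; [exact: K|symmetry; exact: K].
move=> xy xe ye; apply/eqP/negPn/negP => ne.
have cf : {within `[x, y], continuous f}.
  apply: continuous_in_subspaceT => z; rewrite inE /= in_itv /= => /andP[xz zy].
  case: (H z) => //; move: xe ye; rewrite !ltr_norml => /andP[? ?] /andP[? ?].
  apply/andP; split; lra.
have [z + Az] : exists2 z, Num.min (f x) (f y) < z < Num.max (f x) (f y) & ~ A z.
  apply: countable_no_interval => //.
  by move: ne; rewrite neq_lt => /orP[] H'; rewrite ?(min_l (ltW H')) ?(min_r (ltW H')) ?(max_l (ltW H')) ?(max_r (ltW H')).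
move=> /andP[z1 z2]; have [|c] := IVT (ltW xy) cf (v := z).
  by rewrite (ltW z1) (ltW z2).
rewrite in_itv /= => /andP[xc cy] fc; apply: Az; rewrite -fc.
case: (H c) => //; move: xe ye; rewrite !ltr_norml => /andP[? ?] /andP[? ?].
apply/andP; split; lra.
Qed.

End CountableRange.

Section Foliation.
Context {R : realType} (n : nat) (kappa : R) (M : linear_model n kappa).
Local Notation A := (ambient n kappa).
Local Notation E := 'rV[R]_n.+2.
Local Notation X := (mX M).
Local Notation Y := (mY M).
Local Notation q := (bil (mQ M)).
Local Notation b := (bil (mB M)).
Local Notation Mk := (@Mk R n kappa).
Local Notation C := (cK kappa).
Local Notation S := (sK kappa).
Implicit Types (x p u : A) (xi zeta : E).

Variables (N : set A) (a : E) (rho : R) (HN : umbilic_form M N a rho).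
Variables (w : A -> A) (wP : smooth_unit_field N w).
Local Notation V p := ('D_(w p) X p).
Local Notation Gam p t := (geod p (w p) t).

Definition gam p (t : R^o) : E := C t *: X p + S t *: V p.
Definition gam' p (t : R^o) : E := (- kappa * S t) *: X p + C t *: V p.

Lemma w_tangent p : N p -> tangent Mk p (w p) /\ metric p (w p) (w p) = 1.
Proof.
move=> Np; have [q0 _ b1] := v_tangent HN wP Np.
by split; [apply/(tangentMk M); split=> //; exact: (N_Mk HN Np)|case: wP => _ /(_ p Np)[]].
Qed.

Lemma GamE p t : N p -> Mk (Gam p t) /\ X (Gam p t) = gam p t.
Proof.
by move=> Np; have [Tw w1] := w_tangent Np; apply: geodE => //; exact: (N_Mk HN Np).
Qed.

Lemma domY_gam p t : N p -> domY M (gam p t).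
Proof. by move=> Np; have [Mg <-] := GamE t Np; exact: domY_mX. Qed.

Lemma GamY p t : N p -> Gam p t = Y (gam p t).
Proof. by move=> Np; have [Mg <-] := GamE t Np; rewrite mXK //; exact: Mk_domX. Qed.

Lemma is_derive_gam p (t : R^o) : is_derive t (1 : R^o) (gam p) (gam' p t).
Proof. exact: is_derive_osc. Qed.

Lemma is_derive_gam' p (t : R^o) : is_derive t (1 : R^o) (gam' p) (- kappa *: gam p t).
Proof. exact: is_derive_osc'. Qed.

Lemma b_gam' p t : N p -> b (gam' p t) (gam' p t) = 1.
Proof.
move=> Np; have Mp := N_Mk HN Np; have [q0 _ b1] := v_tangent HN wP Np.
have kb := b_X Mp q0; have kk := kkb M Mp.
rewrite /gam' !bilE b1 (bC M (V p) (X p)).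
transitivity (C t ^+ 2 + kappa * S t ^+ 2); last exact: cK_sK.
move: (b (X p) (V p)) (b (X p) (X p)) kb kk => c B kb kk.
transitivity (S t ^+ 2 * (kappa ^+ 2 * B) - 2 * S t * C t * (kappa * c) + C t ^+ 2).
  by ring.
by rewrite kb kk; ring.
Qed.

Lemma gam'_neq0 p t : N p -> gam' p t != 0.
Proof.
move=> Np; apply/eqP => g0; have := b_gam' t Np.
by rewrite g0 bil0l => /esym/eqP; rewrite oner_eq0.
Qed.

Lemma gam_shift p s t : gam p (t + s) = C s *: gam p t + S s *: gam' p t.
Proof. by rewrite /gam /gam' cKD sKD; apply/rowP => i; rewrite !mxE; ring. Qed.

Variable U : set A.
Hypothesis fol : smooth_foliation U [set ray p (w p) | p in N].

Lemma Gam_U p t : N p -> 0 < t -> (t%:E < Tk kappa)%E -> U (Gam p t).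
Proof.
move=> Np t0 tT; have [H _ _ _] := fol.
have [HU _] := H (ray p (w p)) (ex_intro2 _ _ p Np erefl).
by apply: HU; exists t.
Qed.

Lemma U_Gam x : U x -> exists p t, [/\ N p, 0 < t, (t%:E < Tk kappa)%E & x = Gam p t].
Proof.
move=> Ux; have [_ H _ _] := fol; have [L [p Np <-] [t [t0 tT] <-]] := H x Ux.
by exists p, t.
Qed.

Lemma Tk_lt_near (t : R) : (t%:E < Tk kappa)%E -> 0 < t ->
  exists2 e : R, 0 < e & forall s : R, `|s - t| < e -> 0 < s /\ (s%:E < Tk kappa)%E.
Proof.
rewrite /Tk; case: ifP => k0.
  rewrite lte_fin => tT t0; exists (Num.min t (pi / Num.sqrt kappa - t)).
    by rewrite lt_min t0 subr_gt0.
  move=> s; rewrite lt_min !ltr_norml lte_fin => /andP[/andP[? ?] /andP[? ?]]; split; lra.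
by move=> _ t0; exists t => // s; rewrite ltr_norml => /andP[? ?]; split; [lra|rewrite ltry].
Qed.

Lemma nearR (P : R^o -> Prop) (t : R) : (\forall s \near (t : R^o), P s) <->
  exists2 e : R, 0 < e & forall s : R^o, `|s - t| < e -> P s.
Proof.
split=> [/nbhs_ballP[e e0 He]|[e e0 He]].
  by exists e => // s te; apply: He; rewrite /ball /= distrC.
apply/nbhs_ballP; exists e => // s; rewrite /ball /= distrC; exact: He.
Qed.

Lemma open_cube (m : nat) : open (@cube R m).
Proof.
rewrite openE => z Cz; rewrite /interior.
have [r r0 Hr] : exists2 r : R, 0 < r & forall i, r <= 1 - `|z 0 i|.
  exists (\big[Num.min/1]_i (1 - `|z 0 i|)).
    by apply: lt_bigmin => // i _; rewrite subr_gt0; exact: Cz.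
  by move=> i; exact: bigmin_le_cond.
apply/nbhs_ballP; exists r => // y; rewrite -ball_normE /= => zy i.
have := le_lt_trans (coord_le_norm (z - y) 0 i) zy; rewrite !mxE => H.
have := Hr i; have := ler_normD (z 0 i) (y 0 i - z 0 i); rewrite addrC subrK distrC; lra.
Qed.

(* In a foliated chart a leaf moves along the first axis only, since its
   transverse coordinates are continuous with countably many values. *)
Lemma leaf_direction y : U y -> exists (O : set A) (g : A -> E),
  [/\ open O, O y, differentiable g y &
      forall p t, N p -> 0 < t -> (t%:E < Tk kappa)%E -> O (Gam p t) ->
        exists r, gam' p t = r *: g (Gam p t)].
Proof.
move=> Uy; have [_ _ _ /(_ y Uy)] := fol.
move=> [Oc [phi [psi [oOc Ocy WU [sphi spsi] [pp pq leaf]]]]].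
have psik k : Ck k (@cube R n) psi := (smooth_on_open _ (open_cube (m := n))).1 spsi k.
have My x : U x -> Mk x by move=> /U_Gam[p [t [Np _ _ ->]]]; case: (GamE t Np).
have [U1 [Phi [oU1 U1y Phik PhiE]]] := sphi y (conj (My _ Uy) Ocy).
have cP : {for y, continuous Phi} := Ck_continuous (Phik 0%N) U1y.
have Wy : (Mk `&` Oc) y := conj (My _ Uy) Ocy.
have PhiyC : cube (Phi y) by rewrite PhiE //; exact: (pp y Wy).1.
have : \forall z \near y, [/\ Oc z, U1 z, cube (Phi z) & domX M z].
  have n1 : \forall z \near y, Oc z by exact: open_nbhs_nbhs.
  have n2 : \forall z \near y, U1 z by exact: open_nbhs_nbhs.
  have n3 : \forall z \near y, cube (Phi z).
    by apply: cP; apply: open_nbhs_nbhs; split=> //; exact: open_cube.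
  have n4 : \forall z \near y, domX M z.
    apply: open_nbhs_nbhs; split; [exact: open_domX|exact: Mk_domX (My _ Uy)].
  by near=> z; split; near: z.
move=> /near_open [ O [oO Oy OE] ].
pose e0 : 'rV[R]_n.+1 := delta_mx 0 ord0.
pose h z := 'D_e0 psi (Phi z).
pose g z := \sum_i (h z) 0 i *: 'D_(delta_mx 0 i) X z.
have PO z : O z -> cube (Phi z) by move=> /OE[].
have gE z : O z -> g z = 'D_(h z) X z.
  move=> /OE[_ _ _ Dz]; rewrite /g -derive_sum_coord //.
  exact: Ck_differentiable (open_domX M) (Ck_mX M 1%N) Dz.
have hk : Ck 1 O h.
  apply: (Ck_comp oO (open_cube (m := n)) PO (Ck_derive e0 (psik 2%N))).
  by apply: Ck_sub (Phik 1%N) => z /OE[].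
have Xk i : Ck 1 O ('D_(delta_mx 0 i) X).
  by apply: Ck_sub (Ck_derive _ (Ck_mX M 2%N)) => z /OE[].
have gk : Ck 1 O g.
  apply: (Ck_sum oO) => i; apply: (Ck_scale oO _ (Xk i)).
  exact: (Ck_coord 0 i oO hk).
exists O, g; split; [exact: oO|exact: Oy|exact: (Ck_differentiable oO gk Oy)|].
move=> p t Np t0 tT Ot.
have dG : is_derive t (1 : R^o) (fun s : R^o => Gam p s : A) ('D_(gam' p t) Y (gam p t)).
  have := chain_Y (domY_gam t Np) (is_derive_gam p t).
  by apply: is_derive_ext => s; rewrite /= -GamY.
have [A0 cA LE] := leaf (ray p (w p)) (ex_intro2 _ _ p Np erefl).
have [Mt Xt] := GamE t Np.
have : \forall s \near (t : R^o), O (Gam p s) /\ 0 < s /\ (s%:E < Tk kappa)%E.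
  have [e ep He] := Tk_lt_near tT t0.
  apply: filterI; last by apply/nearR; exists e.
  by apply: (is_derive_continuous dG); exact: open_nbhs_nbhs.
move=> /nearR[e ep He].
have inW s : `|s - t| < e -> (Mk `&` Oc) (Gam p s) /\ Phi (Gam p s) = phi (Gam p s).
  move=> /He[/OE[h1 O2 _ _] _]; have [Ms _] := GamE s Np; split=> //.
  by rewrite PhiE.
have dPhi s : `|s - t| < e -> {for s, continuous (fun s : R^o => Phi (Gam p s))}.
  move=> /He[/OE[_ O2 _ _] _].
  have dGs : is_derive s (1 : R^o) (fun s : R^o => Gam p s : A) ('D_(gam' p s) Y (gam p s)).
    have := chain_Y (domY_gam s Np) (is_derive_gam p s).
    by apply: is_derive_ext => r; rewrite /= -GamY.
  apply: continuous_comp; first exact: is_derive_continuous dGs.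
  exact: Ck_continuous (Phik 0%N) O2.
have inA s : `|s - t| < e -> A0 (col' ord0 (Phi (Gam p s))).
  move=> se; have [Ws ->] := inW s se; have [_ [s0 sT]] := He s se.
  have : (ray p (w p) `&` (Mk `&` Oc)) (Gam p s) by split=> //; exists s.
  by rewrite LE => -[].
have trans (j : 'I_n) s : `|s - t| < e -> Phi (Gam p s) 0 (lift ord0 j) = Phi (Gam p t) 0 (lift ord0 j).
  move=> se.
  have cj : countable [set (z : 'rV[R]_n) 0 j | z in A0] by exact: sub_countable (card_image_le _ _) cA.
  have := @countable_range_constant R (fun s => Phi (Gam p s) 0 (lift ord0 j)) _ t e cj _ s se.
  apply=> s' s'e; split.
    apply: (@continuous_comp _ _ _ (fun s : R^o => Phi (Gam p s)) (fun z : 'rV[R]_n.+1 => z 0 (lift ord0 j) : R^o)).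
      exact: dPhi.
    exact: differentiable_continuous (differentiable_coord _ _ _).
  by exists (col' ord0 (Phi (Gam p s'))); [exact: inA|rewrite mxE].
have te : `|t - t| < e by rewrite subrr normr0.
have [h1 h2] : U1 (Gam p t) /\ domX M (Gam p t) by case: (OE _ Ot).
have dPt := is_derive_comp_diff (Ck_differentiable oU1 (Phik 1%N) h1) dG.
set eta := 'D_('D_(gam' p t) Y (gam p t)) Phi (Gam p t) in dPt.
have etaE : eta = eta 0 ord0 *: e0.
  apply/rowP => i; rewrite !mxE eqxx /=; have [j ->|->] := unliftP ord0 i; last by rewrite eqxx mulr1.
  have -> : (lift ord0 j == ord0) = false by rewrite eq_sym; apply/negbTE; exact: neq_lift.
  rewrite mulr0.
  have := is_derive_coord 0 (lift ord0 j) dPt => /is_derive_unique; apply.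
  apply: near_eq_is_derive (@is_derive_cst R R^o R^o (Phi (Gam p t) 0 (lift ord0 j)) t 1).
  by apply/nearR; exists e => // s /(trans j) ->.
exists (eta 0 ord0).
have dpsi : differentiable psi (Phi (Gam p t)).
  exact: Ck_differentiable (open_cube (m := n)) (psik 1%N) (PO _ Ot).
have dcomp := is_derive_comp_diff (g := Phi \o (fun s : R^o => Gam p s)) dpsi dPt.
have velE : 'D_(gam' p t) Y (gam p t) = eta 0 ord0 *: h (Gam p t).
  rewrite /h -(derive_directionZ _ _ dpsi) -etaE.
  apply: is_derive_unique dG _; apply: near_eq_is_derive dcomp.
  by apply/nearR; exists e => // s se; have [Ws Ps] := inW s se; rewrite /= Ps (pp _ Ws).2.
rewrite gE // -dXZ // -velE.
apply: is_derive_unique (is_derive_gam p t) _.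
have := chain_X M Mt dG; apply: is_derive_ext => s.
by rewrite /=; case: (GamE s Np).
Unshelve. all: by end_near. Qed.

End Foliation.

Lemma is_derive_near_open (R : realType) (V : normedModType R) (f : R^o -> V) (t : R^o) d y
    (O : set V) : is_derive t (1 : R^o) f d -> f t = y -> open O -> O y ->
  \forall s \near t, O (f s).
Proof.
by move=> df fy oO Oy; apply: (is_derive_continuous df); rewrite fy; exact: open_nbhs_nbhs.
Qed.

Lemma eliminate_direction (R : pzRingType) (V : lmodType R) (J K ga mu : V) (a1 a2 x lam : R) :
  x * lam = lam * x -> J = a1 *: ga + x *: (lam *: mu) -> K = a2 *: ga + x *: mu ->
  J = (a1 - lam * a2) *: ga + lam *: K.
Proof.
by move=> xl -> ->; rewrite scalerBl scalerDr !scalerA addrA subrK xl.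
Qed.

Section Rays.
Context {R : realType} (n : nat) (kappa : R) (M : linear_model n kappa).
Local Notation A := (ambient n kappa).
Local Notation E := 'rV[R]_n.+2.
Local Notation X := (mX M).
Local Notation Y := (mY M).
Local Notation q := (bil (mQ M)).
Local Notation b := (bil (mB M)).
Local Notation Mk := (@Mk R n kappa).
Local Notation C := (cK kappa).
Local Notation S := (sK kappa).
Implicit Types (x p u : A) (xi zeta : E).

Lemma proportional_derivative (B : 'M[R]_n.+2) (f h : R^o -> E) (s0 : R^o) f' h' :
  is_derive s0 (1 : R^o) f f' -> is_derive s0 (1 : R^o) h h' ->
  (\forall s \near s0, exists r, f s = r *: h s) -> bil B (f s0) (f s0) = 1 ->
  let be := bil B (f s0) (h s0) in
  f' = (bil B (f s0) f' - be^-1 * bil B (f s0) h') *: f s0 + be^-1 *: h'.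
Proof.
move=> df dh fh f1 be; have [r0 r0E] := nbhs_singleton fh.
have rb : r0 * be = 1 by rewrite /be -bilZr -r0E.
have be0 : be != 0 by apply: contra_eq_neq rb => ->; rewrite mulr0 eq_sym oner_neq0.
have h0E : h s0 = be *: f s0 by rewrite r0E scalerA mulrC rb scale1r.
have dc := @is_derive_cst R R^o E (f s0) s0 1.
have dbf := is_derive_bil B dc df; have dbh := is_derive_bil B dc dh.
have dI := @is_derive_inv R _ (fun s : R^o => bil B (f s0) (h s) : R^o) s0 1 _ be0 dbh.
have H := is_derive_scale (is_derive_mul dbf dI) dh.
have nb : \forall s \near s0, bil B (f s0) (h s) != 0.
  have cb := is_derive_continuous dbh.
  have e0 : 0 < `|be| by rewrite normr_gt0.
  have /cvgrPdist_lt/(_ _ e0) := cb; apply: filterS => s.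
  by rewrite /cst /= -/be; apply: contraTneq => ->; rewrite subr0 ltxx.
have F : is_derive s0 (1 : R^o) f
    ((((bil B 0 (f s0) + bil B (cst (f s0) s0) f') * (bil B (cst (f s0) s0) (h s0))^-1 +
      bil B (cst (f s0) s0) (f s0) * (- (bil B 0 (h s0) + bil B (cst (f s0) s0) h') /
          bil B (cst (f s0) s0) (h s0) ^+ 2)) *: h s0) +
      (bil B (cst (f s0) s0) (f s0) * (bil B (cst (f s0) s0) (h s0))^-1) *: h').
  apply: near_eq_is_derive H; near=> s.
  have [r rE] : exists r, f s = r *: h s by near: s.
  have bs : bil B (f s0) (h s) != 0 by near: s.
  by rewrite /cst /= {1}rE bilZr mulfK // rE.
rewrite [LHS](is_derive_unique df F) /cst !bil0l !add0r f1 -/be h0E scalerA mul1r.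
by rewrite div1r; congr (_ *: _ + _); field.
Unshelve. all: by end_near. Qed.

Variables (N : set A) (a : E) (rho : R) (HN : umbilic_form M N a rho).
Variables (w : A -> A) (wP : smooth_unit_field N w).
Local Notation V p := ('D_(w p) X p).
Local Notation Gam p t := (geod p (w p) t).

Definition is_field_derivative p (W : A -> E) : Prop :=
  [/\ linear W,
      forall (c : R^o -> A) (t0 : R^o) u, is_derive t0 (1 : R^o) c u -> c t0 = p ->
        (\forall t \near t0, N (c t)) ->
        is_derive t0 (1 : R^o) (fun t => V (c t)) (W u) &
      forall u, tangent N p u ->
        [/\ q (X p) (W u) = - (kappa * b ('D_u X p) (V p)),
            b (X p - a) (W u) = - b ('D_u X p) (V p) &
            b (V p) (W u) = 0]].

Variable U : set A.
Hypothesis fol : smooth_foliation U [set ray p (w p) | p in N].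

Lemma common_direction p p' t t' : N p -> N p' -> 0 < t -> (t%:E < Tk kappa)%E ->
  0 < t' -> (t'%:E < Tk kappa)%E -> Gam p t = Gam p' t' ->
  gam' M w p' t' = gam' M w p t \/ gam' M w p' t' = - gam' M w p t.
Proof.
move=> Np Np' t0 tT t'0 t'T E.
have [ O [g [oO Oy dg gP]]] := leaf_direction HN wP fol (Gam_U fol Np t0 tT).
have [r rE] := gP p t Np t0 tT Oy.
have [r' r'E] : exists r, gam' M w p' t' = r *: g (Gam p' t').
  by apply: gP => //; rewrite -E.
have := b_gam' HN wP t Np; have := b_gam' HN wP t' Np'.
rewrite rE r'E -E !bilE => H1 H2.
have : (r' - r) * (r' + r) * b (g (Gam p t)) (g (Gam p t)) = 0.
  by move: H1 H2; move: (b _ _) => B H1 H2; lra.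
move=> /eqP; rewrite !mulf_eq0 -orbA => /or3P[/eqP H|/eqP H|/eqP H].
- by left; congr (_ *: _); lra.
- by right; rewrite -scaleNr; congr (_ *: _); lra.
- by move: H1; rewrite H !mulr0 => /esym/eqP; rewrite oner_eq0.
Qed.

Lemma gam_back p t : X p = C t *: gam M w p t - S t *: gam' M w p t.
Proof.
rewrite /gam /gam' -[LHS]scale1r -(cK_sK kappa t).
by apply/rowP => i; rewrite !mxE; ring.
Qed.

Lemma common_point p p' t t' : N p -> N p' -> 0 < t -> (t%:E < Tk kappa)%E ->
  0 < t' -> (t'%:E < Tk kappa)%E -> Gam p t = Gam p' t' ->
  p' = Gam p (t - t') \/ p' = Gam p (t + t').
Proof.
move=> Np Np' t0 tT t'0 t'T E.
have gE : gam M w p' t' = gam M w p t.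
  by rewrite -(GamE HN wP t Np).2 -(GamE HN wP t' Np').2 E.
have XE s : X p' = gam M w p s -> p' = Gam p s.
  move=> H; have [Ms Xs] := GamE HN wP s Np.
  by apply: (X_inj (M := M)); [exact: (N_Mk HN Np')|exact: Ms|rewrite Xs; exact: H].
have [H|H] := common_direction Np Np' t0 tT t'0 t'T E; [left|right]; apply: XE;
  rewrite (gam_back p' t') gE H gam_shift ?cKN ?sKN ?scaleNr ?scalerN ?opprK //.
Qed.

Lemma nondegenerate p t (W : A -> E) u (lam : R) : N p -> is_field_derivative p W ->
  0 < t -> (t%:E < Tk kappa)%E -> tangent N p u ->
  C t *: 'D_u X p + S t *: W u = lam *: gam' M w p t -> u = 0.
Proof.
move=> Np [_ HW Wfacts] t0 tT Tu JE.
have [qW bW _] := Wfacts u Tu.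
have [_ qxi bxi] := (tangentN HN p u).1 Tu.
have [q0 b0 b1] := v_tangent HN wP Np.
have Mp := N_Mk HN Np.
have [c cP] := Tu; have [e e0 [_ Nc c0 dc]] := path_atP cP.
have nN : \forall s \near (0 : R^o), N (c s) by apply/near0P; exists e.
have dV := HW c 0 u dc c0 nN.
have dXc := path_X M (N_Mk HN) cP.
have [ O [g [oO Oy dg gP]]] := leaf_direction HN wP fol (Gam_U fol Np t0 tT).
set xi := 'D_u X p in qxi bxi qW bW JE dXc.
pose ga := gam' M w p t.
pose z (s : R^o) := gam M w (c s) t; pose z' (s : R^o) := gam' M w (c s) t.
have dz : is_derive (0 : R^o) (1 : R^o) z (lam *: ga).
  by rewrite -JE; apply: is_deriveD; apply: is_deriveZ.
have dz' : is_derive (0 : R^o) (1 : R^o) z' ((- kappa * S t) *: xi + C t *: W u).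
  by apply: is_deriveD; apply: is_deriveZ.
have z0 : z 0 = gam M w p t by rewrite /z c0.
have Dz0 : domY M (z 0) by rewrite z0; exact: (domY_gam HN wP t Np).
have dYz := chain_Y Dz0 dz.
have dYg := chain_Y (domY_gam HN wP t Np) (is_derive_gam M w p t).
have Yz0 : (Y \o z) 0 = Gam p t by rewrite /= z0 -(GamY HN wP).
have Yg0 : (Y \o gam M w p) t = Gam p t by rewrite /= -(GamY HN wP).
have dgz : is_derive (0 : R^o) (1 : R^o) (g \o (Y \o z))
    (lam *: 'D_('D_ga Y (gam M w p t)) g (Gam p t)).
  have := is_derive_comp_diff (g := Y \o z) (F := g) _ dYz; rewrite Yz0 => /(_ dg).
  rewrite z0 (derive_directionZ _ _ (Y_differentiable (domY_gam HN wP t Np))).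
  by rewrite (derive_directionZ _ _ dg).
have dgg : is_derive (t : R^o) (1 : R^o) (g \o (Y \o gam M w p))
    ('D_('D_ga Y (gam M w p t)) g (Gam p t)).
  by have := is_derive_comp_diff (g := Y \o gam M w p) (F := g) _ dYg; rewrite Yg0 => /(_ dg).
set mu := 'D_('D_ga Y _) g _ in dgz dgg.
have z'0 : z' 0 = ga by rewrite /z' c0.
have E1 : ((- kappa * S t) *: xi + C t *: W u) = (b ga ((- kappa * S t) *: xi + C t *: W u) -
   (b ga (g (Gam p t)))^-1 * b ga (lam *: mu)) *: ga + (b ga (g (Gam p t)))^-1 *: (lam *: mu).
  have H := @proportional_derivative (mB M) z' (g \o (Y \o z)) 0 _ _ dz' dgz.
  have e1 : (g \o (Y \o z)) 0 = g (Gam p t) by rewrite -Yz0.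
  rewrite z'0 e1 in H; apply: H; last exact: (b_gam' HN wP t Np).
  have nO : \forall s \near (0 : R^o), O ((Y \o z) s).
    exact: (is_derive_near_open dYz Yz0 oO Oy).
  near=> s; have Ns : N (c s) by near: s.
  have Os : O ((Y \o z) s) by near: s.
  have Ys : Y (z s) = Gam (c s) t by rewrite (GamY HN wP t Ns).
  have Os' : O (Gam (c s) t) by rewrite -Ys.
  have [r rE] := gP _ _ Ns t0 tT Os'.
  by exists r; rewrite /z' rE -Ys.
have E2 : (- kappa *: gam M w p t) = (b ga (- kappa *: gam M w p t) -
   (b ga (g (Gam p t)))^-1 * b ga mu) *: ga + (b ga (g (Gam p t)))^-1 *: mu.
  have H := @proportional_derivative (mB M) (gam' M w p) (g \o (Y \o gam M w p)) t _ _
    (is_derive_gam' M w p t) dgg.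
  have e1 : (g \o (Y \o gam M w p)) t = g (Gam p t) by rewrite -Yg0.
  rewrite e1 in H; apply: H; last exact: (b_gam' HN wP t Np).
  have nO : \forall s \near (t : R^o), O ((Y \o gam M w p) s).
    exact: (is_derive_near_open dYg Yg0 oO Oy).
  have [e1' e10 He1] := Tk_lt_near tT t0.
  have nT : \forall s \near (t : R^o), 0 < s /\ (s%:E < Tk kappa)%E by apply/nearR; exists e1'.
  near=> s; have [s0 sT] : 0 < s /\ (s%:E < Tk kappa)%E by near: s.
  have Os : O ((Y \o gam M w p) s) by near: s.
  have Ys : Y (gam M w p s) = Gam p s by rewrite (GamY HN wP s Np).
  have Os' : O (Gam p s) by rewrite -Ys.
  have [r rE] := gP _ _ Np s0 sT Os'.
  by exists r; rewrite rE -Ys.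
have [sg E3] : exists sg, (- kappa * S t) *: xi + C t *: W u = sg *: ga - (lam * kappa) *: gam M w p t.
  have H := eliminate_direction (mulrC _ _) E1 E2.
  eexists; rewrite {1}H; congr (_ + _).
  by rewrite scalerA mulrN scaleNr.
have xiE : xi = C t *: (lam *: ga) - S t *: (sg *: ga - (lam * kappa) *: gam M w p t).
  rewrite -JE -E3 -[LHS]scale1r -(cK_sK kappa t).
  by apply/rowP => i; rewrite !mxE; ring.
have WE : W u = (kappa * S t) *: (lam *: ga) + C t *: (sg *: ga - (lam * kappa) *: gam M w p t).
  rewrite -JE -E3 -[LHS]scale1r -(cK_sK kappa t).
  by apply/rowP => i; rewrite !mxE; ring.
have [al [be xiE']] : exists al be, xi = al *: X p + be *: V p.
  exists (- kappa * S t * (C t * lam - S t * sg) + C t * (S t * (lam * kappa))).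
  exists (C t * (C t * lam - S t * sg) + S t * (S t * (lam * kappa))).
  by rewrite [LHS]xiE /ga /gam /gam'; apply/rowP => i; rewrite !mxE; ring.
have [al' [be' WE']] : exists al be, W u = al *: X p + be *: V p.
  exists (- kappa * S t * (kappa * S t * lam + C t * sg) - C t * (C t * (lam * kappa))).
  exists (C t * (kappa * S t * lam + C t * sg) - S t * (C t * (lam * kappa))).
  by rewrite [LHS]WE /ga /gam /gam'; apply/rowP => i; rewrite !mxE; ring.
have al0 : al = 0.
  by move: qxi; rewrite xiE' bilDr !bilZr q0 (mQ_mX M Mp) mulr0 addr0 mulr1.
rewrite al0 scale0r add0r in xiE'.
have bxV : b xi (V p) = be by rewrite xiE' bilZl b1 mulr1.
have qW' : al' = - (kappa * be).
  by move: qW; rewrite WE' bilDr !bilZr q0 (mQ_mX M Mp) mulr0 addr0 mulr1 bxV.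
have kb : kappa * b (X p - a) (X p) = 0 by exact: (b_etaX HN Np).
have be0 : be = 0.
  move: bW; rewrite WE' bilDr !bilZr b0 mulr0 addr0 bxV qW' mulNr mulrAC kb mul0r => /eqP.
  by rewrite eq_sym eqr_opp => /eqP.
apply: (dX_inj (M := M) Mp); rewrite -/xi xiE' be0 scale0r derive0 //.
Unshelve. all: by end_near. Qed.

End Rays.

Section BiRays.
Context {R : realType} (n : nat) (kappa : R) (M : linear_model n kappa).
Local Notation A := (ambient n kappa).
Local Notation E := 'rV[R]_n.+2.
Local Notation X := (mX M).
Local Notation Y := (mY M).
Local Notation q := (bil (mQ M)).
Local Notation b := (bil (mB M)).
Local Notation Mk := (@Mk R n kappa).
Local Notation C := (cK kappa).
Local Notation S := (sK kappa).
Variables (N : set A) (a : E) (rho : R) (HN : umbilic_form M N a rho).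
Variables (v : A -> A) (vP : smooth_unit_field N v).
Local Notation V p := ('D_(v p) X p).
Local Notation Gam p t := (geod p (v p) t).

Lemma smooth_unit_fieldN : smooth_unit_field N (fun p => - v p).
Proof.
have [sv v1] := vP; split.
  move=> x Nx; have [ O [F [oO Ox Fk FE]]] := sv x Nx.
  exists O, (fun y => (-1 : R^o) *: F y); split=> //.
    by move=> k; apply: Ck_scale => //; exact: Ck_cst.
  by move=> y Ny Oy; rewrite FE // scaleN1r.
move=> p Np; have [Tv vv] := v1 p Np; have Mp := N_Mk HN Np.
have [_ q0 b0] := (tangentN HN p (v p)).1 Tv.
have E : 'D_(- v p) X p = - V p by rewrite -scaleN1r (dXZ M) // scaleN1r.
split; first by apply/(tangentN HN); rewrite E !bilNr q0 b0 oppr0.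
by rewrite (metricE M) // E bilNl bilNr opprK -metricE.
Qed.

Lemma gamN p t : N p -> gam M (fun p => - v p) p t = gam M v p (- t) /\
  gam' M (fun p => - v p) p t = - gam' M v p (- t).
Proof.
move=> Np; have Mp := N_Mk HN Np.
have E : 'D_(- v p) X p = - V p by rewrite -scaleN1r (dXZ M) // scaleN1r.
rewrite /gam /gam' E cKN sKN; split; first by rewrite scalerN scaleNr.
by apply/rowP => i; rewrite !mxE; ring.
Qed.

Lemma GamN p t : N p -> geod p (- v p) t = Gam p (- t).
Proof.
move=> Np; have [M1 X1] := GamE HN smooth_unit_fieldN t Np.
have [M2 X2] := GamE HN vP (- t) Np.
by apply: (X_inj (M := M)) => //; rewrite X1 X2; case: (gamN t Np).
Qed.

Variable U : set A.
Hypothesis fol : smooth_foliation U [set ray p (v p) | p in N].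
Hypothesis folN : smooth_foliation U [set ray p (- v p) | p in N].
Hypothesis UN : forall x, U x -> ~ N x.

Lemma Gam_NU p t : N p -> 0 < t -> (t%:E < Tk kappa)%E -> U (Gam p (- t)).
Proof. by move=> Np t0 tT; rewrite -GamN //; exact: (Gam_U folN). Qed.

Lemma gam_return p (s : R) : N p -> (`|s|%:E < Tk kappa)%E -> N (Gam p s) -> Gam p s = p.
Proof.
move=> Np sT Ns; have [s0|s0|->] := ltgtP s 0.
- exfalso; apply: (UN _ Ns); rewrite -(opprK s); apply: (Gam_NU Np); first by rewrite oppr_gt0.
  by rewrite -(ltr0_norm s0).
- exfalso; apply: (UN _ Ns); apply: (Gam_U fol Np s0).
  by rewrite -(gtr0_norm s0).
- have [M1 X1] := GamE HN vP 0 Np.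
  apply: (X_inj (M := M)) => //; first exact: (N_Mk HN Np).
  by rewrite X1 /gam cK0 sK0 scale1r scale0r addr0.
Qed.

Lemma gam_return2 p (s t t' : R) : N p -> 0 < t -> (t%:E < Tk kappa)%E -> 0 < t' ->
  (t'%:E < Tk kappa)%E -> s = t + t' -> N (Gam p s) -> Gam p s = p.
Proof.
move=> Np t0 tT t'0 t'T sE Ns.
have [k0|k0] := ltP 0 kappa; last first.
  apply: (gam_return Np) => //; rewrite /Tk.
  have -> : (0 < kappa) = false by apply/negbTE; rewrite -leNgt.
  exact: ltry.
move: tT t'T; rewrite /Tk k0 !lte_fin; set T := _ / _ => tT t'T.
have TE : Tk kappa = T%:E by rewrite /Tk k0.
have [cT sT] : C T = -1 /\ S T = 0 by rewrite /T cK_pi // sK_pi.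
have [sT1|sT1|sT1] := ltgtP s T.
- by apply: (gam_return Np) => //; rewrite TE lte_fin gtr0_norm // sE addr_gt0.
- have s2 : `|s - T - T| < T by rewrite ltr_norml; apply/andP; split; lra.
  have E : Gam p s = Gam p (s - T - T).
    have [M1 X1] := GamE HN vP s Np; have [M2 X2] := GamE HN vP (s - T - T) Np.
    apply: (X_inj (M := M)) => //; rewrite X1 X2 /gam.
    have -> : s = s - T - T + T + T by ring.
    rewrite !(cKD _ _ T) !(sKD _ _ T) cT sT.
    have -> : s - T - T + T + T - T - T = s - T - T by ring.
    by congr (_ *: _ + _ *: _); ring.
  by rewrite E; apply: (gam_return Np); rewrite -?E // TE lte_fin.
- have [M1 X1] := GamE HN vP s Np.
  have := q_aX HN Ns; rewrite X1 sT1 /gam cT sT scale0r addr0 scaleN1r bilNr (q_aX HN Np).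
  by move=> H; exfalso; lra.
Qed.

Lemma ray_inj p p' t t' : N p -> N p' -> 0 < t -> (t%:E < Tk kappa)%E ->
  0 < t' -> (t'%:E < Tk kappa)%E -> Gam p t = Gam p' t' -> p' = p.
Proof.
move=> Np Np' t0 tT t'0 t'T E.
have [H|H] := common_point HN vP fol Np Np' t0 tT t'0 t'T E.
  rewrite H; apply: (gam_return Np); rewrite -?H //.
  have [tt|tt] := leP t' t.
    by rewrite ger0_norm ?subr_ge0 //; apply: le_lt_trans tT; rewrite lee_fin; lra.
  by rewrite ltr0_norm ?subr_lt0 //; apply: le_lt_trans t'T; rewrite lee_fin; lra.
by rewrite H; apply: (gam_return2 Np t0 tT t'0 t'T) => //; rewrite -H.
Qed.

End BiRays.

(** * The differential of the billiard map *)

Section SmoothAlongPaths.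
Context {R : realType}.

Lemma Ck_affine_cK_sK (k t0 tau : R) m :
  Ck m (setT : set R^o) (fun s : R^o => cK k (t0 + tau * s) : R^o) /\
  Ck m (setT : set R^o) (fun s : R^o => sK k (t0 + tau * s) : R^o).
Proof.
have da (s : R^o) : is_derive s (1 : R^o) (fun s : R^o => t0 + tau * s : R^o) tau.
  have := is_deriveD (@is_derive_cst R R^o R^o (t0 : R^o) s 1)
    (is_derive_mul (@is_derive_cst R R^o R^o (tau : R^o) s 1) (@is_derive_id R R^o s 1)).
  by rewrite add0r mul0r add0r mulr1.
have comp (f : R^o -> R^o) d (s : R^o) : is_derive (t0 + tau * s : R^o) (1 : R^o) f d ->
    is_derive s (1 : R^o) (fun s : R^o => f (t0 + tau * s)) (tau * d).
  move=> fd; have [/derivable1_diffP df _] := fd.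
  have := is_derive_comp_diff (F := f) (g := fun s : R^o => t0 + tau * s : R^o) df (da s).
  have [_ E] := is_derive_dirZ tau fd; rewrite [tau *: (1 : R^o)]mulr1 in E.
  by rewrite E.
have dc s := comp _ _ s (is_derive_cK k (t0 + tau * s)).
have ds s := comp _ _ s (is_derive_sK k (t0 + tau * s)).
elim: m => [|m [IHc IHs]].
  by split; split=> // s _; [exact: is_derive_continuous (dc s)|exact: is_derive_continuous (ds s)].
split.
- apply: (CkS_der (D := fun (u s : R^o) => u *: (tau *: (- k *: (sK k (t0 + tau * s) : R^o) : R^o) : R^o))).
  + exact: openT.
  + by move=> s _; exact: is_derive_continuous (dc s).
  + by move=> u s _; have := is_derive_dirZ u (dc s); rewrite [u *: (1 : R^o)]mulr1.
  + by move=> u; do 3 (apply: Ck_scale; [exact: openT|exact: Ck_cst|]).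
- apply: (CkS_der (D := fun (u s : R^o) => u *: (tau *: (cK k (t0 + tau * s) : R^o) : R^o))).
  + exact: openT.
  + by move=> s _; exact: is_derive_continuous (ds s).
  + by move=> u s _; have := is_derive_dirZ u (ds s); rewrite [u *: (1 : R^o)]mulr1.
  + by move=> u; do 2 (apply: Ck_scale; [exact: openT|exact: Ck_cst|]).
Qed.

Lemma is_derive_affine_cK_sK (k t0 tau : R) :
  is_derive (0 : R^o) (1 : R^o) (fun s : R^o => cK k (t0 + tau * s) : R^o) (tau * (- k * sK k t0)) /\
  is_derive (0 : R^o) (1 : R^o) (fun s : R^o => sK k (t0 + tau * s) : R^o) (tau * cK k t0).
Proof.
have da (s : R^o) : is_derive s (1 : R^o) (fun s : R^o => t0 + tau * s : R^o) tau.
  have := is_deriveD (@is_derive_cst R R^o R^o (t0 : R^o) s 1)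
    (is_derive_mul (@is_derive_cst R R^o R^o (tau : R^o) s 1) (@is_derive_id R R^o s 1)).
  by rewrite add0r mul0r add0r mulr1.
have comp (f : R^o -> R^o) d : is_derive (t0 : R^o) (1 : R^o) f d ->
    is_derive (0 : R^o) (1 : R^o) (fun s : R^o => f (t0 + tau * s)) (tau * d).
  move=> fd; have [/derivable1_diffP df _] := fd.
  have := is_derive_comp_diff (F := f) (g := fun s : R^o => t0 + tau * s : R^o) _ (da 0).
  rewrite mulr0 addr0 => /(_ df).
  have [_ E] := is_derive_dirZ tau fd; rewrite [tau *: (1 : R^o)]mulr1 in E.
  by rewrite E.
by split; apply: comp; [exact: is_derive_cK|exact: is_derive_sK].
Qed.

Lemma smooth_on_path (m l k : nat) (A : set 'rV[R]_m) (f : 'rV[R]_m -> 'rV[R]_l)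
    (c : R^o -> 'rV[R]_m) (I : set R^o) :
  smooth_on A f -> open I -> (forall k, Ck k I c) -> (forall s, I s -> A (c s)) ->
  Ck k I (fun s => f (c s)).
Proof.
move=> fA oI ck cA; apply: Ck_local => s Is.
have [U [F [oU Us Fk FE]]] := fA _ (cA s Is).
have cs : {for s, continuous c} := Ck_continuous (ck 0%N) Is.
have : \forall r \near s, I r /\ U (c r).
  apply: filterI; first exact: open_nbhs_nbhs.
  by apply: cs; exact: open_nbhs_nbhs.
move=> /near_open [B [oB Bs BP]]; exists B => //.
apply: (Ck_eq (f := fun r => F (c r)) oB).
  by move=> r /BP[Ir Ur]; exact: FE (cA r Ir) Ur.
apply: (Ck_comp oB oU _ (Fk k)); first by move=> r /BP[].
by apply: Ck_sub (ck k) => r /BP[].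
Qed.

Lemma is_derive_sqrt (f : R^o -> R^o) (t d : R^o) : 0 < f t -> is_derive t (1 : R^o) f d ->
  exists d', is_derive t (1 : R^o) (fun s => Num.sqrt (f s) : R^o) d'.
Proof.
move=> f0 fd; have dq : differentiable (Num.sqrt : R^o -> R^o) (f t).
  by apply/derivable1_diffP; case: (is_derive1_sqrt f0).
by eexists; exact: (is_derive_comp_diff dq fd).
Qed.

End SmoothAlongPaths.

Section Billiard.
Context {R : realType} (n : nat) (kappa : R) (M : linear_model n kappa).
Local Notation A := (ambient n kappa).
Local Notation E := 'rV[R]_n.+2.
Local Notation X := (mX M).
Local Notation Y := (mY M).
Local Notation q := (bil (mQ M)).
Local Notation b := (bil (mB M)).
Local Notation Mk := (@Mk R n kappa).
Local Notation C := (cK kappa).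
Local Notation S := (sK kappa).
Variables (N : set A) (a : E) (rho : R) (HN : umbilic_form M N a rho).
Variables (v : A -> A) (vP : smooth_unit_field N v).
Local Notation V p := ('D_(v p) X p).
Local Notation Gam p t := (geod p (v p) t).
Local Notation vN := (fun p : A => - v p).
Local Notation vNP := (smooth_unit_fieldN HN vP).
Variable U : set A.
Hypothesis fol : smooth_foliation U [set ray p (v p) | p in N].
Hypothesis folN : smooth_foliation U [set ray p (- v p) | p in N].
Hypothesis UN : forall x, U x -> ~ N x.

Lemma folNN : smooth_foliation U [set ray p (- vN p) | p in N].
Proof.
suff -> : [set ray p (- vN p) | p in N] = [set ray p (v p) | p in N] by [].
by apply/seteqP; split=> L [p Np <-]; exists p; rewrite ?opprK.
Qed.

Lemma U_back x : U x -> exists p t,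
  [/\ N p, 0 < t, (t%:E < Tk kappa)%E & x = Gam p (- t)].
Proof.
move=> /(U_Gam folN)[p [t [Np t0 tT ->]]]; exists p, t; split=> //.
exact: (GamN HN vP t Np).
Qed.

Lemma gam_coef p s s' : N p -> gam M v p s = gam M v p s' -> C s = C s' /\ S s = S s'.
Proof.
move=> Np; have [q0 _ b1] := v_tangent HN vP Np; have Mp := N_Mk HN Np.
rewrite /gam => H; have Cs : C s = C s'.
  have := congr1 (q (X p)) H; rewrite !bilDr !bilZr q0 (mQ_mX M Mp).
  by rewrite !mulr0 !addr0 !mulr1.
split=> //; move: H; rewrite Cs => /addrI H.
by have := congr1 (b (V p)) H; rewrite !bilZr b1 !mulr1.
Qed.

Lemma back_unique p p' (t t' : R) : N p -> N p' -> 0 < t -> (t%:E < Tk kappa)%E ->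
  0 < t' -> (t'%:E < Tk kappa)%E -> Gam p (- t) = Gam p' (- t') ->
  [/\ p' = p, C t' = C t & S t' = S t].
Proof.
move=> Np Np' t0 tT t'0 t'T E.
have pp : p' = p.
  apply: (ray_inj HN vNP folN folNN UN Np Np' t0 tT t'0 t'T).
  by rewrite !(GamN HN vP).
split=> //; rewrite pp in E.
all: have [|H1 H2] := @gam_coef p (- t') (- t) Np.
1,3: by rewrite -(GamE HN vP (- t) Np).2 -(GamE HN vP (- t') Np).2 E.
  by move: H1; rewrite !cKN.
by move: H2; rewrite !sKN => /oppr_inj.
Qed.

Lemma billiardE p t : N p -> 0 < t -> (t%:E < Tk kappa)%E ->
  billiard N v (Gam p (- t)) = Gam p t.
Proof.
move=> Np t0 tT; rewrite /billiard.
case: xgetP => [y _ [p' [t' [Np' t'0 t'T E ->]]]|/(_ (Gam p t))]; last first.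
  by case; exists p, t.
have [pp Ct St] := back_unique Np Np' t0 tT t'0 t'T E.
have [M1 X1] := GamE HN vP t Np; have [M2 X2] := GamE HN vP t' Np'.
have gE : gam M v p t' = gam M v p t.
  exact: (congr2 (fun c s => c *: X p + s *: V p) Ct St).
apply: (X_inj (M := M)); [exact: M2|exact: M1|].
rewrite X2 pp gE; exact: esym X1.
Qed.

Lemma Ck_V (c : R^o -> A) (I : set R^o) k : open I -> (forall k, Ck k I c) ->
  (forall s, I s -> N (c s)) -> Ck k I (fun s => V (c s)).
Proof.
move=> oI ck Nc; have [sv _] := vP.
have vk := smooth_on_path k sv oI ck Nc.
have Dc s : I s -> domX M (c s) by move=> /Nc/(N_Mk HN); exact: Mk_domX.
apply: (Ck_eq (f := fun s => \sum_i (v (c s)) 0 i *: 'D_(delta_mx 0 i) X (c s)) oI).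
  move=> s Is; rewrite -derive_sum_coord //.
  exact: (X_differentiable M (N_Mk HN (Nc s Is))).
apply: (Ck_sum oI) => i; apply: (Ck_scale oI); first exact: (Ck_coord 0 i oI vk).
exact: (Ck_comp oI (open_domX M) Dc (Ck_derive _ (Ck_mX M k.+1)) (ck k)).
Qed.

(* The velocity in [E] of a variation of [gam p t]: the foot point moves with
   velocity [xi], the unit vector with velocity [eta] and [t] with velocity [tau]. *)
Definition variation p (t tau : R) (xi eta : E) : E :=
  C t *: xi + S t *: eta + tau *: gam' M v p t.

Lemma variation_path (c : R^o -> A) (e : R) p (t tau : R) (xi eta : E) : 0 < e ->
  (forall k, Ck k [set s : R^o | `|s| < e] c) -> (forall s : R^o, `|s| < e -> N (c s)) ->
  c 0 = p -> is_derive (0 : R^o) (1 : R^o) (X \o c) xi ->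
  is_derive (0 : R^o) (1 : R^o) (fun s => V (c s)) eta ->
  let z (s : R^o) := gam M v (c s) (t + tau * s) in
  [/\ forall k, Ck k [set s : R^o | `|s| < e] z,
      forall s : R^o, `|s| < e -> q (z s) (z s) = 1 /\ Y (z s) = Gam (c s) (t + tau * s),
      z 0 = X (Gam p t) &
      is_derive (0 : R^o) (1 : R^o) z (variation p t tau xi eta)].
Proof.
move=> e0 ck Nc c0 dX dV z; have oI := @open_interval R e.
have N0 : N (c 0) by apply: Nc; rewrite normr0.
split.
- move=> k; have [cc cs] := Ck_affine_cK_sK kappa t tau k.
  apply: (CkD oI); apply: (Ck_scale oI); try exact: Ck_sub (@subsetT _ _) _.
    apply: (Ck_comp oI (open_domX M) _ (Ck_mX M k) (ck k)).
    by move=> s /Nc/(N_Mk HN); exact: Mk_domX.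
  exact: Ck_V.
- move=> s /Nc Ns; have [Ms Xs] := GamE HN vP (t + tau * s) Ns.
  by rewrite /z -Xs; split; [exact: mQ_mX|rewrite mXK //; exact: Mk_domX].
- have Np : N p by rewrite -c0.
  by rewrite /z mulr0 addr0 c0 (GamE HN vP t Np).2.
have [dc ds] := is_derive_affine_cK_sK kappa t tau.
have H := is_deriveD (is_derive_scale dc dX) (is_derive_scale ds dV).
apply: (is_derive_conv H) => //.
rewrite /variation /gam' mulr0 addr0 /= c0.
by apply/rowP => i; rewrite !mxE; ring.
Qed.

Lemma derivable_tangentN (c : R^o -> A) p u : is_derive (0 : R^o) (1 : R^o) c u ->
  c 0 = p -> (\forall s \near (0 : R^o), N (c s)) -> tangent N p u.
Proof.
move=> dc c0 nN; have Np : N p by rewrite -c0; exact: nbhs_singleton nN.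
have Mp := N_Mk HN Np.
have dXc : is_derive (0 : R^o) (1 : R^o) (X \o c) ('D_u X p).
  by have := @chain_X _ _ _ M c 0 u; rewrite c0 => /(_ Mp dc).
have dcE := @is_derive_cst R R^o E a (0 : R^o) 1.
have dd := is_deriveB dXc dcE; rewrite subr0 in dd.
have cstD (f : R^o -> R^o) (k d : R) : is_derive (0 : R^o) (1 : R^o) f d ->
    (forall t, N (c t) -> f t = k) -> d = 0.
  move=> df fk; apply: is_derive_unique df _.
  apply: near_eq_is_derive (@is_derive_cst R R^o R^o k 0 1).
  by apply: filterS nN => t /fk ->.
have /cstD H1 := is_derive_bil (mQ M) dXc dXc.
have /cstD H2 := is_derive_bil (mB M) dd dd.
have ev : (X \o c - cst a) 0 = X p - a by rewrite -c0.
have ev' : (X \o c) 0 = X p by rewrite -c0.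
apply/(tangentN HN); split=> //.
  have := H1 1 (fun t Nt => mQ_mX M (N_Mk HN Nt)); rewrite ev' (qC M _ (X p)); lra.
have := H2 rho (fun t Nt => b_eta HN Nt); rewrite ev (bC M _ (X p - a)); lra.
Qed.

Lemma is_field_derivativeN p W : N p -> is_field_derivative M N a v p W ->
  is_field_derivative M N a vN p (fun u => - W u).
Proof.
move=> Np [Wl HW WF]; have Mp := N_Mk HN Np.
have VN x : N x -> 'D_(- v x) X x = - V x.
  by move=> Nx; rewrite -scaleN1r (dXZ M) ?scaleN1r //; exact: (N_Mk HN Nx).
split.
- by move=> k u w; rewrite Wl opprD scalerN.
- move=> c t0 u dc ct0 Nc; have H := is_deriveN (HW c t0 u dc ct0 Nc).
  by apply: near_eq_is_derive H; apply: filterS Nc => s Ns; rewrite VN.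
- move=> u Tu; have [h1 h2 h3] := WF u Tu.
  have e1 : q (X p) (- W u) = - (kappa * b ('D_u X p) ('D_(- v p) X p)).
    by rewrite (VN p Np) bilNr h1 bilNr mulrN.
  have e2 : b (X p - a) (- W u) = - b ('D_u X p) ('D_(- v p) X p).
    by rewrite (VN p Np) bilNr h2 bilNr.
  split; [exact: e1|exact: e2|].
  by rewrite (VN p Np) bilNr bilNl opprK.
Qed.

Section AtPoint.
Variables (p : A) (t : R) (W : A -> E).
Hypothesis (Np : N p) (t0 : 0 < t) (tT : (t%:E < Tk kappa)%E).
Hypothesis HW : is_field_derivative M N a v p W.
Local Notation x := (Gam p (- t)).
Local Notation y := (Gam p t).

Lemma back_nondegenerate u (lam : R) : tangent N p u ->
  C t *: 'D_u X p - S t *: W u = lam *: gam' M v p (- t) -> u = 0 /\ lam = 0.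
Proof.
move=> Tu H; have u0 : u = 0.
  apply: (nondegenerate HN vNP folN Np (is_field_derivativeN Np HW) t0 tT Tu (lam := - lam)).
  by rewrite scalerN H (gamN HN v t Np).2 scalerN scaleNr opprK.
split=> //; move: H; have [Wl _ _] := HW.
have W0 : W 0 = 0.
  have := Wl 1 0 0; rewrite !scale1r addr0 => /eqP.
  by rewrite -subr_eq0 opprD addNKr oppr_eq0 => /eqP.
rewrite u0 derive0 W0 !scaler0 subr0 => /esym/eqP; rewrite scaler_eq0.
by rewrite (negbTE (gam'_neq0 HN vP (- t) Np)) orbF => /eqP.
Qed.

(* All quantities determining the ray through [k s] and the parameter of [k s]
   on it are recovered from [k s] and its image, except for the foot point at
   parameters where [C] vanishes; there it is found along the leaf. *)
Lemma preimage_derivable (k : R^o -> A) (ps : R^o -> A) (ts : R^o -> R) (e : R)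
    (x' y' : E) : 0 < e ->
  (forall s : R^o, `|s| < e -> [/\ N (ps s), 0 < ts s, ((ts s)%:E < Tk kappa)%E &
      k s = Gam (ps s) (- ts s)]) ->
  ps 0 = p -> C (ts 0) = C t -> S (ts 0) = S t ->
  (exists u, is_derive (0 : R^o) (1 : R^o) k u) ->
  is_derive (0 : R^o) (1 : R^o) (fun s => X (k s)) x' ->
  is_derive (0 : R^o) (1 : R^o) (fun s => gam M v (ps s) (ts s)) y' ->
  exists C' S' P', [/\ is_derive (0 : R^o) (1 : R^o) (fun s => C (ts s) : R^o) C',
    is_derive (0 : R^o) (1 : R^o) (fun s => S (ts s) : R^o) S' &
    is_derive (0 : R^o) (1 : R^o) (fun s => X (ps s)) P'].
Proof.
move=> e0 He p0 Ct St [ku dk] dx dy.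
have nearE (P : R^o -> Prop) : (forall s : R^o, `|s| < e -> P s) -> \forall s \near (0 : R^o), P s.
  by move=> HP; apply/near0P; exists e.
have Xk s : `|s| < e -> X (k s) = C (ts s) *: X (ps s) - S (ts s) *: V (ps s).
  by move=> /He[Ns _ _ ->]; rewrite (GamE HN vP _ Ns).2 /gam cKN sKN scaleNr.
have dcst (z : E) := @is_derive_cst R R^o E z (0 : R^o) 1.
have St0 : 0 < S t := sK_gt0 t0 tT.
pose Z s := 2^-1 *: (X (k s) + gam M v (ps s) (ts s)).
pose D s := 2^-1 *: (gam M v (ps s) (ts s) - X (k s)).
have dZ : is_derive (0 : R^o) (1 : R^o) Z (2^-1 *: (x' + y')).
  by apply: is_deriveZ; exact: is_deriveD.
have dD : is_derive (0 : R^o) (1 : R^o) D (2^-1 *: (y' - x')).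
  by apply: is_deriveZ; exact: is_deriveB.
have ZE s : `|s| < e -> Z s = C (ts s) *: X (ps s).
  by move=> se; rewrite /Z Xk // /gam; apply/rowP => i; rewrite !mxE; field.
have DE s : `|s| < e -> D s = S (ts s) *: V (ps s).
  by move=> se; rewrite /D Xk // /gam; apply/rowP => i; rewrite !mxE; field.
have dC : is_derive (0 : R^o) (1 : R^o) (fun s => C (ts s) : R^o)
    (bil (mQ M) 0 (Z 0) + q (cst a (0 : R^o)) (2^-1 *: (x' + y'))).
  apply: near_eq_is_derive (is_derive_bil (mQ M) (dcst a) dZ).
  apply: nearE => s se; rewrite ZE // /cst bilZr (q_aX HN) ?mulr1 //.
  by case: (He s se).
have [S' dS] : exists S', is_derive (0 : R^o) (1 : R^o) (fun s => S (ts s) : R^o) S'.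
  have DD s : `|s| < e -> b (D s) (D s) = S (ts s) ^+ 2.
    move=> se; have [Ns _ _ _] := He s se; have [_ _ b1] := v_tangent HN vP Ns.
    by rewrite DE // bilZl bilZr b1 mulr1 expr2.
  have DD0 : 0 < b (D 0) (D 0) by rewrite DD ?normr0 // St exprn_gt0.
  have [S' dS] := is_derive_sqrt DD0 (is_derive_bil (mB M) dD dD).
  exists S'; apply: near_eq_is_derive dS; apply: nearE => s se.
  have [Ns s0 sT _] := He s se.
  by rewrite DD // sqrtr_sqr ger0_norm // ltW // sK_gt0.
set C' := _ + _ in dC.
suff [P' dP] : exists P', is_derive (0 : R^o) (1 : R^o) (fun s => X (ps s)) P'.
  by exists C', S', P'.
have [C0|C0] := eqVneq (C t) 0; last first.
  have C00 : (fun s : R^o => C (ts s) : R^o) 0 != 0 by rewrite /= Ct.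
  have dI := @is_derive_inv R _ (fun s : R^o => C (ts s) : R^o) 0 1 _ C00 dC.
  eexists; apply: near_eq_is_derive (is_derive_scale dI dZ).
  have nC : \forall s \near (0 : R^o), C (ts s) != 0.
    have ep : 0 < `|C (ts 0)| by rewrite normr_gt0.
    have /cvgrPdist_lt/(_ _ ep) := is_derive_continuous dC.
    by apply: filterS => s; apply: contraTneq => ->; rewrite subr0 ltxx.
  have nZ := nearE _ ZE.
  near=> s; have Cs : C (ts s) != 0 by near: s.
  have -> : Z s = C (ts s) *: X (ps s) by near: s.
  by rewrite scalerA mulVf // scale1r.
have [H1 H2 H3 H4] := He 0 (eq_ind_r (fun r => r < e) e0 (normr0 _)).
have Ux0 : U (geod p (- v p) t) := Gam_U folN Np t0 tT.
have [ O [g [oO Oy dg gP]]] := leaf_direction HN vNP folN Ux0.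
have k0 : k 0 = geod p (- v p) t.
  rewrite H4 p0 (GamN HN vP t Np).
  have [M1 X1] := GamE HN vP (- ts 0) Np; have [M2 X2] := GamE HN vP (- t) Np.
  apply: (X_inj (M := M)); [exact: M1|exact: M2|].
  by rewrite X1 X2 /gam !cKN !sKN Ct St.
have dgk := is_derive_comp_diff (F := g) (g := k) (eq_ind_r (fun z => differentiable g z) dg k0) dk.
have nO := is_derive_near_open dk k0 oO Oy.
have gaE s : `|s| < e -> O (k s) -> exists r, gam' M v (ps s) (- ts s) = r *: g (k s).
  move=> se Os; have [Ns s0 sT kE] := He s se.
  have kE' : k s = geod (ps s) (vN (ps s)) (ts s) by rewrite kE (GamN HN vP).
  rewrite kE' in Os; have [r rE] := gP _ _ Ns s0 sT Os.
  exists (- r); rewrite scaleNr kE' -rE (gamN HN v (ts s) Ns).2 opprK //.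
have PE s : `|s| < e -> O (k s) -> S (ts s) * q a (g (k s)) != 0 ->
    X (ps s) = C (ts s) *: X (k s) +
      ((1 - C (ts s) * q a (X (k s))) * (q a (g (k s)))^-1) *: g (k s).
  move=> se Os; rewrite mulf_eq0 negb_or => /andP[S0 g0].
  have [r rE] := gaE s se Os; have [Ns s0 sT kE] := He s se.
  have PB : X (ps s) = C (ts s) *: X (k s) + S (ts s) *: (r *: g (k s)).
    rewrite -rE {1}(gam_back M v (ps s) (- ts s)) cKN sKN scaleNr opprK.
    by rewrite kE (GamE HN vP _ Ns).2.
  have : q a (X (ps s)) = 1 by exact: (q_aX HN Ns).
  rewrite [in X in X -> _]PB bilDr !bilZr => E1.
  rewrite {1}PB; congr (_ + _); rewrite scalerA; congr (_ *: _).
  by rewrite -E1 addrC addKr mulrA mulfK.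
have g00 : q a (g (k 0)) != 0.
  have n0 : `|0 : R^o| < e by rewrite normr0.
  have [r rE] := gaE 0 n0 (nbhs_singleton nO).
  have := q_aX HN H1; rewrite (gam_back M v (ps 0) (- ts 0)) rE cKN sKN Ct C0.
  rewrite scale0r add0r scaleNr opprK !bilZr.
  by move=> H; apply: contra_eq_neq H => ->; rewrite !mulr0 eq_sym oner_neq0.
have dqg := is_derive_bil (mQ M) (dcst a) dgk.
have dqx := is_derive_bil (mQ M) (dcst a) dx.
have dI := @is_derive_inv R _ (fun s : R^o => q a (g (k s)) : R^o) 0 1 _ g00 dqg.
have d1 := is_deriveB (@is_derive_cst R R^o R^o (1 : R^o) (0 : R^o) 1) (is_derive_mul dC dqx).
have H := is_deriveD (is_derive_scale dC dx) (is_derive_scale (is_derive_mul d1 dI) dgk).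
eexists; apply: near_eq_is_derive H.
have nS : \forall s \near (0 : R^o), S (ts s) * q a (g (k s)) != 0.
  have ds := is_derive_mul dS dqg.
  have ep : 0 < `|S (ts 0) * q a (g (k 0))|.
    by rewrite normr_gt0 mulf_neq0 // St gt_eqF.
  have /cvgrPdist_lt/(_ _ ep) := is_derive_continuous ds.
  by apply: filterS => s; apply: contraTneq; rewrite /cst /= => ->; rewrite subr0 ltxx.
have ne : \forall s \near (0 : R^o), `|s| < e by exact: nearE.
near=> s; have se : `|s| < e by near: s.
have Os : O (k s) by near: s.
have Ss : S (ts s) * q a (g (k s)) != 0 by near: s.
by rewrite (PE s se Os Ss).
Unshelve. all: by end_near. Qed.

Lemma billiard_tdiff u (tau : R) : tangent N p u ->
  let e := 'D_(variation p (- t) (- tau) ('D_u X p) (W u)) Y (X x) in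
  [/\ tangent U x e,
      'D_e X x = variation p (- t) (- tau) ('D_u X p) (W u) &
      'D_(tdiff U (billiard N v) x e) X y = variation p t tau ('D_u X p) (W u)].
Proof.
move=> Tu e; have [Wl HWc WF] := HW; have Mp := N_Mk HN Np.
have [c cP] := Tu; have [e0 e00 [ck Nc c0 dc]] := path_atP cP.
have nN : \forall s \near (0 : R^o), N (c s) by apply/near0P; exists e0.
have dV := HWc c 0 u dc c0 nN; have dXc := path_X M (N_Mk HN) cP.
have [e1 e10 He1] := Tk_lt_near tT t0.
pose e2 := Num.min e0 (e1 / (`|tau| + 1)).
have tau1 : 0 < `|tau| + 1 by rewrite ltr_wpDl.
have e20 : 0 < e2 by rewrite lt_min e00 divr_gt0.
have e2P (s : R^o) : `|s| < e2 -> `|s| < e0 /\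
    (0 < t + tau * s /\ ((t + tau * s)%:E < Tk kappa)%E).
  rewrite lt_min => /andP[s0 s1]; split=> //; apply: He1.
  rewrite addrC addKr normrM; move: s1; rewrite ltr_pdivlMr // => s1.
  apply: le_lt_trans s1; rewrite mulrC ler_wpM2l //; lra.
have Nc2 (s : R^o) : `|s| < e2 -> N (c s) by move=> /e2P[/Nc].
have ck2 k : Ck k [set s : R^o | `|s| < e2] c by apply: Ck_sub (ck k) => s /e2P[].
have [zk zE z0 dz] := variation_path (- t) (- tau) e20 ck2 Nc2 c0 dXc dV.
have [zk' zE' z0' dz'] := variation_path t tau e20 ck2 Nc2 c0 dXc dV.
have [Mx _] := GamE HN vP (- t) Np; have [My _] := GamE HN vP t Np.
have Uz (s : R^o) : `|s| < e2 -> domY M (gam M v (c s) (- t + - tau * s)) ->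
    U (Y (gam M v (c s) (- t + - tau * s))).
  move=> se _; have [_ [ts tsT]] := e2P s se; rewrite (zE s se).2.
  have -> : - t + - tau * s = - (t + tau * s) by ring.
  exact: (Gam_NU HN vP folN (Nc2 s se)).
have Uz' (s : R^o) : `|s| < e2 -> domY M (gam M v (c s) (t + tau * s)) ->
    U (Y (gam M v (c s) (t + tau * s))).
  move=> se _; have [_ [ts tsT]] := e2P s se; rewrite (zE' s se).2.
  exact: (Gam_U fol (Nc2 s se)).
have [pathx dex] := lift_path Mx e20 zk (fun s se => (zE s se).1) Uz z0 dz.
have [pathy dey] := lift_path My e20 zk' (fun s se => (zE' s se).1) Uz' z0' dz'.
split; [by eexists; exact: pathx|exact: dex|].
have B0 : is_derive (0 : R^o) (1 : R^o)
    (billiard N v \o (Y \o (fun s : R^o => gam M v (c s) (- t + - tau * s))))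
    ('D_(variation p t tau ('D_u X p) (W u)) Y (X y)).
  have [e4 e40 [_ _ _ dYy]] := path_atP pathy.
  apply: near_eq_is_derive dYy; apply/near0P; exists e2 => // s se /=.
  have [_ [ts tsT]] := e2P s se; rewrite (zE s se).2 (zE' s se).2.
  have -> : - t + - tau * s = - (t + tau * s) by ring.
  by rewrite billiardE //; exact: Nc2.
rewrite /tdiff; case: xgetP => [w -> [k [kP dBk ->]]|]; last first.
  move/(_ ('D_(variation p t tau ('D_u X p) (W u)) Y (X y))); case.
  exists (Y \o (fun s : R^o => gam M v (c s) (- t + - tau * s))); split.
  - exact: pathx.
  - exact: (@ex_derive _ _ _ _ _ _ _ B0).
  - by rewrite derive1E; exact: esym (@derive_val _ _ _ _ _ _ _ B0).
rewrite derive1E; set w' := derive (billiard N v \o k) _ _.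
have dB : is_derive (0 : R^o) (1 : R^o) (billiard N v \o k) w' by exact/derivableP.
have [e3 e30 [_ Uk k0 dk]] := path_atP kP.
have UM z : U z -> Mk z by move=> /(U_Gam fol)[p' [t' [Np' _ _ ->]]]; case: (GamE HN vP t' Np').
have ex (s : R^o) : exists pt : A * R, `|s| < e3 -> [/\ N pt.1, 0 < pt.2, (pt.2%:E < Tk kappa)%E &
    k s = Gam pt.1 (- pt.2)].
  have [se|se] := ltP `|s| e3; last by exists (p, t).
  by have [p' [t' H]] := U_back (Uk s se); exists (p', t').
pose pt s := sval (cid (ex s)).
have ptP (s : R^o) : `|s| < e3 -> [/\ N (pt s).1, 0 < (pt s).2, ((pt s).2%:E < Tk kappa)%E &
    k s = Gam (pt s).1 (- (pt s).2)] by exact: (svalP (cid (ex s))).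
have n0 : `|0 : R^o| < e3 by rewrite normr0.
have [N0 t00 t0T k0E] := ptP 0 n0.
have [p0 C0 S0] : [/\ (pt 0).1 = p, C (pt 0).2 = C t & S (pt 0).2 = S t].
  by apply: back_unique => //; rewrite -k0E k0.
have dXk : is_derive (0 : R^o) (1 : R^o) (fun s => X (k s)) ('D_e X x).
  by have := path_X M UM kP.
have By : (billiard N v \o k) 0 = y by rewrite /= k0 billiardE.
have dXBk : is_derive (0 : R^o) (1 : R^o) (fun s => X (billiard N v (k s))) ('D_w' X y).
  by have := @chain_X _ _ _ M (billiard N v \o k) 0 w'; rewrite By => /(_ My dB).
have dy : is_derive (0 : R^o) (1 : R^o) (fun s => gam M v (pt s).1 (pt s).2) ('D_w' X y).
  apply: near_eq_is_derive dXBk; apply/near0P; exists e3 => // s se.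
  by have [Ns s0 sT kE] := ptP s se; rewrite kE billiardE // (GamE HN vP _ Ns).2.
have [C' [S' [P' [dC dS dP]]]] := preimage_derivable e30 ptP p0 C0 S0
  (ex_intro _ _ dk) dXk dy.
have dp : is_derive (0 : R^o) (1 : R^o) (fun s => (pt s).1) ('D_P' Y (X p)).
  have Dp : domY M (X (pt 0).1) by apply: domY_mX; rewrite p0.
  have := chain_Y Dp dP; rewrite p0; apply: near_eq_is_derive.
  apply/near0P; exists e3 => // s se; have [Ns _ _ _] := ptP s se.
  by rewrite /= mXK //; apply: Mk_domX; exact: (N_Mk HN Ns).
set u2 := 'D_P' Y _ in dp.
have nN2 : \forall s \near (0 : R^o), N (pt s).1.
  by apply/near0P; exists e3 => // s se; case: (ptP s se).
have Tu2 := derivable_tangentN dp p0 nN2.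
have dV2 := HWc _ 0 u2 dp p0 nN2.
have u2E : 'D_u2 X p = P'.
  have := @chain_X _ _ _ M (fun s => (pt s).1) 0 u2; rewrite p0 => /(_ Mp dp) H.
  exact: (is_derive_unique H dP).
have CS : C t * C' + kappa * S t * S' = 0.
  have H := is_deriveD (is_derive_mul dC dC)
    (is_derive_mul (@is_derive_cst R R^o R^o (kappa : R^o) (0 : R^o) 1) (is_derive_mul dS dS)).
  have H1 : is_derive (0 : R^o) (1 : R^o) (cst (1 : R^o)) 0 by exact: is_derive_cst.
  have := is_derive_unique H (near_eq_is_derive _ H1).
  rewrite /cst C0 S0 => E; apply: (mulfI (_ : 2 != 0 :> R)) => //.
  rewrite mulr0 -E; first by ring.
  by apply/near0P; exists 1 => // s _ /=; have := cK_sK kappa (pt s).2; rewrite !expr2.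
pose tau2 := C t * S' - S t * C'.
have C'E : C' = - kappa * S t * tau2.
  transitivity (C' * (C t ^+ 2 + kappa * S t ^+ 2)); first by rewrite cK_sK mulr1.
  transitivity (C t * (C t * C' + kappa * S t * S') - kappa * S t * tau2).
    by rewrite /tau2; ring.
  by rewrite CS mulr0 add0r !mulNr.
have S'E : S' = C t * tau2.
  transitivity (S' * (C t ^+ 2 + kappa * S t ^+ 2)); first by rewrite cK_sK mulr1.
  transitivity (S t * (C t * C' + kappa * S t * S') + C t * tau2).
    by rewrite /tau2; ring.
  by rewrite CS mulr0 add0r.
have yE : 'D_w' X y = variation p t tau2 P' (W u2).
  rewrite (is_derive_unique dy (is_deriveD (is_derive_scale dC dP) (is_derive_scale dS dV2))).
  rewrite /variation /gam' C0 S0 p0 C'E S'E.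
  by apply/rowP => i; rewrite !mxE; ring.
have xE : 'D_e X x = variation p (- t) (- tau2) P' (W u2).
  have H := is_deriveB (is_derive_scale dC dP) (is_derive_scale dS dV2).
  have -> : 'D_e X x = C' *: X p + C t *: P' - (S' *: V p + S t *: W u2).
    apply: is_derive_unique dXk _; rewrite p0 C0 S0 in H.
    apply: near_eq_is_derive H.
    apply/near0P; exists e3 => // s se; have [Ns _ _ kE] := ptP s se.
    by rewrite kE (GamE HN vP _ Ns).2 /gam cKN sKN scaleNr.
  rewrite /variation /gam' cKN sKN C'E S'E.
  by apply/rowP => i; rewrite !mxE; ring.
have [_ q2 b2] := (tangentN HN p u2).1 Tu2; have [_ qu bu] := (tangentN HN p u).1 Tu.
have Tuu : tangent N p (u2 - u).
  by apply/(tangentN HN); rewrite (dXB M) // !bilDr !bilNr q2 qu b2 bu subrr.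
have WB : W (u2 - u) = W u2 - W u.
  by rewrite addrC -scaleN1r Wl scaleN1r addrC.
have [uu tt] : u2 - u = 0 /\ tau2 - tau = 0.
  apply: back_nondegenerate => //; rewrite (dXB M) // u2E WB.
  have := xE; rewrite dex /variation cKN sKN => H.
  move: H; move: (gam' _ _ _ _) => ga H.
  have {H} : 0 = (C t *: P' + - S t *: W u2 + - tau2 *: ga) - (C t *: 'D_u X p + - S t *: W u + - tau *: ga).
    by rewrite -H subrr.
  move=> H; apply/eqP; rewrite -subr_eq0; apply/eqP; rewrite [RHS]H.
  by apply/rowP => i; rewrite !mxE; ring.
move/eqP: uu; rewrite subr_eq0 => /eqP uu; move/eqP: tt; rewrite subr_eq0 => /eqP tt.
by rewrite yE -u2E uu tt.
Qed.

End AtPoint.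

End Billiard.

(** * Volume and the characteristic polynomial *)

Section JacobiMatrix.
Context {K : comNzRingType} (n : nat).

Definition jacobi_mx (A : 'M[K]_n) (w : 'rV[K]_n) (C S r k : K) : 'M[K]_(n + 1 + 1) :=
  block_mx (block_mx (C%:M + S *: A) (- (S * r) *: w^T) (C *: w) 0)
           (col_mx (- (k * S) *: w^T) (- (k * S))%:M) (row_mx (S *: w) 0) C%:M.

Lemma det_jacobi_mx (A : 'M[K]_n) (w : 'rV[K]_n) (C S r k : K) :
  A *m w^T = 0 -> w *m w^T = 1%:M ->
  C ^+ 2 * \det (jacobi_mx A w C S r k) =
    \det (C%:M + S *: A) * (C * S * r) * (C ^+ 2 + k * S ^+ 2).
Proof.
move=> Aw ww.
pose T : 'M[K]_(n + 1 + 1) := block_mx (block_mx 1%:M ((S * r) *: w^T) 0 C%:M)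
  (col_mx ((k * S) *: w^T) 0) 0 C%:M.
have dT : \det T = C ^+ 2 by rewrite !det_ublock det1 mul1r !det_scalar1 expr2.
pose L : 'M[K]_(n + 1 + 1) := block_mx (block_mx (C%:M + S *: A) 0 (C *: w) (C * S * r)%:M)
  0 (row_mx (S *: w) (S * S * r)%:M) (C ^+ 2 + k * S ^+ 2)%:M.
have LE : jacobi_mx A w C S r k *m T = L.
  have Cw c : (C%:M + S *: A) *m (c *: w^T) = (C * c) *: w^T.
    by rewrite mulmxDl -scalemxAl -!scalemxAr Aw !scaler0 addr0 mul_scalar_mx scalerA mulrC.
  have wc c d : (c *: w) *m (d *: w^T) = (c * d)%:M :> 'M[K]_1.
    by rewrite -scalemxAl -scalemxAr ww scalerA scale_scalar_mx mulr1.
  rewrite /jacobi_mx /T /L !mulmx_block !mul_block_col !mul_row_block !mul_row_col.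
  rewrite !mulmx0 !mulmx1 !addr0 !mul0mx !addr0 !Cw !wc !mul_mx_scalar.
  rewrite scale_col_mx add_col_mx !scalerA !scale_scalar_mx -!scalerDl -!raddfD /=.
  congr block_mx; first congr block_mx.
  - by rewrite mulrN subrr scale0r.
  - by rewrite mulrA.
  - by rewrite !mulrN !subrr scale0r raddf0 col_mx0.
  - by rewrite mulrA.
  - by congr (_%:M); ring.
have := congr1 determinant LE; rewrite det_mulmx dT !det_lblock !det_scalar1 => <-.
by rewrite mulrC.
Qed.

Lemma jacobi_mxZ (A : 'M[K]_n) (w : 'rV[K]_n) (C S r k : K) :
  jacobi_mx A w (S * C) S r k = S *: jacobi_mx A w C 1 r k.
Proof.
rewrite /jacobi_mx !scale_block_mx scale_col_mx scale_row_mx !scalerA !scale_scalar_mx.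
rewrite !scaler0 scalerDr !scale_scalar_mx !scalerA !mulr1 mul1r !mulrN.
by rewrite [k * S]mulrC.
Qed.

End JacobiMatrix.

Lemma map_jacobi_mx (K K' : comNzRingType) (f : {rmorphism K -> K'}) n
    (A : 'M[K]_n) (w : 'rV[K]_n) (C S r k : K) :
  map_mx f (jacobi_mx A w C S r k) =
  jacobi_mx (map_mx f A) (map_mx f w) (f C) (f S) (f r) (f k).
Proof.
rewrite /jacobi_mx !map_block_mx map_col_mx map_row_mx !map_mxZ !map_scalar_mx !map_mx0.
by rewrite map_mxD map_mxZ map_scalar_mx !map_trmx !rmorphN !rmorphM.
Qed.

Section Parity.
Context {R : realType} (n : nat).

Lemma poly_eq0_injective (p : {poly R}) (f : nat -> R) : injective f ->
  (forall i, p.[f i] = 0) -> p = 0.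
Proof.
move=> fI p0; apply/eqP/negP => /negP pN0.
have := max_poly_roots pN0 (rs := [seq f i | i <- iota 0 (size p)]).
rewrite size_map size_iota ltnn => /(_ _ _)/negP; apply=> //.
  by apply/allP => x /mapP[i _ ->]; rewrite /root p0.
by rewrite map_inj_uniq ?iota_uniq.
Qed.

Variables (A : 'M[R]_n) (w : 'rV[R]_n) (r k : R).
Hypothesis (Aw : A *m w^T = 0) (ww : w *m w^T = 1%:M) (r0 : r != 0).

Let J : {poly R} := \det (jacobi_mx (map_mx polyC A) (map_mx polyC w) 'X 1 r%:P k%:P).

Lemma horner_J z : J.[z] = \det (jacobi_mx A w z 1 r k).
Proof.
have mapC m l (D : 'M[R]_(m, l)) : map_mx (horner_eval z) (map_mx polyC D) = D.
  by apply/matrixP => i j; rewrite !mxE horner_evalE hornerC.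
rewrite -horner_evalE /J -det_map_mx map_jacobi_mx /= !mapC rmorph1.
by rewrite !horner_evalE hornerX !hornerC.
Qed.

Lemma horner_char_poly z : \det (z%:M + A) = (-1) ^+ n * (char_poly A).[- z].
Proof.
rewrite -horner_evalE /char_poly -det_map_mx -detZ; congr (\det _).
apply/matrixP => i j; rewrite !mxE /= horner_evalE !hornerE hornerMn hornerX.
by rewrite mulN1r opprB mulNrn opprK addrC.
Qed.

Lemma mul_horner_J z : z ^+ 2 * J.[z] =
  (-1) ^+ n * (char_poly A).[- z] * (z * r) * (z ^+ 2 + k).
Proof.
have := det_jacobi_mx z 1 r k Aw ww.
by rewrite horner_J => ->; rewrite scale1r horner_char_poly mulr1 expr1n mulr1.
Qed.

Let J2 : {poly R} := J + (-1) ^+ n *: (J \Po (- 'X)).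

Lemma horner_J2 z : J2.[z] = J.[z] + (-1) ^+ n * J.[- z].
Proof. by rewrite !hornerE horner_comp !hornerE. Qed.

Lemma char_poly_parity :
  (forall s, (char_poly A).[- s] = (-1) ^+ n * (char_poly A).[s]) ->
  forall z, \det (jacobi_mx A w z 1 r k) = (-1) ^+ n.+1 * \det (jacobi_mx A w (- z) 1 r k).
Proof.
move=> par z; rewrite -!horner_J exprS -mulrA mulN1r; apply/eqP.
rewrite -subr_eq0 opprK -horner_J2; suff -> : J2 = 0 by rewrite horner0.
apply: (@poly_eq0_injective _ (fun i => i.+1%:R)) => [i j /eqP|i].
  by rewrite eqr_nat => /eqP[].
rewrite horner_J2; set x := i.+1%:R; have x0 : x != 0 by rewrite pnatr_eq0.
apply: (mulfI (expf_neq0 2 x0)); rewrite mulr0 mulrDr mulrCA.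
have := mul_horner_J (- x); rewrite !sqrrN => ->; rewrite mul_horner_J par opprK.
have : (-1) ^+ n * (-1) ^+ n = 1 :> R by rewrite -expr2 sqrr_sign.
by move: ((-1) ^+ n) => s s1; ring: s1.
Qed.

Lemma jacobi_parity (f : nat -> R) : injective f ->
  (forall i, \det (jacobi_mx A w (f i) 1 r k) =
    (-1) ^+ n.+1 * \det (jacobi_mx A w (- f i) 1 r k)) ->
  forall s, (char_poly A).[- s] = (-1) ^+ n * (char_poly A).[s].
Proof.
move=> fI H s.
have J20 : J2 = 0.
  apply: (poly_eq0_injective fI) => i.
  by rewrite horner_J2 !horner_J H exprS mulN1r mulNr addNr.
have sg : (-1) ^+ n * (-1) ^+ n = 1 :> R by rewrite -expr2 sqrr_sign.
pose D : {poly R} := char_poly A \Po (- 'X) - (-1) ^+ n *: char_poly A.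
have DE z : D.[z] = (char_poly A).[- z] - (-1) ^+ n * (char_poly A).[z].
  by rewrite !hornerE horner_comp !hornerE.
suff D0 : D = 0 by have := DE s; rewrite D0 horner0 => /esym/eqP; rewrite subr_eq0 => /eqP.
have XN0 : 'X * ('X^2 + k%:P) != 0 :> {poly R}.
  rewrite mulf_neq0 ?polyX_eq0 // -size_poly_eq0 size_polyDl ?size_polyXn //.
  by rewrite (leq_ltn_trans (size_polyC_leq1 k)).
apply: (mulfI XN0); rewrite mulr0.
apply: (@poly_eq0_injective _ (fun i => i%:R)) => [i j /eqP|i].
  by rewrite eqr_nat => /eqP.
move: (i%:R : R) => z; rewrite hornerM DE !hornerE.
have H1 := mul_horner_J z; have H2 := mul_horner_J (- z); rewrite sqrrN opprK in H2.
have H3 : J.[z] + (-1) ^+ n * J.[- z] = 0 by rewrite -horner_J2 J20 horner0.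
apply: (mulfI r0); rewrite mulr0; move: H1 H2 H3 sg.
move: ((-1) ^+ n) => s1 H1 H2 H3 sg.
have : s1 * (z ^+ 2 * (J.[z] + s1 * J.[- z])) = 0 by rewrite H3 !mulr0.
rewrite mulrDr [z ^+ 2 * (s1 * _)]mulrCA H1 H2 => <-.
by ring: sg.
Qed.

End Parity.

Section GramSchmidt.
Context {R : realType} (m : nat) (B : 'M[R]_m).
Hypothesis Bsym : B^T = B.

Lemma Gram_Schmidt l (K : 'M[R]_(l, m)) d : \rank K = d ->
  (forall z : 'rV[R]_m, (z <= K)%MS -> z != 0 -> 0 < bil B z z) ->
  exists Z : 'M[R]_(d, m), (Z :=: K)%MS /\ Z *m B *m Z^T = 1%:M.
Proof.
elim: d l K => [|d IH] l K rK Kpos.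
  exists 0; split; last by apply/matrixP => -[].
  by apply/eqmxP; move/eqP: rK; rewrite mxrank_eq0 => /eqP ->; rewrite !sub0mx.
have K0 : K != 0 by rewrite -mxrank_eq0 rK.
pose z0 := nz_row K; have z00 : z0 != 0 by rewrite nz_row_eq0.
have bz : 0 < bil B z0 z0 by apply: Kpos => //; exact: nz_row_sub.
pose z := (Num.sqrt (bil B z0 z0))^-1 *: z0.
have zK : (z <= K)%MS by rewrite scalemx_sub // nz_row_sub.
have b1 : bil B z z = 1.
  by rewrite bilZl bilZr mulrA -expr2 exprVn sqr_sqrtr ?ltW // mulVf // gt_eqF.
pose f := B *m z^T; pose K' := (K :&: kermx f)%MS.
have zf : z *m f = 1%:M by rewrite mulmxA [LHS]mx11_scalar -[in RHS]b1.
have rKf : \rank (K *m f) = 1%N.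
  apply/eqP; rewrite eqn_leq rank_leq_col lt0n mxrank_eq0.
  apply: contraTneq zK => Kf0; apply/negP => /submxP[D zD].
  by move: zf; rewrite zD -mulmxA Kf0 mulmx0 => /esym/eqP; rewrite oner_eq0.
have rK' : \rank K' = d by have := mxrank_mul_ker K f; rewrite rKf rK => -[].
have [z1 z1K|Z [ZK ZB]] := IH _ K' rK'.
  by apply: Kpos; exact: submx_trans z1K (capmxSl _ _).
have Zf : Z *m f = 0 by apply/sub_kermxP; rewrite ZK capmxSr.
pose Z' : 'M[R]_(1 + d, m) := col_mx z Z; exists Z'.
have fZ : z *m B *m Z^T = 0.
  by apply: trmx_inj; rewrite trmx_mul trmxK trmx_mul Bsym trmx0.
have ZZ : Z' *m B *m Z'^T = 1%:M.
  rewrite /Z' tr_col_mx mul_col_mx mul_col_row -mulmxA zf fZ ZB -mulmxA Zf.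
  by rewrite -scalar_mx_block.
have Z'K : (Z' <= K)%MS by rewrite col_mx_sub zK ZK capmxSl.
split=> //; apply/eqmxP; rewrite -(geq_leqif (mxrank_leqif_eq Z'K)) rK.
have /eqP -> : row_free Z' by apply/row_freeP; exists (B *m Z'^T); rewrite mulmxA.
by [].
Qed.

End GramSchmidt.

Section CastDeterminant.
Context {R : realType}.

Lemma det_castmx_mul m k (e : m = k) (L : 'M[R]_m) (Z : 'M[R]_(m, k)) :
  \det (castmx (e, erefl k) (L *m Z)) = \det L * \det (castmx (e, erefl k) Z).
Proof. by case: k / e Z => Z; rewrite !castmx_id det_mulmx. Qed.

Lemma det_castmx_neq0 m k (e : m = k) (Z : 'M[R]_(m, k)) :
  (forall c : 'rV[R]_m, c *m Z = 0 -> c = 0) -> \det (castmx (e, erefl k) Z) != 0.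
Proof.
case: k / e Z => Z H; rewrite castmx_id -unitfE -unitmxE -row_free_unit -kermx_eq0.
by apply/eqP/row_matrixP => i; rewrite row0; apply: H; rewrite -row_mul mulmx_ker row0.
Qed.

Lemma det_castmx_span m k (e : m = k) (Z : 'M[R]_(m, k)) (z : 'rV[R]_k) :
  \det (castmx (e, erefl k) Z) != 0 -> exists c, z = c *m Z.
Proof.
case: k / e Z z => Z z; rewrite castmx_id -unitfE -unitmxE => uZ.
by exists (z *m invmx Z); rewrite mulmxKV.
Qed.

Lemma stack_castmx n m (e1 : n.+1 = m) (e2 : (m + 1)%N = n.+2) (F : 'M[R]_(m, n.+2))
    (f : 'I_n.+1 -> 'rV[R]_n.+2) z : (forall k, f k = row (cast_ord e1 k) F) ->
  \matrix_(i < n.+2, j < n.+2) (if insub (i : nat) is Some k then f k else z) 0 j =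
  castmx (e2, erefl n.+2) (col_mx F z).
Proof.
move=> fF; apply/matrixP => i j; rewrite mxE castmxE /= cast_ord_id mxE.
case: splitP => l /= il.
  case: insubP => [k _ kE|]; last by rewrite il; have := ltn_ord l; rewrite -{2}e1 => ->.
  by rewrite fF mxE; congr (F _ _); apply: val_inj; rewrite /= kE il.
by rewrite insubF ?ord1 // il ord1 addn0 -e1 ltnn.
Qed.

End CastDeterminant.

Lemma bil_row (R : realType) m k l (B : 'M[R]_m) (Z : 'M[R]_(k, m)) (W : 'M[R]_(l, m)) i j :
  bil B (row i Z) (row j W) = (Z *m B *m W^T) i j.
Proof. by rewrite /bil -row_mul !mxE; apply: eq_bigr => h _; rewrite !mxE. Qed.

Lemma tangent_sub (R : realType) (V : normedModType R) (S S' : set V) (x u : V) :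
  S `<=` S' -> tangent S x u -> tangent S' x u.
Proof.
move=> SS' [c [[e e0 [sc Sc]] c0 dc]]; exists c; split=> //.
by exists e => //; split=> // t /Sc/SS'.
Qed.

Section TangentBasis.
Context {R : realType} (n : nat) (kappa : R) (M : linear_model n kappa).
Local Notation A := (ambient n kappa).
Local Notation E := 'rV[R]_n.+2.
Local Notation X := (mX M).
Local Notation Y := (mY M).
Local Notation q := (bil (mQ M)).
Local Notation b := (bil (mB M)).
Local Notation Mk := (@Mk R n kappa).

Lemma volume_formE p (u : 'I_n.+1 -> A) (F : 'M[R]_(n + 1, n.+2))
    (e1 : n.+1 = (n + 1)%N) (e2 : (n + 1 + 1)%N = n.+2) : Mk p ->
  (forall k, 'D_(u k) X p = row (cast_ord e1 k) F) ->
  volume_form p u = vol_cst M * \det (castmx (e2, erefl n.+2) (col_mx F (X p))).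
Proof. by move=> Mp uF; rewrite (volE M) // (stack_castmx e2 _ uF). Qed.

Lemma dX_mulmx p k (c : 'rV[R]_k) (D : 'M[R]_(k, _)) : Mk p ->
  'D_(c *m D) X p = c *m \matrix_i 'D_(row i D) X p.
Proof.
move=> Mp; rewrite !mulmx_sum_row.
transitivity (\sum_i 'D_(c 0 i *: row i D) X p).
  apply: (big_morph (fun u => 'D_u X p)) => [u w|]; first exact: dXD.
  exact: derive0.
by apply: eq_bigr => i _; rewrite (dXZ M) // rowK.
Qed.

Variables (N : set A) (a : E) (rho : R) (HN : umbilic_form M N a rho).

Lemma tbasis_exists p : N p -> exists D : 'M[R]_(n, (n + (0 < kappa)%R).+1),
  (forall u : A, tangent N p u <-> (u <= D)%MS) /\
  forall i j, metric p (row i D) (row j D) = (i == j)%:R.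
Proof.
move=> Np; have Mp := N_Mk HN Np; set P := X p.
have qs := mQ_sym M; have bs := mB_sym M.
have r0 := rho_gt0 HN.
pose f : 'M[R]_(n.+2, 1 + 1) := row_mx (mQ M *m P^T) (mB M *m (P - a)^T).
have fE (z : E) : z *m f = row_mx (q z P)%:M (b z (P - a))%:M.
  by rewrite mul_mx_row !mulmxA; congr row_mx; rewrite [LHS]mx11_scalar.
have rf : \rank f = 2.
  apply/eqP; rewrite -[_ == _]/(row_full f); apply/row_fullP.
  exists (col_mx (P - (b P (P - a) / rho) *: (P - a)) (rho^-1 *: (P - a))).
  rewrite mul_col_mx !fE scalar_mx_block /block_mx; congr col_mx; congr row_mx.
  - congr (_%:M); rewrite bilDl bilNl bilZl (mQ_mX M Mp) (bilC _ _ qs) (q_eta HN Np).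
    by rewrite mulr0 subr0.
  - rewrite -[RHS](raddf0 (@scalar_mx R 1)); congr (_%:M).
    by rewrite bilDl bilNl bilZl (b_eta HN Np) divfK ?subrr // gt_eqF.
  - rewrite -[RHS](raddf0 (@scalar_mx R 1)); congr (_%:M).
    by rewrite bilZl (bilC _ _ qs) (q_eta HN Np) mulr0.
  - by congr (_%:M); rewrite bilZl (b_eta HN Np) mulVf // gt_eqF.
have rK : \rank (kermx f) = n by rewrite mxrank_ker rf subSS subSS subn0.
have KP (z : E) : (z <= kermx f)%MS <-> q P z = 0 /\ b (P - a) z = 0.
  split=> [/sub_kermxP|[qz bz]].
    rewrite fE -[0](row_mx0 R 1 1 1) => /eq_row_mx[/matrixP/(_ 0 0) H1 /matrixP/(_ 0 0) H2].
    by move: H1 H2; rewrite !mxE eqxx !mulr1n (bilC z P qs) (bilC z (P - a) bs).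
  apply/sub_kermxP; rewrite fE (bilC z P qs) (bilC z (P - a) bs) qz bz.
  by rewrite raddf0 row_mx0.
have [z zK z0|Z [ZK ZB]] := Gram_Schmidt bs rK.
  have [qz bz] := (KP z).1 zK; rewrite lt_neqAle (b_ge0 Mp qz) andbT.
  by apply: contra_neq z0 => /esym; exact: (b_eq0 Mp qz).
have ZP i : q P (row i Z) = 0 /\ b (P - a) (row i Z) = 0.
  by apply/KP; rewrite -ZK row_sub.
pose D := \matrix_(i < n) 'D_(row i Z) Y P.
have dD i : 'D_(row i D) X p = row i Z.
  by rewrite rowK; have [u Tu <-] := quadric_path Mp (ZP i).1; rewrite /P dYK.
have DZ (c : 'rV[R]_n) : 'D_(c *m D) X p = c *m Z.
  rewrite dX_mulmx //; congr mulmx; apply/row_matrixP => i.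
  by rewrite rowK dD.
exists D; split=> [u|i j]; last first.
  by rewrite (metricE M) // !dD bil_row ZB mxE.
split=> [/(tangentN HN)[_ qu bu]|/submxP[c ->]].
  have : ('D_u X p <= Z)%MS by rewrite ZK; exact/KP.
  case/submxP=> c; rewrite -DZ => /(dX_inj Mp) ->; exact: submxMl.
have [h1 h2] : q P (c *m Z) = 0 /\ b (P - a) (c *m Z) = 0.
  by apply/KP; rewrite -ZK submxMl.
by apply/(tangentN HN); split=> //; rewrite DZ.
Qed.

Lemma tbasisP p : N p -> 
  (forall u : A, tangent N p u <-> (u <= tbasis N p)%MS) /\
  forall i j, metric p (row i (tbasis N p)) (row j (tbasis N p)) = (i == j)%:R.
Proof.
move=> Np; pose Pr := [set D : 'M[R]_(n, (n + (0 < kappa)%R).+1) |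
  (forall u : A, tangent N p u <-> (u <= D)%MS) /\
  forall i j, metric p (row i D) (row j D) = (i == j)%:R].
have ex : exists D, Pr D by exact: tbasis_exists.
exact: (xgetPex 0 ex).
Qed.

End TangentBasis.

Section FieldDerivative.
Context {R : realType} (n : nat) (kappa : R) (M : linear_model n kappa).
Local Notation A := (ambient n kappa).
Local Notation E := 'rV[R]_n.+2.
Local Notation X := (mX M).
Local Notation Y := (mY M).
Local Notation q := (bil (mQ M)).
Local Notation b := (bil (mB M)).
Local Notation Mk := (@Mk R n kappa).
Local Notation C := (cK kappa).
Local Notation S := (sK kappa).
Variables (N : set A) (a : E) (rho : R) (HN : umbilic_form M N a rho).
Variables (v : A -> A) (vP : smooth_unit_field N v).
Local Notation V p := ('D_(v p) X p).
Variables (p : A) (W : A -> E) (Np : N p).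
Hypothesis HW : is_field_derivative M N a v p W.
Local Notation D := (tbasis N p).
Local Notation nablaM :=
  (\matrix_(i < n, j < n) metric p (nabla N v p (row i D)) (row j D)).
Hypothesis nablaW : forall u z, tangent N p u -> tangent N p z ->
  metric p (nabla N v p u) z = b (W u) ('D_z X p).

Local Notation Xi := (\matrix_i 'D_(row i D) X p).
Local Notation WD := (\matrix_i W (row i D)).
Local Notation vD := (V p *m mB M *m Xi^T).
Let Mp : Mk p := N_Mk HN Np.

Lemma tangentD (c : 'rV[R]_n) : tangent N p (c *m D).
Proof. by apply/(tbasisP HN Np).1; exact: submxMl. Qed.

Lemma tangent_row i : tangent N p (row i D).
Proof. by rewrite -[D]mul1mx row_mul; exact: tangentD. Qed.

Lemma Xi_orthonormal : Xi *m mB M *m Xi^T = 1%:M.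
Proof.
apply/matrixP => i j; rewrite -bil_row !rowK -(metricE M) // [RHS]mxE.
exact: (tbasisP HN Np).2.
Qed.

Lemma coord_Xi (z : E) j : (z *m mB M *m Xi^T) 0 j = b z ('D_(row j D) X p).
Proof.
rewrite /bil !mxE; apply: eq_bigr => h _; congr (_ * _).
by rewrite !mxE.
Qed.

Lemma bil_Xi (c d : 'rV[R]_n) : b (c *m Xi) (d *m Xi) = (c *m d^T) 0 0.
Proof.
rewrite /bil trmx_mul !mulmxA -(mulmxA c) -(mulmxA c (Xi *m _)) Xi_orthonormal.
by rewrite mulmx1.
Qed.

Lemma tangent_Xi (z : E) : q (X p) z = 0 -> b (X p - a) z = 0 ->
  z = (z *m mB M *m Xi^T) *m Xi.
Proof.
move=> qz bz; have [u _ uz] := quadric_path Mp qz.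
have /(tbasisP HN Np).1/submxP[c uc] : tangent N p u.
  by apply/(tangentN HN); rewrite uz.
have zc : z = c *m Xi by rewrite -uz uc dX_mulmx.
by rewrite {2}zc -(mulmxA c) -(mulmxA c (Xi *m _)) Xi_orthonormal mulmx1.
Qed.

Lemma vD_Xi : V p = vD *m Xi.
Proof. by have [q0 b0 _] := v_tangent HN vP Np; exact: tangent_Xi. Qed.

Lemma vD_unit : vD *m vD^T = 1%:M.
Proof.
have [_ _ b1] := v_tangent HN vP Np; rewrite [LHS]mx11_scalar -bil_Xi -vD_Xi.
by rewrite b1.
Qed.

Lemma WD_row i : W (row i D) = row i nablaM *m Xi
   - (rho^-1 * vD 0 i) *: (X p - a) - (kappa * vD 0 i) *: X p.
Proof.
have [Wl _ WF] := HW; have [h1 h2 h3] := WF _ (tangent_row i).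
have bs := mB_sym M; have qs := mQ_sym M; have r0 := rho_gt0 HN.
have vi : b ('D_(row i D) X p) (V p) = vD 0 i by rewrite coord_Xi bilC.
rewrite vi in h1 h2; have q1 := mQ_mX M Mp; have qe := q_eta HN Np.
have be := b_eta HN Np; have beX := b_etaX HN Np.
pose k := kappa * vD 0 i; pose r := rho^-1 * vD 0 i.
have zE : W (row i D) + r *: (X p - a) + k *: X p = row i nablaM *m Xi.
  set z := _ + _ + _; rewrite (@tangent_Xi z).
  - congr mulmx; apply/rowP => j; rewrite coord_Xi !mxE nablaW; [|exact: tangent_row..].
    have /(tangentN HN)[_ qj bj] := tangent_row j.
    by rewrite /z bilDl bilDl !bilZl bj mulr0 addr0 /k mulrAC (b_X Mp qj) mul0r addr0.
  - by rewrite /z bilDr bilDr !bilZr h1 qe q1 /k; ring.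
  - rewrite /z bilDr bilDr !bilZr h2 be /k /r [kappa * _ * _]mulrAC beX.
    by field; rewrite gt_eqF.
by rewrite -zE -/k -/r addrAC addrK addrK.
Qed.

Lemma nabla_vD : nablaM *m vD^T = 0.
Proof.
apply/row_matrixP => i; rewrite row0 row_mul; have [Wl _ WF] := HW.
have [_ _ h3] := WF _ (tangent_row i).
have [q0 b0 _] := v_tangent HN vP Np; have bs := mB_sym M.
rewrite [LHS]mx11_scalar -bil_Xi -vD_Xi.
have -> : row i nablaM *m Xi = W (row i D) + (rho^-1 * vD 0 i) *: (X p - a)
   + (kappa * vD 0 i) *: X p by rewrite WD_row addrAC !subrK.
rewrite bilDl bilDl !bilZl b0 bilC // h3 mulr0 mulrAC (b_X Mp q0) mul0r.
by rewrite !addr0 raddf0.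
Qed.

(* The rows are the velocities in [E] of the variations of [gam p t] along the
   tangent basis and along the ray, followed by the position [gam p t]. *)
Lemma jacobi_mxE t :
  col_mx (col_mx (C t *: Xi + S t *: WD) (gam' M v p t)) (gam M v p t) =
  jacobi_mx nablaM vD (C t) (S t) rho^-1 kappa *m col_mx (col_mx Xi (X p - a)) (X p).
Proof.
rewrite /jacobi_mx mul_block_col mul_block_col mul_row_col mul_col_mx add_col_mx.
rewrite mul0mx addr0 !mul_scalar_mx -!scalemxAl -vD_Xi.
congr col_mx; last by rewrite /gam addr0 addrC.
congr col_mx; last by rewrite /gam' addrC mulNr.
have rv i (z : E) : row i (vD^T *m z) = vD 0 i *: z.
  rewrite row_mul; apply/rowP => j; rewrite mxE big_ord1 !mxE.
  by congr (_ * _).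
apply/row_matrixP => i.
have rD m (x y : 'M[R]_(n, m)) : row i (x + y) = row i x + row i y.
  by apply/rowP => j; rewrite !mxE.
have rZ m k (x : 'M[R]_(n, m)) : row i (k *: x) = k *: row i x.
  by apply/rowP => j; rewrite !mxE.
rewrite !rD !rZ !rv !rowK WD_row mulmxDl mul_scalar_mx -scalemxAl.
rewrite rD !rZ rowK -row_mul.
rewrite row_mul; move: (row i nablaM *m Xi) => z.
by move: (vD 0 i) => w; apply/rowP => j; rewrite !mxE; ring.
Qed.

End FieldDerivative.

Section VolumePreservation.
Context {R : realType} (n : nat) (kappa : R) (M : linear_model n kappa).
Local Notation A := (ambient n kappa).
Local Notation E := 'rV[R]_n.+2.
Local Notation X := (mX M).
Local Notation Y := (mY M).
Local Notation q := (bil (mQ M)).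
Local Notation b := (bil (mB M)).
Local Notation Mk := (@Mk R n kappa).
Local Notation C := (cK kappa).
Local Notation S := (sK kappa).
Variables (N : set A) (a : E) (rho : R) (HN : umbilic_form M N a rho).
Variables (v : A -> A) (vP : smooth_unit_field N v).
Local Notation V p := ('D_(v p) X p).
Local Notation Gam p t := (geod p (v p) t).
Variable U : set A.
Hypothesis fol : smooth_foliation U [set ray p (v p) | p in N].
Hypothesis folN : smooth_foliation U [set ray p (- v p) | p in N].
Hypothesis UN : forall x, U x -> ~ N x.
Local Notation B := (billiard N v).
Local Notation preserved x := (forall u : 'I_n.+1 -> A,
  (forall i, tangent Mk x (u i)) ->
  volume_form (B x) (fun i => tdiff U B x (u i)) = volume_form x u).

Lemma fol_Mk : U `<=` Mk.
Proof. by move=> x /(U_Gam fol)[p [t [Np _ _ ->]]]; case: (GamE HN vP t Np). Qed.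

Section AtFoot.
Variables (p : A) (W : A -> E) (Np : N p).
Hypothesis HW : is_field_derivative M N a v p W.
Local Notation D := (tbasis N p).
Local Notation nablaM :=
  (\matrix_(i < n, j < n) metric p (nabla N v p (row i D)) (row j D)).
Hypothesis nablaW : forall u z, tangent N p u -> tangent N p z ->
  metric p (nabla N v p u) z = b (W u) ('D_z X p).
Local Notation Xi := (\matrix_i 'D_(row i D) X p).
Local Notation WD := (\matrix_i W (row i D)).
Local Notation vD := (V p *m mB M *m Xi^T).
Let Mp : Mk p := N_Mk HN Np.

Definition jacobi_fields (s sg : R) : 'M[R]_(n + 1, n.+2) :=
  col_mx (C s *: Xi + S s *: WD) (sg *: gam' M v p s).

Let e2 : (n + 1 + 1)%N = n.+2. Proof. by rewrite !addn1. Qed.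
Let e1 : n.+1 = (n + 1)%N. Proof. by rewrite addn1. Qed.

Local Notation frame_det := (\det (castmx (e2, erefl n.+2) (col_mx (col_mx Xi (X p - a)) (X p)))).

Lemma det_jacobi_fields s sg :
  \det (castmx (e2, erefl n.+2) (col_mx (jacobi_fields s sg) (gam M v p s))) =
  sg * (\det (jacobi_mx nablaM vD (C s) (S s) rho^-1 kappa) * frame_det).
Proof.
rewrite -det_castmx_mul -(jacobi_mxE HN vP Np HW nablaW).
pose L : 'M[R]_(n + 1 + 1) := block_mx (block_mx 1%:M 0 0 sg%:M) 0 0 1%:M.
have dL : \det L = sg by rewrite !det_lblock !det1 mul1r det_scalar1 mulr1.
rewrite -[sg in RHS]dL -det_castmx_mul; congr (\det (castmx _ _)).
rewrite /L /jacobi_fields mul_block_col mul_block_col !mul0mx !mul1mx !addr0 !add0r.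
by rewrite mul_scalar_mx.
Qed.

Lemma jacobi_fieldsE s sg (c : 'rV[R]_(n + 1)) : c *m jacobi_fields s sg =
  variation M v p s (sg * rsubmx c 0 0) ('D_(lsubmx c *m D) X p) (W (lsubmx c *m D)).
Proof.
have [Wl _ _] := HW.
have WE : W (lsubmx c *m D) = lsubmx c *m WD.
  have W0 : W 0 = 0.
    have := Wl 1 0 0; rewrite !scale1r addr0 => /eqP.
    by rewrite -subr_eq0 opprD addNKr oppr_eq0 => /eqP.
  rewrite !mulmx_sum_row; transitivity (\sum_i W (lsubmx c 0 i *: row i D)).
    apply: (big_morph W) => [u w|]; last exact: W0.
    by have := Wl 1 u w; rewrite !scale1r.
  apply: eq_bigr => i _; rewrite rowK.
  by have := Wl (lsubmx c 0 i) (row i D) 0; rewrite W0 !addr0.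
rewrite WE dX_mulmx // /variation /jacobi_fields -{1}[c]hsubmxK mul_row_col.
rewrite mulmxDr -!scalemxAr; congr (_ + _).
apply/rowP => i; rewrite !mxE big_ord1 !mxE; ring.
Qed.

Section AtTime.
Variables (t : R) (t0 : 0 < t) (tT : (t%:E < Tk kappa)%E).
Local Notation x := (Gam p (- t)).
Local Notation y := (Gam p t).

Lemma billiard_jacobi (c : 'rV[R]_(n + 1)) (e : A) :
  'D_e X x = c *m jacobi_fields (- t) (- 1) ->
  'D_(tdiff U B x e) X y = c *m jacobi_fields t 1.
Proof.
have [Mx _] := GamE HN vP (- t) Np.
rewrite !jacobi_fieldsE mulN1r mul1r => eE.
have [_ _ <-] := billiard_tdiff HN vP fol folN UN Np t0 tT HW (rsubmx c 0 0)
  (tangentD HN Np (lsubmx c)).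
by rewrite -eE dYK.
Qed.

Lemma jacobi_tangent (c : 'rV[R]_(n + 1)) :
  exists2 e, tangent Mk x e & 'D_e X x = c *m jacobi_fields (- t) (- 1).
Proof.
have [Te eE _] := billiard_tdiff HN vP fol folN UN Np t0 tT HW (rsubmx c 0 0)
  (tangentD HN Np (lsubmx c)).
eexists; first exact: (tangent_sub fol_Mk Te).
by rewrite jacobi_fieldsE mulN1r.
Qed.

Lemma jacobi_neq0 :
  \det (castmx (e2, erefl n.+2) (col_mx (jacobi_fields (- t) (- 1)) (gam M v p (- t)))) != 0.
Proof.
have [Mx Xx] := GamE HN vP (- t) Np.
apply: det_castmx_neq0 => c; rewrite -[c]hsubmxK mul_row_col.
set c1 := lsubmx c; set al := rsubmx c => H.
have [e Te eE] := jacobi_tangent c1.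
have [_ qe] := (tangentMk M x e).1 Te.
have al0 : al = 0.
  have alE : al *m gam M v p (- t) = al 0 0 *: gam M v p (- t).
    by rewrite {1}[al]mx11_scalar mul_scalar_mx.
  have := congr1 (q (X x)) H; rewrite bilDr -eE qe alE bilZr -Xx (mQ_mX M Mx).
  by rewrite bil0r add0r mulr1 => al0; rewrite [al]mx11_scalar al0 raddf0.
move: H; rewrite al0 mul0mx addr0 jacobi_fieldsE /variation cKN sKN mulN1r !scaleNr.
move=> /eqP; rewrite subr_eq0 => /eqP.
case/(back_nondegenerate HN vP folN Np t0 tT HW (tangentD HN Np _)) => u0 tau0.
rewrite -[c1]hsubmxK [rsubmx c1]mx11_scalar tau0 raddf0.
have -> : lsubmx c1 = 0.
  have := congr1 (fun u => 'D_u X p) u0; rewrite /= derive0 dX_mulmx // => u1.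
  rewrite -[lsubmx c1]mulmx1 -(Xi_orthonormal HN Np) !mulmxA u1 !mul0mx //.
by rewrite !row_mx0.
Qed.

Lemma frame_det_neq0 : frame_det != 0.
Proof.
by have := jacobi_neq0; rewrite det_jacobi_fields !mulf_eq0 !negb_or => /and3P[].
Qed.

Lemma jacobi_span e : tangent Mk x e ->
  exists c, 'D_e X x = c *m jacobi_fields (- t) (- 1).
Proof.
move=> /(tangentMk M)[Mx qe]; have [_ Xx] := GamE HN vP (- t) Np.
have [c cE] := det_castmx_span ('D_e X x) jacobi_neq0.
exists (lsubmx c); move: cE qe; rewrite -{1}[c]hsubmxK mul_row_col => -> .
have [e' /(tangentMk M)[_ qe'] <-] := jacobi_tangent (lsubmx c).
have alE : rsubmx c *m gam M v p (- t) = rsubmx c 0 0 *: gam M v p (- t).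
  by rewrite {1}[rsubmx c]mx11_scalar mul_scalar_mx.
rewrite bilDr qe' alE bilZr -Xx (mQ_mX M Mx) add0r mulr1 => ->.
by rewrite scale0r addr0.
Qed.

Lemma preserved_det : preserved x <->
  \det (castmx (e2, erefl n.+2) (col_mx (jacobi_fields t 1) (gam M v p t))) =
  \det (castmx (e2, erefl n.+2) (col_mx (jacobi_fields (- t) (- 1)) (gam M v p (- t)))).
Proof.
have [Mx Xx] := GamE HN vP (- t) Np; have [My Xy] := GamE HN vP t Np.
have Bx : B x = y := billiardE HN vP fol folN UN Np t0 tT.
rewrite -Xx -Xy Bx; split=> [pres|detE u Tu].
  have ex k : exists e, tangent Mk x e /\
      'D_e X x = row (cast_ord e1 k) (jacobi_fields (- t) (- 1)).
    have [e Te eE] := jacobi_tangent (row (cast_ord e1 k) 1%:M).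
    by exists e; split=> //; rewrite eE -row_mul mul1mx.
  pose u k := sval (cid (ex k)).
  have uP k : tangent Mk x (u k) /\
      'D_(u k) X x = row (cast_ord e1 k) (jacobi_fields (- t) (- 1)) := svalP (cid (ex k)).
  have := pres u (fun k => (uP k).1).
  rewrite (@volume_formE _ _ _ M y _ (jacobi_fields t 1) e1 e2 My); last first.
    move=> k; rewrite (billiard_jacobi (c := row (cast_ord e1 k) 1%:M)).
      by rewrite -row_mul mul1mx.
    by rewrite -row_mul mul1mx (uP k).2.
  rewrite (@volume_formE _ _ _ M x _ (jacobi_fields (- t) (- 1)) e1 e2 Mx); last first.
    by move=> k; rewrite (uP k).2.
  exact: (mulfI (vol_cst_neq0 M)).
have ex k : exists c, 'D_(u k) X x = c *m jacobi_fields (- t) (- 1).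
  exact: jacobi_span.
pose c k := sval (cid (ex k)).
have cP k : 'D_(u k) X x = c k *m jacobi_fields (- t) (- 1) := svalP (cid (ex k)).
pose L : 'M[R]_(n + 1) := \matrix_i c (cast_ord (esym e1) i).
have rL k : row (cast_ord e1 k) L = c k by rewrite rowK cast_ordK.
rewrite (@volume_formE _ _ _ M y _ (L *m jacobi_fields t 1) e1 e2 My); last first.
  by move=> k; rewrite row_mul rL; exact: billiard_jacobi.
rewrite (@volume_formE _ _ _ M x _ (L *m jacobi_fields (- t) (- 1)) e1 e2 Mx); last first.
  by move=> k; rewrite row_mul rL.
have LE F z : col_mx (L *m F) z = block_mx L 0 0 1%:M *m col_mx F z :> 'M[R]_(n + 1 + 1, n.+2).
  by rewrite mul_block_col !mul0mx mul1mx addr0 add0r.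
by rewrite !LE !det_castmx_mul detE.
Qed.

Lemma preserved_jacobi (z := C t / S t) : preserved x <->
  \det (jacobi_mx nablaM vD z 1 rho^-1 kappa) =
  (-1) ^+ n.+1 * \det (jacobi_mx nablaM vD (- z) 1 rho^-1 kappa).
Proof.
have S0 : S t != 0 by rewrite gt_eqF // sK_gt0.
have CE : C t = S t * z by rewrite mulrC divfK.
have CE' : C t = - S t * - z by rewrite mulrNN.
rewrite preserved_det !det_jacobi_fields cKN sKN mul1r mulrA.
rewrite {1}CE CE' !jacobi_mxZ !detZ.
have -> : (- S t) ^+ (n + 1 + 1) = (-1) ^+ n * S t ^+ (n + 1 + 1).
  have sg : (-1 : R) ^+ (n + 1 + 1) = (-1) ^+ n.
    by rewrite -addnA exprD sqrrN expr1n mulr1.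
  exact: etrans (exprNn _ _) (congr1 (fun x => x * _) sg).
have Sn : S t ^+ (n + 1 + 1) != 0 by rewrite expf_neq0.
rewrite exprS mulN1r; move: ((-1) ^+ n) => sg.
split=> [|->]; last by ring.
move=> /(mulIf frame_det_neq0) H; apply: (mulfI Sn).
by rewrite H; ring.
Qed.

End AtTime.

Lemma preserved_parity :
  (forall t, 0 < t -> (t%:E < Tk kappa)%E -> preserved (Gam p (- t))) <->
  (forall s, (nabla_char_poly N v p).[- s] = (-1) ^+ n * (nabla_char_poly N v p).[s]).
Proof.
have Aw := nabla_vD HN vP Np HW nablaW; have ww := vD_unit HN vP Np.
have r0 : rho^-1 != 0 by rewrite invr_eq0 gt_eqF // (rho_gt0 HN).
split=> [pres s|par t t0 tT]; last first.
  by apply/(preserved_jacobi t0 tT); exact: char_poly_parity.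
have [T0 T00 T0T] : exists2 T0 : R, 0 < T0 & (T0%:E < Tk kappa)%E.
  have := Tk_gt0 kappa; case: (Tk kappa) => [T| |//].
    by rewrite lte_fin => T0; exists (T / 2); rewrite ?lte_fin; lra.
  by exists 1; rewrite ?ltry.
pose t i : R := T0 / i.+1%:R.
have tP i : 0 < t i /\ ((t i)%:E < Tk kappa)%E.
  split; first by rewrite divr_gt0.
  apply: le_lt_trans T0T; rewrite lee_fin ler_pdivrMr ?ltr0Sn //.
  by rewrite -{1}[T0]mulr1 ler_wpM2l ?ler1n // ltW.
have S0 i : S (t i) != 0 by have [h1 h2] := tP i; rewrite gt_eqF // sK_gt0.
apply: (jacobi_parity (k := kappa) Aw ww r0 (f := fun i => C (t i) / S (t i))) => [i j H|i].
  2: by have [h1 h2] := tP i; apply/(preserved_jacobi h1 h2); exact: pres.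
have {H} : S (t i - t j) = 0.
  rewrite sKD cKN sKN; move/eqP: H; rewrite eqr_div // => /eqP H.
  by rewrite mulrN addrC [S (t i) * _]mulrC H subrr.
move/sK_eq0 => H; have : t i - t j = 0.
  apply: H; have [h1 h2] := tP i; have [h3 h4] := tP j.
  have [ij|ji] := leP (t i) (t j).
    by apply: le_lt_trans h4; rewrite lee_fin ler0_norm; lra.
  by apply: le_lt_trans h2; rewrite lee_fin gtr0_norm; lra.
move/eqP; rewrite subr_eq0 => /eqP/(mulfI (lt0r_neq0 T00))/invr_inj/eqP.
by rewrite eqr_nat => /eqP[].
Qed.

End AtFoot.

Theorem preserves_volume_parity : preserves_volume U B <->
  (forall p s, N p ->
     (nabla_char_poly N v p).[- s] = (-1) ^+ n * (nabla_char_poly N v p).[s]).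
Proof.
split=> [pres p s Np|par x u Ux Tu].
  have [W [Wl Wd nab WF]] := field_derivative HN vP Np.
  have HW : is_field_derivative M N a v p W by [].
  have [H _] := preserved_parity Np HW nab; apply: H => t t0 tT u Tu; apply: pres => //.
  exact: (Gam_NU HN vP folN).
have [p [t [Np t0 tT xE]]] := U_back HN vP folN Ux; rewrite xE in Tu *.
have [W [Wl Wd nab WF]] := field_derivative HN vP Np.
have HW : is_field_derivative M N a v p W by [].
have [_ H] := preserved_parity Np HW nab.
by apply: (H _ t t0 tT u Tu) => s; exact: par.
Qed.

End VolumePreservation.

(** * The models of the three geometries *)

Section Koszul.
Context {R : realType} (n : nat) (kappa : R).
Local Notation A := (ambient n kappa).
Local Notation E := 'rV[R]_n.+2.
Local Notation Mk := (@Mk R n kappa).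

Lemma edot_bil (u w : A) : edot u w = bil 1%:M u w.
Proof. by rewrite /edot /bil mulmx1 mxE; apply: eq_bigr => i _; rewrite !mxE. Qed.

Hypothesis k0 : kappa <= 0.

Lemma MkE : Mk = [set x | kappa < 0 -> 0 < x 0 ord0].
Proof.
have H (c : bool) (P Q : Prop) : c = false -> (if c then P else Q) = Q by move=> ->.
by apply/seteqP; split=> x; rewrite /Defs.Mk /mkset H // ltNge k0.
Qed.

Lemma open_Mk : open Mk.
Proof.
have [k1|k1] := ltP kappa 0; last first.
  suff -> : Mk = setT by exact: openT.
  apply/seteqP; split=> // x _; rewrite MkE => kn.
  by have := lt_le_trans kn k1; rewrite ltxx.
suff -> : Mk = (fun x : A => x 0 ord0 : R^o) @^-1` [set r : R^o | 0 < r].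
  by apply: open_comp; [move=> x _; exact: coord_continuous|exact: open_gt].
by rewrite MkE; apply/seteqP; split=> x; [apply|move=> ? _].
Qed.

Lemma confE (x : A) : conf x = if kappa < 0 then (- kappa * x 0 ord0 ^+ 2)^-1 else 1.
Proof. by []. Qed.

Lemma Ck_conf m : Ck m Mk (@conf R n kappa : A -> R^o).
Proof.
have oM := open_Mk.
have cE : (@conf R n kappa) =
  (fun x => if kappa < 0 then (- kappa * x 0 ord0 ^+ 2)^-1 else 1) by [].
rewrite cE; have [k1|_] := ltP kappa 0; last exact: Ck_cst.
have c0 : Ck m Mk (fun x : A => x 0 ord0 : R^o).
  apply: (Ck_coord 0 ord0 oM).
  by apply: (Ck_linear m Mk (L := idfun : {linear A -> A})) => x.
apply: (Ck_inv oM) => [x Mx|].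
  have x0 : 0 < x 0 ord0 by move: Mx; rewrite MkE; apply.
  apply: mulf_neq0; first by rewrite oppr_eq0 lt_eqF.
  by apply: expf_neq0; rewrite gt_eqF.
apply: (@Ck_scale _ A R^o m Mk (fun=> - kappa) (fun x : A => x 0 ord0 ^+ 2)) => //.
  exact: Ck_cst.
exact: (@Ck_scale _ A R^o m Mk (fun x : A => x 0 ord0) (fun x : A => x 0 ord0)).
Qed.

Lemma derive_conf_sum (x z : A) : Mk x ->
  edot (\row_i 'D_(delta_mx 0 i) (@conf R n kappa) x) z = 'D_z (@conf R n kappa) x.
Proof.
move=> Mx; have df : differentiable (@conf R n kappa : A -> R^o) x.
  apply: (C1_differentiable_real (D := fun u => 'D_u (@conf R n kappa)) open_Mk Mx) => [u y My|u].
    exact: Ck_is_derive u (Ck_conf 1) My.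
  exact: (Ck_continuous (Ck_derive u (Ck_conf 1)) Mx).
rewrite [RHS]deriveE // [in RHS](row_sum_delta z) linear_sum /edot.
by apply: eq_bigr => i _; rewrite linearZ /= mxE deriveE // mulrC.
Qed.

Lemma metric_christoffel (x u w z : A) : Mk x ->
  metric x (christoffel x u w) z *+ 2 =
    'D_u (@conf R n kappa) x * edot w z + 'D_w (@conf R n kappa) x * edot u z
    - 'D_z (@conf R n kappa) x * edot u w.
Proof.
move=> Mx; have c0 : conf x != 0 by rewrite gt_eqF // conf_gt0.
rewrite -(derive_conf_sum z Mx) /metric /christoffel !edot_bil bilZl bilDl bilDl bilNl !bilZl.
rewrite mulr2n; move: c0; move: (conf x) (bil 1%:M w z) (bil 1%:M u z) (bil 1%:M u w).
move: (bil _ (\row_i _) z) (derive _ x u) (derive _ x w) => e1 e2 e3 c e4 e5 e6 c0.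
by field.
Qed.

Lemma koszul (B : 'M[R]_n.+2) (G : A -> E) (O : set A) : B^T = B ->
  open O -> Mk `<=` O -> Ck 2 O G ->
  (forall x u w, Mk x -> metric x u w = bil B ('D_u G x) ('D_w G x)) ->
  forall x u w z, Mk x ->
    bil B ('D_u ('D_w G) x) ('D_z G x) = metric x (christoffel x u w) z.
Proof.
move=> Bs oO MO Gk mE x u w z Mx; have Ox := MO _ Mx.
have K (u1 u2 u3 : A) : 'D_u3 (@conf R n kappa) x * edot u1 u2 =
    bil B ('D_u3 ('D_u1 G) x) ('D_u2 G x) + bil B ('D_u1 G x) ('D_u3 ('D_u2 G) x).
  have d1 := is_derive_mul (Ck_is_derive u3 (Ck_conf 1) Mx)
    (@is_derive_cst R A R^o (edot u1 u2 : R^o) x u3).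
  have d2 := is_derive_bil B (Ck_is_derive u3 (Ck_derive u1 Gk) Ox)
    (Ck_is_derive u3 (Ck_derive u2 Gk) Ox).
  rewrite mulr0 addr0 in d1; apply: is_derive_unique d1 _.
  apply: near_eq_is_derive d2; have := open_nbhs_nbhs (conj open_Mk Mx).
  by apply: filterS => y My; rewrite -mE.
have S u1 u2 : 'D_u2 ('D_u1 G) x = 'D_u1 ('D_u2 G) x := schwarz u1 u2 oO Ox Gk.
have key (T : A -> A -> E) (D : A -> E) (c : A -> R) (m : R) :
    (forall u1 u2, T u1 u2 = T u2 u1) ->
    (forall u1 u2 u3, c u3 * edot u1 u2 = bil B (T u3 u1) (D u2) + bil B (D u1) (T u3 u2)) ->
    m *+ 2 = c u * edot w z + c w * edot u z - c z * edot u w ->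
    bil B (T u w) (D z) = m.
  move=> Ts Kc; rewrite !Kc (Ts w u) (Ts z u) (Ts z w).
  rewrite !(bilC (D _) _ Bs) mulr2n.
  move: (bil _ _ _) (bil _ _ _) (bil _ _ _) => b1 b2 b3.
  lra.
apply: (key (fun u1 u2 => 'D_u1 ('D_u2 G) x) (fun u1 => 'D_u1 G x)
  (fun u1 => 'D_u1 (@conf R n kappa) x)) => [u1 u2|//|].
  exact: S.
exact: metric_christoffel.
Qed.

End Koszul.

Section RightMultiplication.
Context {R : realType} (m l : nat) (J : 'M[R]_(m, l)).

Lemma Ck_mulmxr k (O : set 'rV[R]_m) : Ck k O (fun x : 'rV[R]_m => x *m J).
Proof. exact: (Ck_linear k O (L := mulmxr J) (@rV_linear_continuous _ _ _ _)). Qed.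

Lemma is_derive_mulmxr (x u : 'rV[R]_m) : is_derive x u (fun x : 'rV[R]_m => x *m J) (u *m J).
Proof.
exact: (is_derive_linear (L := mulmxr J) (@rV_linear_continuous _ _ _ _) (is_derive_id x u)).
Qed.

End RightMultiplication.

Lemma row_mx_coord (R : realType) p k :
  let J := row_mx 0 1%:M : 'M[R]_(k, p + k) in let F := row_mx 1%:M 0 : 'M[R]_(p, p + k) in
  [/\ J *m J^T = 1%:M, J *m F^T = 0, F *m F^T = 1%:M & J^T *m J + F^T *m F = 1%:M].
Proof.
split; rewrite !tr_row_mx ?mul_row_col ?mul_col_row !trmx0 !trmx1.
- by rewrite mul0mx mul1mx add0r.
- by rewrite mul0mx mulmx0 addr0.
- by rewrite mul1mx mulmx0 addr0.
- rewrite !mul0mx !mulmx0 !mul1mx add_block_mx !addr0 !add0r.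
  by rewrite -scalar_mx_block.
Qed.

Lemma bil_outer (R : realType) m (f g z w : 'rV[R]_m) :
  bil (f^T *m g) z w = bil 1%:M z f * bil 1%:M w g.
Proof.
rewrite /bil !mulmx1 mulmxA -mulmxA mxE big_ord1; congr (_ * _).
by rewrite -[g]trmxK -trmx_mul trmxK mxE.
Qed.

Lemma bil_mulmx (R : realType) m k (K : 'M[R]_(m, k)) (z w : 'rV[R]_m) :
  bil (K *m K^T) z w = bil 1%:M (z *m K) (w *m K).
Proof. by rewrite /bil mulmx1 trmx_mul !mulmxA. Qed.

Section Coordinates.
Context {R : realType} (n m : nat) (e : n.+1 = m).

Definition coord_mx : 'M[R]_(m, n.+2) :=
  castmx (e, erefl (1 + n.+1)%N) (row_mx 0 1%:M : 'M[R]_(n.+1, 1 + n.+1)).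

Definition coord_row : 'rV[R]_n.+2 := (row_mx 1%:M 0 : 'M[R]_(1, 1 + n.+1)).

Lemma coord_mxK : coord_mx *m coord_mx^T = 1%:M.
Proof.
have [h _ _ _] := @row_mx_coord R 1 n.+1.
by rewrite /coord_mx; case: m / e; rewrite castmx_id; exact: h.
Qed.

Lemma coord_mx_row : coord_mx *m coord_row^T = 0.
Proof.
have [_ h _ _] := @row_mx_coord R 1 n.+1.
by rewrite /coord_mx; case: m / e; rewrite castmx_id; exact: h.
Qed.

Lemma coord_rowK : coord_row *m coord_row^T = 1%:M.
Proof. by have [_ _ h _] := @row_mx_coord R 1 n.+1; exact: h. Qed.

Lemma coord_mx_tr : coord_mx^T *m coord_mx + coord_row^T *m coord_row = 1%:M.
Proof.
have [_ _ _ h] := @row_mx_coord R 1 n.+1.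
by rewrite /coord_mx; case: m / e; rewrite castmx_id; exact: h.
Qed.

Lemma coord_row_mx : coord_row *m coord_mx^T = 0.
Proof. by apply: trmx_inj; rewrite trmx_mul trmxK coord_mx_row trmx0. Qed.

Lemma coord_split (z : 'rV[R]_n.+2) :
  z = bil 1%:M z coord_row *: coord_row + z *m coord_mx^T *m coord_mx.
Proof.
have {1}-> : z = z *m (coord_mx^T *m coord_mx + coord_row^T *m coord_row).
  by rewrite coord_mx_tr mulmx1.
rewrite mulmxDr !mulmxA addrC; congr (_ + _).
by rewrite {1}[z *m _]mx11_scalar mul_scalar_mx /bil mulmx1.
Qed.

Lemma bil1_coord_mx (u w : 'rV[R]_m) : bil 1%:M (u *m coord_mx) (w *m coord_mx) = bil 1%:M u w.
Proof. by rewrite /bil !mulmx1 trmx_mul !mulmxA -(mulmxA u) coord_mxK mulmx1. Qed.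

Lemma bil1_coord_row : bil 1%:M coord_row coord_row = 1 :> R.
Proof. by rewrite /bil mulmx1 coord_rowK mxE. Qed.

Lemma bil1_coord (u : 'rV[R]_m) : bil 1%:M (u *m coord_mx) coord_row = 0.
Proof. by rewrite /bil mulmx1 -mulmxA coord_mx_row mulmx0 mxE. Qed.

Variable e2 : (m + 1)%N = n.+2.

Definition coord_det : R := \det (castmx (e2, erefl n.+2) (col_mx coord_mx coord_row)).

Lemma coord_det_neq0 : coord_det != 0.
Proof.
apply: det_castmx_neq0 => c H; rewrite -[c]mulmx1.
suff <- : col_mx coord_mx coord_row *m (col_mx coord_mx coord_row)^T = 1%:M.
  by rewrite mulmxA H mul0mx.
rewrite tr_col_mx mul_col_row coord_mxK coord_rowK coord_mx_row coord_row_mx.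
by rewrite -scalar_mx_block.
Qed.

Lemma det_coord (T : 'M[R]_m) (al : 'cV[R]_m) (z : 'rV[R]_n.+2) :
  \det (castmx (e2, erefl n.+2) (col_mx (T *m coord_mx + al *m z) z)) =
  \det T * bil 1%:M z coord_row * coord_det.
Proof.
set c := bil _ _ _.
have -> : col_mx (T *m coord_mx + al *m z) z = block_mx 1%:M al 0 1%:M *m
    (block_mx T 0 (z *m coord_mx^T) c%:M *m col_mx coord_mx coord_row).
  rewrite !mul_block_col !mul0mx !mul1mx addr0 add0r mul_scalar_mx.
  by rewrite [_ + c *: _]addrC -coord_split.
by rewrite !det_castmx_mul det_ublock det_lblock !det1 !mul1r det_scalar1.
Qed.

End Coordinates.

Section Models.
Context {R : realType} (n : nat).

Lemma ambient_dim (kappa : R) : kappa <= 0 -> n.+1 = (n + (0 < kappa)%R).+1.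
Proof. by rewrite leNgt => /negbTE ->; rewrite addn0. Qed.

Lemma ambient_dim1 (kappa : R) : kappa <= 0 -> ((n + (0 < kappa)%R).+1 + 1)%N = n.+2.
Proof. by move=> /ambient_dim <-; rewrite addn1. Qed.

Lemma volume_form_nonpos (kappa : R) (e : n.+1 = (n + (0 < kappa)%R).+1)
    (x : ambient n kappa) u : exists G, (forall k, row (cast_ord e k) G = u k) /\
    volume_form x u = Num.sqrt (conf x) ^+ n.+1 * \det G.
Proof.
eexists; split; last by reflexivity.
move=> k; apply/rowP => j; rewrite !mxE.
case: insubP => [l _ lk|]; last by rewrite /= ltn_ord.
by congr (u _ 0 j); apply: val_inj.
Qed.

Lemma conf_nonneg (kappa : R) : 0 <= kappa -> @conf R n kappa = fun=> 1.
Proof.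
move=> k0; apply/funext => x; rewrite /conf.
have H (c : bool) (p q : R) : c = false -> (if c then p else q) = q by move=> ->.
by apply: H; rewrite ltNge k0.
Qed.

Lemma open_bil_gt0 m (F : 'rV[R]_m) : open [set z : 'rV[R]_m | 0 < bil 1%:M z F].
Proof.
have ck : Ck 0 setT (fun z : 'rV[R]_m => bil 1%:M z F).
  apply: (Ck_bil _ openT); last exact: Ck_cst.
  by apply: (Ck_linear 0 setT (L := idfun : {linear 'rV[R]_m -> 'rV[R]_m})) => x.
rewrite -[X in open X]/((fun z : 'rV[R]_m => bil 1%:M z F : R^o) @^-1` [set r : R^o | 0 < r]).
apply: open_comp; last exact: open_gt.
by move=> z _; exact: (Ck_continuous ck).
Qed.

Lemma flat_model (kappa : R) : kappa = 0 -> inhabited (linear_model n kappa).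
Proof.
move=> k0; have k0' : kappa <= 0 by rewrite k0.
pose A := ambient n kappa; pose E := 'rV[R]_n.+2.
have e := ambient_dim k0'; have e2 := ambient_dim1 k0'.
pose J := @coord_mx R n _ e; pose F := @coord_row R n.
pose X (x : A) : E := F + x *m J; pose Y (z : E) : A := z *m J^T.
pose Q := F^T *m F; pose B := J^T *m J.
have QE z w : bil Q z w = bil 1%:M z F * bil 1%:M w F := bil_outer F F z w.
have BE z w : bil B z w = bil 1%:M (z *m J^T) (w *m J^T).
  by rewrite /B -{2}[J]trmxK bil_mulmx.
have dX (x u : A) : is_derive x u X (u *m J).
  have := is_deriveD (@is_derive_cst R A E F x u) (is_derive_mulmxr J x u).
  by rewrite add0r.
have DX (x u : A) : 'D_u X x = u *m J by case: (dX x u).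
have XF (x : A) : bil 1%:M (X x) F = 1.
  by rewrite bilDl bil1_coord_row bil1_coord addr0.
have Xk k (O : set A) : open O -> Ck k O X.
  by move=> oO; apply: (CkD oO); [exact: Ck_cst|exact: Ck_mulmxr].
have conf1 : @conf R n kappa = fun=> 1 by apply: conf_nonneg; rewrite k0.
have MkT (x : A) : Mk x.
  by rewrite (MkE n k0') => kn; move: (kn); rewrite {1}k0 ltxx.
have mE (x u w : A) : Mk x -> metric x u w = bil B ('D_u X x) ('D_w X x).
  by move=> _; rewrite /metric conf1 mul1r edot_bil BE !DX -!mulmxA coord_mxK !mulmx1.
have Bs : B^T = B by rewrite trmx_mul trmxK.
apply: inhabits; apply: (@LinearModel R n kappa X Y setT [set z | 0 < bil 1%:M z F] Q B
  (@coord_det R n _ e e2)^-1) => //.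
- exact: openT.
- exact: open_bil_gt0.
- by move=> k; exact: (Xk _ _ openT).
- by move=> k; exact: Ck_mulmxr.
- move=> x _; rewrite /Y /X mulmxDl -mulmxA coord_mxK mulmx1.
  by rewrite coord_row_mx add0r.
- by move=> x _ /=; rewrite XF.
- move=> z /= z0; rewrite QE => /eqP; rewrite -expr2 sqrf_eq1 => /orP[|] /eqP z1; last first.
    by move: z0; rewrite z1 oppr_gt0 ltr10.
  split=> //; rewrite [RHS](@coord_split R n _ e) z1 scale1r.
  by [].
- by rewrite trmx_mul trmxK.
- by move=> x _; rewrite QE XF mulr1.
- by move=> x y _ _ _; rewrite QE !XF mulr1.
- have kk : kappa ^+ 2 = kappa by rewrite expr2 {2}k0 mulr0 k0.
  have kZ (D : 'M[R]_n.+2) : kappa *: D = 0 by rewrite k0 scale0r.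
  by rewrite kk !kZ.
- move=> x xi zeta _; rewrite !QE XF mul1r => ->.
  have kM (r : R) : kappa * r = 0 by rewrite k0 mul0r.
  by rewrite mul0r kM.
- move=> x u w z Mx.
  by apply: (koszul k0' Bs openT (@subsetT _ _) (Xk 2%N _ openT) mE).
- move=> x xi t _ /=; rewrite QE XF mul1r => xi0 _.
  by rewrite bilDl !bilZl XF xi0 mulr0 addr0 mulr1 cK_gt0.
- by rewrite invr_eq0 coord_det_neq0.
move=> x u _; have [G [Gu ->]] := volume_form_nonpos e x u.
rewrite (stack_castmx e2 (F := G *m J + 0 *m X x)); last first.
  by move=> k; rewrite DX -Gu mul0mx addr0 row_mul.
rewrite det_coord XF mulr1 conf1 sqrtr1 expr1n mul1r mulrC mulfK //.
exact: coord_det_neq0.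
Qed.

Lemma spherical_model (kappa : R) : 0 < kappa -> inhabited (linear_model n kappa).
Proof.
move=> k0.
have e : (n + (0 < kappa)%R).+1 = n.+2 by rewrite k0 addn1.
pose A := ambient n kappa; pose E := 'rV[R]_n.+2.
have iso m k (h : m = k) : let J := castmx (erefl m, h) 1%:M : 'M[R]_(m, k) in
    [/\ J *m J^T = 1%:M, J^T *m J = 1%:M & \det (castmx (h, erefl k) J) = 1].
  by case: k / h; rewrite /= !castmx_id trmx1 mulmx1 det1.
pose J := castmx (erefl _, e) 1%:M : 'M[R]_((n + (0 < kappa)%R).+1, n.+2).
have [JJ JJ' dJ] : [/\ J *m J^T = 1%:M, J^T *m J = 1%:M &
  \det (castmx (e, erefl n.+2) J) = 1] := iso _ _ e.
pose X (x : A) : E := x *m J; pose Y (z : E) : A := z *m J^T.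
have DX (x u : A) : 'D_u X x = u *m J by case: (is_derive_mulmxr J x u).
have XE (u w : A) : bil 1%:M (X u) (X w) = edot u w.
  by rewrite edot_bil /bil !mulmx1 trmx_mul !mulmxA -(mulmxA u) JJ mulmx1.
have QE z w : bil (kappa *: 1%:M : 'M[R]_n.+2) z w = kappa * bil 1%:M z w.
  by rewrite /bil -scalemxAr -scalemxAl mxE.
have conf1 : @conf R n kappa = fun=> 1 by apply: conf_nonneg; rewrite ltW.
have MkE (x : A) : Mk x <-> edot x x = kappa^-1.
  have H (c : bool) (P P' : Prop) : c -> (if c then P else P') = P by move=> ->.
  by rewrite /Defs.Mk /= H.
pose d : 'rV[R]_(n + (0 < kappa)%R).+1 :=
  \row_i (if (insub (i : nat) : option 'I_n.+1) is Some _ then 1 else Num.sqrt kappa).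
apply: inhabits; apply: (@LinearModel R n kappa X Y setT setT (kappa *: 1%:M) 1%:M
  (\det (diag_mx d))) => //.
- exact: openT.
- exact: openT.
- by move=> k; exact: Ck_mulmxr.
- by move=> k; exact: Ck_mulmxr.
- by move=> x _; rewrite /Y /X -mulmxA JJ mulmx1.
- move=> z _; rewrite QE => z1; have zE : X (Y z) = z by rewrite /X /Y -mulmxA JJ' mulmx1.
  split=> //; apply/MkE; rewrite -XE zE; apply: (mulfI (lt0r_neq0 k0)).
  by rewrite z1 mulfV // gt_eqF.
- by rewrite linearZ /= trmx1.
- by rewrite trmx1.
- by move=> x /MkE xx; rewrite QE XE xx mulfV // gt_eqF.
- by move=> x y k1; move: k0; rewrite {1}k1 ltxx.
- by rewrite scalerA expr2.
- by move=> x u w _; rewrite /metric conf1 mul1r !DX XE.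
- move=> x u w z _; have -> : 'D_w X = fun=> w *m J by apply/funext => y; exact: DX.
  rewrite derive_cst bil0l /metric /edot big1 ?mulr0 // => i _.
  by rewrite /christoffel conf1 !mxE !derive_cst; ring.
- rewrite det_diag; apply/prodf_neq0 => i _; rewrite mxE.
  by case: (insub _) => [_|]; rewrite ?oner_neq0 // gt_eqF // sqrtr_gt0.
move=> x u _; rewrite /volume_form conf1 sqrtr1 expr1n mul1r.
pose U := \matrix_(i < (n + (0 < kappa)%R).+1, j < (n + (0 < kappa)%R).+1)
  ((if insub (i : nat) is Some k then u k else x) : A) 0 j.
have rU i : row i U = if insub (i : nat) is Some k then u k else x.
  by apply/rowP => j; rewrite !mxE.
have -> : \matrix_(i < n.+2, j < n.+2)
    (if insub (i : nat) is Some k then 'D_(u k) X x else X x) 0 j =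
    castmx (e, erefl n.+2) (U *m J).
  apply/matrixP => i j; rewrite castmxE cast_ord_id mxE.
  transitivity (row (cast_ord (esym e) i) (U *m J) 0 j); last by rewrite mxE.
  by rewrite row_mul rU /=; case: (insub _) => [k|//]; rewrite DX.
rewrite det_castmx_mul dJ mulr1 -det_mulmx; congr (\det _).
apply/matrixP => i j; rewrite mul_diag_mx !mxE.
by case: (insub _) => [k|]; rewrite ?mul1r // mxE.
Qed.

End Models.

Section HyperbolicModel.
Context {R : realType} (n : nat) (kappa : R).
Hypothesis k0 : kappa < 0.
Local Notation A := (ambient n kappa).
Local Notation E := 'rV[R]_n.+2.
Local Notation Mk := (@Mk R n kappa).
Let e : n.+1 = (n + (0 < kappa)%R).+1 := ambient_dim n (ltW k0).
Let e2 : ((n + (0 < kappa)%R).+1 + 1)%N = n.+2 := ambient_dim1 n (ltW k0).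
Local Notation J := (@coord_mx R n _ e).
Local Notation F := (@coord_row R n).
Let h : A := delta_mx 0 ord0.
Local Notation H := (h *m J).

(* The light cone model: [q] is half the product of the two null coordinates,
   along [F] and [H], minus the Euclidean product of the other ones. *)
Let Q : 'M[R]_n.+2 :=
  2^-1 *: (F^T *m H) + 2^-1 *: (H^T *m F) - J^T *m J + H^T *m H.
Let B : 'M[R]_n.+2 := kappa^-1 *: Q.
Local Notation q := (bil Q).

Let X (x : A) : E := (x 0 ord0)^-1 *: (F + x *m J + (edot x x - x 0 ord0) *: H).
Let Y (z : E) : A :=
  (bil 1%:M z F)^-1 *: (h + z *m J^T - (z *m J^T) 0 ord0 *: h).

Lemma edot_h (x : A) : bil 1%:M x h = x 0 ord0.
Proof.
rewrite -edot_bil /edot (bigD1 ord0) //= big1 ?addr0 => [|i i0]; rewrite mxE ?eqxx ?mulr1 //=.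
by rewrite (negbTE i0) mulr0.
Qed.

Lemma h0 : h 0 ord0 = 1. Proof. by rewrite mxE !eqxx. Qed.

Lemma bil1C m (z w : 'rV[R]_m) : bil 1%:M z w = bil 1%:M w z.
Proof. by rewrite bilC ?trmx1. Qed.

Lemma Q_sym : Q^T = Q.
Proof.
have tD (D D' : 'M[R]_n.+2) : (D + D')^T = D^T + D'^T by apply/matrixP => i j; rewrite !mxE.
have tN (D : 'M[R]_n.+2) : (- D)^T = - D^T by apply/matrixP => i j; rewrite !mxE.
have tZ c (D : 'M[R]_n.+2) : (c *: D)^T = c *: D^T by apply/matrixP => i j; rewrite !mxE.
rewrite /Q !tD tN !tZ !trmx_mul !trmxK.
by congr (_ - _ + _); rewrite addrC.
Qed.

Lemma QE (al be : R) (y w : A) : q (al *: F + y *m J) (be *: F + w *m J) =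
  2^-1 * (al * w 0 ord0 + y 0 ord0 * be) - edot y w + y 0 ord0 * w 0 ord0.
Proof.
have bD (Q1 Q2 : 'M[R]_n.+2) z1 z2 : bil (Q1 + Q2) z1 z2 = bil Q1 z1 z2 + bil Q2 z1 z2.
  by rewrite /bil mulmxDr mulmxDl mxE.
have bN (Q1 : 'M[R]_n.+2) z1 z2 : bil (- Q1) z1 z2 = - bil Q1 z1 z2.
  by rewrite /bil mulmxN mulNmx mxE.
have bZ c (Q1 : 'M[R]_n.+2) z1 z2 : bil (c *: Q1) z1 z2 = c * bil Q1 z1 z2.
  by rewrite /bil -scalemxAr -scalemxAl mxE.
have bJ z1 z2 : bil (J^T *m J) z1 z2 = bil 1%:M (z1 *m J^T) (z2 *m J^T).
  by rewrite -{2}[J]trmxK bil_mulmx.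
have zF al' (y' : A) : bil 1%:M (al' *: F + y' *m J) F = al'.
  by rewrite bilDl bilZl bil1_coord_row bil1_coord mulr1 addr0.
have zH al' (y' : A) : bil 1%:M (al' *: F + y' *m J) H = y' 0 ord0.
  rewrite bilDl bilZl bil1_coord_mx edot_h bil1C bil1_coord mulr0 add0r //.
have zJ al' (y' : A) : (al' *: F + y' *m J) *m J^T = y'.
  by rewrite mulmxDl -scalemxAl coord_row_mx scaler0 add0r -mulmxA coord_mxK mulmx1.
rewrite /Q !bD bN !bZ !bil_outer bJ !zJ !zF !zH edot_bil.
by ring.
Qed.

Lemma E_split (z : E) : z = bil 1%:M z F *: F + z *m J^T *m J.
Proof. exact: coord_split. Qed.

Lemma XE (x : A) : X x = (x 0 ord0)^-1 *: F +
  ((x 0 ord0)^-1 *: (x + (edot x x - x 0 ord0) *: h)) *m J.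
Proof.
by rewrite /X -addrA scalerDr; congr (_ + _); rewrite -scalemxAl mulmxDl -scalemxAl.
Qed.

Lemma dXE (x u : A) : 0 < x 0 ord0 -> 'D_u X x =
  (u *m ((x 0 ord0)^-1 *: (1%:M + (2 *: x^T - h^T) *m h))) *m J +
    (- (x 0 ord0)^-1 * u 0 ord0) *: X x.
Proof.
move=> x0; have id : is_derive x u (fun y : A => y) u := is_derive_id x u.
have d0 := is_derive_coord 0 ord0 id.
have di := is_derive_inv (f := fun y : A => y 0 ord0 : R^o) (lt0r_neq0 x0) d0.
have dr := is_derive_bil 1%:M id id.
have dJ := is_derive_mulmxr J x u.
pose L (y : A) : E := F + y *m J + (bil 1%:M y y - y 0 ord0) *: H.
have dL : is_derive x u L (u *m J + (2 * bil 1%:M u x - u 0 ord0) *: H).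
  have := is_deriveD (is_deriveD (@is_derive_cst R A E F x u) dJ)
    (is_derive_scale (is_deriveB dr d0) (@is_derive_cst R A E H x u)).
  move=> dL; apply: (is_derive_conv dL) => //.
  rewrite add0r scaler0 addr0; congr (_ + _ *: _).
  by rewrite (bil1C x u); ring.
have -> : X = (fun y : A => (y 0 ord0)^-1 *: L y).
  by apply/funext => y; rewrite /X /L edot_bil.
case: (is_derive_scale di dL) => _ ->.
have uT : u *m ((2 *: x^T - h^T) *m h) = (2 * bil 1%:M u x - u 0 ord0) *: h.
  rewrite mulmxA mulmxBr -scalemxAr.
  have -> : u *m x^T = (bil 1%:M u x)%:M by rewrite [LHS]mx11_scalar /bil mulmx1.
  have -> : u *m h^T = (u 0 ord0)%:M by rewrite -edot_h [LHS]mx11_scalar /bil mulmx1.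
  by rewrite scale_scalar_mx -raddfB mul_scalar_mx.
rewrite -scalemxAr mulmxDr mulmx1 uT -scalemxAl mulmxDl -scalemxAl.
move: (L x) => Lx; rewrite addrC; congr (_ + _).
by rewrite scalerA; congr (_ *: _); field; rewrite gt_eqF.
Qed.

Lemma det_dX (x : A) : \det (1%:M + (2 *: x^T - h^T) *m h) = 2 * x 0 ord0.
Proof.
rewrite det_trig.
  rewrite (bigD1 ord0) //= big1 ?mulr1 => [|i i0].
    by rewrite !mxE big_ord1 !mxE !eqxx /=; ring.
  by rewrite !mxE big_ord1 !mxE eqxx (negbTE i0) /=; ring.
apply/is_trig_mxP => i j ij; rewrite !mxE big_ord1 !mxE.
have -> : (j == ord0) = false by apply/negbTE; rewrite -val_eqE /= -lt0n (leq_ltn_trans _ ij).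
by rewrite -val_eqE /= ltn_eqF // mulr0 addr0.
Qed.

Lemma edot_sym (x y : A) : edot x y = edot y x.
Proof. by rewrite !edot_bil bil1C. Qed.

Lemma edotDZ (x y z : A) c : edot (x + c *: y) z = edot x z + c * edot y z.
Proof. by rewrite !edot_bil bilDl bilZl. Qed.

Lemma edotZl (x y : A) c : edot (c *: x) y = c * edot x y.
Proof. by rewrite !edot_bil bilZl. Qed.

Lemma edot_hl (x : A) : edot h x = x 0 ord0.
Proof. by rewrite edot_sym edot_bil edot_h. Qed.

(* The part of [edot] orthogonal to the vertical direction. *)
Lemma horizontal_ge0 (y : A) : 0 <= edot y y - y 0 ord0 ^+ 2.
Proof.
have <- : edot (y + - y 0 ord0 *: h) (y + - y 0 ord0 *: h) = edot y y - y 0 ord0 ^+ 2.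
  rewrite !edotDZ edot_hl mxE [(_ *: h) _ _]mxE h0 edot_sym edotDZ edot_hl.
  by ring.
exact: edot_ge0.
Qed.

Lemma coord0D (x y : A) : (x + y) 0 ord0 = x 0 ord0 + y 0 ord0.
Proof. by rewrite mxE. Qed.

Lemma coord0Z (x : A) c : (c *: x) 0 ord0 = c * x 0 ord0.
Proof. by rewrite mxE. Qed.

Definition c0E := (coord0D, coord0Z, h0).

Lemma qX (x w : A) be : q (X x) (be *: F + w *m J) =
  (x 0 ord0)^-1 * (2^-1 * (w 0 ord0 + edot x x * be) - edot x w + x 0 ord0 * w 0 ord0).
Proof.
rewrite XE QE !c0E edotZl edotDZ edot_hl; ring.
Qed.

Lemma X_row (x : A) : bil 1%:M (X x) F = (x 0 ord0)^-1.
Proof. by rewrite XE bilDl bilZl bil1_coord_row bil1_coord mulr1 addr0. Qed.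

Lemma X_mx (x : A) : X x *m J^T = (x 0 ord0)^-1 *: (x + (edot x x - x 0 ord0) *: h).
Proof.
by rewrite XE mulmxDl -[(_ *: F) *m _]scalemxAl coord_row_mx scaler0 add0r -mulmxA coord_mxK mulmx1.
Qed.

Lemma dX_split (x u : A) : 0 < x 0 ord0 ->
  'D_u X x = (- u 0 ord0 / x 0 ord0 ^+ 2) *: F +
    (- (u 0 ord0 / x 0 ord0 ^+ 2) *: (x + (edot x x - x 0 ord0) *: h)
     + (x 0 ord0)^-1 *: (u + (2 * edot x u - u 0 ord0) *: h)) *m J.
Proof.
move=> x0; rewrite dXE // [in X in _ + X]XE.
have uT : u *m ((2 *: x^T - h^T) *m h) = (2 * edot x u - u 0 ord0) *: h.
  rewrite mulmxA mulmxBr -scalemxAr.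
  have -> : u *m x^T = (edot x u)%:M.
    by rewrite [LHS]mx11_scalar edot_bil bil1C /bil mulmx1.
  have -> : u *m h^T = (u 0 ord0)%:M by rewrite -edot_h [LHS]mx11_scalar /bil mulmx1.
  by rewrite scale_scalar_mx -raddfB mul_scalar_mx.
rewrite -scalemxAr mulmxDr mulmx1 uT [in RHS]mulmxDl [RHS]addrA [RHS]addrC; congr (_ + _).
rewrite scalerDr scalerA -!scalemxAl scalerA.
by congr (_ *: _ + _ *: _); field; rewrite gt_eqF.
Qed.

Lemma metric_hX (x u w : A) : 0 < x 0 ord0 ->
  q ('D_u X x) ('D_w X x) = - (x 0 ord0) ^- 2 * edot u w.
Proof.
move=> x0; rewrite !dX_split // QE !c0E.
rewrite [edot (_ + _) _]edotDZ !edotZl !edotDZ !edot_hl !c0E.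
rewrite !(edot_sym _ (- _ *: _ + _)) !edotDZ !edotZl !edotDZ !edot_hl.
rewrite (edot_sym w x) (edot_sym w u).
by field; rewrite gt_eqF.
Qed.

Lemma qXX (x : A) : 0 < x 0 ord0 -> q (X x) (X x) = 1.
Proof.
move=> x0; rewrite {2}XE qX !c0E edot_sym edotZl edotDZ edot_hl.
by field; rewrite gt_eqF.
Qed.

Lemma XK (x : A) : 0 < x 0 ord0 -> Y (X x) = x.
Proof.
move=> x0; rewrite /Y X_row X_mx !c0E invrK.
by apply/rowP => i; rewrite !mxE; field; rewrite gt_eqF.
Qed.

Lemma YK (z : E) : 0 < bil 1%:M z F -> q z z = 1 -> 0 < Y z 0 ord0 /\ X (Y z) = z.
Proof.
move=> z0; have zE := E_split z; rewrite {1 2}zE QE => z1.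
move: z0 z1 zE; rewrite /Y; move: (z *m J^T) (bil 1%:M z F) => y al al0 z1 zE.
have Y0 : (al^-1 *: (h + y - y 0 ord0 *: h)) 0 ord0 = al^-1.
  by rewrite -scaleNr !c0E; ring.
rewrite Y0; split; first by rewrite invr_gt0.
rewrite XE Y0 invrK [RHS]zE; congr (_ + _ *m _).
set w := _ *: (h + _ - _); have ww : edot w w = al^-1 * y 0 ord0.
  rewrite /w -scaleNr edotZl edot_sym edotZl edotDZ edot_hl.
  rewrite [edot (h + y) _]edot_sym edotDZ edot_hl !c0E.
  have -> : edot (h + y) (h + y) = 1 + 2 * y 0 ord0 + edot y y.
    by rewrite !edot_bil bilDl !bilDr (bil1C h y) !edot_h h0; ring.
  have -> : edot y y = al * y 0 ord0 + y 0 ord0 ^+ 2 - 1.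
    by move: z1; lra.
  by field; rewrite gt_eqF.
rewrite ww; apply/rowP => i; rewrite /w !mxE; field; rewrite gt_eqF //.
Qed.

Lemma vertical_bound (x : A) (xi : E) : 0 < x 0 ord0 -> q (X x) xi = 0 -> q xi xi = kappa ->
  (bil 1%:M xi F * x 0 ord0) ^+ 2 <= - kappa.
Proof.
move=> x0; have zE := E_split xi; rewrite {1 2 3}zE qX QE.
move: (xi *m J^T) (bil 1%:M xi F) => w be {zE} qx qk.
have H := horizontal_ge0 (w + - be *: x).
move: H; rewrite !c0E !edotDZ ![edot _ (w + _)]edot_sym !edotDZ (edot_sym w x).
have {}qx : 2^-1 * (w 0 ord0 + edot x x * be) = edot x w - x 0 ord0 * w 0 ord0.
  move/eqP: qx; rewrite mulf_eq0 invr_eq0 gt_eqF //= => /eqP; lra.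
move: (edot x w) (edot w w) (edot x x) qx qk => a1 a2 a3 qx qk H.
have a1E : a1 = 2^-1 * (w 0 ord0 + a3 * be) + x 0 ord0 * w 0 ord0 by lra.
have a2E : a2 = 2^-1 * (be * w 0 ord0 + w 0 ord0 * be) + w 0 ord0 ^+ 2 - kappa by lra.
rewrite -subr_ge0; move: H; rewrite a1E a2E; congr (is_true (0 <= _)).
by field.
Qed.

Lemma hyperbolic_Mk (x : A) : Mk x <-> 0 < x 0 ord0.
Proof. by rewrite (MkE n (ltW k0)); split=> [|? _]; [apply|]. Qed.

Lemma Ck_X k : Ck k [set x : A | 0 < x 0 ord0] X.
Proof.
have oM : open [set x : A | 0 < x 0 ord0].
  suff <- : Mk = [set x : A | 0 < x 0 ord0] by exact: open_Mk (ltW k0).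
  by apply/seteqP; split=> x /hyperbolic_Mk.
have ckid : Ck k [set x : A | 0 < x 0 ord0] (fun x : A => x).
  by apply: (Ck_linear k _ (L := idfun : {linear A -> A})) => x.
have c0 := Ck_coord 0 ord0 oM ckid.
apply: (Ck_scale oM); first by apply: (Ck_inv oM) => // x /=; exact: lt0r_neq0.
apply: (CkD oM); first by apply: (CkD oM); [exact: Ck_cst|exact: Ck_mulmxr].
apply: (Ck_scale oM); last exact: Ck_cst.
apply: (CkD oM); last first.
  apply: (Ck_eq (f := fun x : A => (-1 : R^o) *: (x 0 ord0 : R^o)) oM).
    by move=> x _; rewrite scaleN1r.
  by apply: (Ck_scale oM) => //; exact: Ck_cst.
apply: (Ck_eq (f := fun x : A => bil 1%:M x x) oM); first by move=> x _; rewrite edot_bil.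
exact: (Ck_bil 1%:M oM).
Qed.

Lemma Ck_Y k : Ck k [set z : E | 0 < bil 1%:M z F] Y.
Proof.
have oM := @open_bil_gt0 R _ F.
have ckid : Ck k [set z : E | 0 < bil 1%:M z F] (fun z : E => z).
  by apply: (Ck_linear k _ (L := idfun : {linear E -> E})) => x.
apply: (Ck_scale oM).
  apply: (Ck_inv oM) => [x /=|]; first exact: lt0r_neq0.
  by apply: (Ck_bil 1%:M oM) => //; exact: Ck_cst.
apply: (CkD oM); first by apply: (CkD oM); [exact: Ck_cst|exact: Ck_mulmxr].
apply: (Ck_eq (f := fun z : E => (- (z *m J^T) 0 ord0 : R^o) *: h) oM).
  by move=> z _; rewrite scaleNr.
apply: (Ck_scale oM); last exact: Ck_cst.
apply: (Ck_eq (f := fun z : E => (-1 : R^o) *: ((z *m J^T) 0 ord0 : R^o)) oM).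
  by move=> x _; rewrite scaleN1r.
apply: (Ck_scale oM); first exact: Ck_cst.
by apply: (Ck_coord 0 ord0 oM); exact: Ck_mulmxr.
Qed.

Lemma hyperbolic_model : exists M : linear_model n kappa,
  [/\ forall x y, Mk x -> Mk y -> 0 < bil (mQ M) (mX M x) (mX M y),
      exists2 w, bil (mQ M) w w < 1 &
        forall x, Mk x -> bil (mQ M) w (mX M x) = 1 <-> x 0 ord0 = 1 &
      forall a : A, a 0 ord0 != 0 -> exists2 w, bil (mQ M) w w < 1 &
        forall x, Mk x -> bil (mQ M) w (mX M x) = 1 <-> edot a x = 0].
Proof.
have k0' := ltW k0; have kN0 : kappa != 0 by rewrite lt_eqF.
have BE z w : bil B z w = kappa^-1 * q z w by rewrite /bil /B -scalemxAr -scalemxAl mxE.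
have kB z w : q z w = kappa * bil B z w by rewrite BE mulrA mulfV // mul1r.
have Mp (x : A) : Mk x -> 0 < x 0 ord0 by move=> /hyperbolic_Mk.
have mE (x u w : A) : Mk x -> metric x u w = bil B ('D_u X x) ('D_w X x).
  move=> Mx; rewrite BE metric_hX ?Mp // /metric confE k0.
  by rewrite !invfM invrN; ring.
have Bs : B^T = B by rewrite /B linearZ /= Q_sym.
pose D := [set x : A | 0 < x 0 ord0]; pose D' := [set z : E | 0 < bil 1%:M z F].
have oD : open D.
  suff <- : Mk = D by exact: open_Mk k0'.
  by apply/seteqP; split=> x /hyperbolic_Mk.
pose vc := (Num.sqrt (- kappa))^-1 ^+ n.+1 * (2 * @coord_det R n _ e e2)^-1.
have cd0 := @coord_det_neq0 R n _ e e2.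
have sk : 0 < Num.sqrt (- kappa) by rewrite sqrtr_gt0 oppr_gt0.
have vc0 : vc != 0.
  by rewrite mulf_neq0 // ?expf_neq0 // ?invr_eq0 ?mulf_neq0 // ?gt_eqF // pnatr_eq0.
have vE (x : A) u : Mk x -> volume_form x u = vc * \det (\matrix_(i < n.+2, j < n.+2)
    (if insub (i : nat) is Some k then 'D_(u k) X x else X x) 0 j).
  move=> Mx; have x0 := Mp _ Mx; have [G [Gu ->]] := volume_form_nonpos e x u.
  pose T := (x 0 ord0)^-1 *: (1%:M + (2 *: x^T - h^T) *m h).
  rewrite (stack_castmx e2 (F := (G *m T) *m J + (- (x 0 ord0)^-1 *: (G *m h^T)) *m X x)).
    have eX (r : R) : r ^+ (n + (0 < kappa)%R).+1 = r ^+ n.+1 by rewrite -e.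
    rewrite det_coord det_mulmx /T detZ det_dX X_row eX confE k0.
    have -> : Num.sqrt (- kappa * x 0 ord0 ^+ 2)^-1 =
        (Num.sqrt (- kappa))^-1 * (x 0 ord0)^-1.
      have : 0 < - kappa by rewrite oppr_gt0.
      move: (- kappa) => c c0; rewrite -{1}(sqr_sqrtr (ltW c0)) -exprMn -exprVn sqrtr_sqr.
      by rewrite ger0_norm ?invfM // mulr_ge0 // invr_ge0 ?sqrtr_ge0 // ltW.
    rewrite /vc exprMn !exprVn; field.
    by rewrite cd0 !expf_neq0 ?gt_eqF.
  move=> k; rewrite dXE // -!Gu.
  apply/rowP => j; rewrite !mxE big_ord1 !mxE; congr (_ + _).
    by apply: eq_bigr => l _; rewrite -row_mul mxE.
  rewrite -!mulrA; congr (_ * (_ * _)).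
  rewrite (bigD1 ord0) //= big1 ?addr0 => [|l l0]; rewrite !mxE ?eqxx ?mulr1 //=.
  by rewrite (negbTE l0) mulr0.
have [M [MX MQ]] : exists M : linear_model n kappa, mX M = X /\ mQ M = Q.
  unshelve eexists.
    apply: (@LinearModel R n kappa X Y D D' Q B vc oD (@open_bil_gt0 R _ F)).
    - by move=> x /hyperbolic_Mk.
    - exact: Ck_X.
    - exact: Ck_Y.
    - exact: XK.
    - by move=> x /hyperbolic_Mk x0; rewrite /D' /mkset X_row invr_gt0.
    - by move=> z z0 /(YK z0)[/hyperbolic_Mk].
    - exact: Q_sym.
    - exact: Bs.
    - by move=> x /hyperbolic_Mk; exact: qXX.
    - by move=> x y k1; case/eqP: kN0.
    - by rewrite /B scalerA expr2 mulfK.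
    - by move=> x xi zeta _ _; exact: kB.
    - exact: mE.
    - move=> x u w z Mx; apply: (koszul k0' Bs oD _ (Ck_X 2) mE) => //.
    - move=> x xi t Mx qx; rewrite BE => qk; have x0 := Mp _ Mx.
      have {}qk : q xi xi = kappa.
        by move: qk => /(congr1 (fun r => kappa * r)); rewrite mulrA mulfV // mul1r mulr1.
      have vb := vertical_bound x0 qx qk.
      rewrite /D' /mkset bilDl [bil _ (_ *: X x) _]bilZl X_row [bil _ (_ *: xi) _]bilZl.
      have -> : cK kappa t * (x 0 ord0)^-1 + sK kappa t * bil 1%:M xi F =
          (x 0 ord0)^-1 * (cK kappa t + sK kappa t * (bil 1%:M xi F * x 0 ord0)).
        by field; rewrite gt_eqF.
      rewrite mulr_gt0 ?invr_gt0 //; move: vb; move: (bil _ _ _ * _) => r vb.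
      have C0 : 0 < cK kappa t by exact: cK_gt0.
      have CS := cK_sK kappa t; move: (cK kappa t) (sK kappa t) C0 CS => c s C0 CS.
      rewrite ltNge; apply/negP => le0.
      have : c ^+ 2 <= (s * r) ^+ 2 by nra.
      have : s ^+ 2 * r ^+ 2 <= s ^+ 2 * - kappa by rewrite ler_wpM2l // sqr_ge0.
      rewrite exprMn mulrN [s ^+ 2 * kappa]mulrC => h1 h2.
      have h3 := le_trans h2 h1; rewrite -[c ^+ 2](addrK (kappa * s ^+ 2)) CS in h3.
      by move: h3; rewrite gerDr ler10.
    - exact: vc0.
    - exact: vE.
  by split.
exists M; rewrite MX MQ.
have qw (y x : A) : 0 < x 0 ord0 -> q (0 *: F + y *m J) (X x) =
    (x 0 ord0)^-1 * (2^-1 * y 0 ord0 - edot x y + x 0 ord0 * y 0 ord0).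
  by move=> x0; rewrite (bilC _ _ Q_sym) qX mulr0 addr0.
split.
- move=> x y /Mp x0 /Mp y0; rewrite [X y]XE qX !c0E edot_sym edotZl edotDZ edot_hl.
  have H : 0 <= edot x x + -1 * edot x y + -1 * (edot x y + -1 * edot y y).
    have := edot_ge0 (x + -1 *: y); rewrite !edot_bil bilDl !bilDr !bilZl !bilZr (bil1C y x).
    by lra.
  rewrite (edot_sym y x).
  have -> : (x 0 ord0)^-1 * (2^-1 * ((y 0 ord0)^-1 * (y 0 ord0 + (edot y y - y 0 ord0) * 1) +
      edot x x * (y 0 ord0)^-1) - (y 0 ord0)^-1 * (edot x y + (edot y y - y 0 ord0) * x 0 ord0) +
      x 0 ord0 * ((y 0 ord0)^-1 * (y 0 ord0 + (edot y y - y 0 ord0) * 1))) =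
      (x 0 ord0)^-1 * (y 0 ord0)^-1 * (2^-1 * (edot x x + -1 * edot x y +
        -1 * (edot x y + -1 * edot y y)) + x 0 ord0 * y 0 ord0).
    by field; rewrite !gt_eqF.
  by rewrite !mulr_gt0 ?invr_gt0 // ltr_wpDl ?mulr_gt0 // mulr_ge0 // invr_ge0.
-
  exists (0 *: F + (2 *: h) *m J).
    by rewrite QE !c0E edotZl edot_sym edotZl edot_hl h0; lra.
  move=> x /Mp x0; rewrite qw // !c0E edot_sym edotZl edot_hl.
  have -> : (x 0 ord0)^-1 * (2^-1 * (2 * 1) - 2 * x 0 ord0 + x 0 ord0 * (2 * 1)) = (x 0 ord0)^-1.
    by field; rewrite gt_eqF.
  by split=> [/eqP|->]; rewrite ?invr1 // invr_eq1 => /eqP.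
- move=> a a0; pose y : A := (a 0 ord0)^-1 *: a + - 1 *: h.
have y0 : y 0 ord0 = 0 by rewrite !c0E mulVf // mulN1r subrr.
exists (0 *: F + y *m J).
  by rewrite QE y0; have := edot_ge0 y; move: (edot y y) => r r0; lra.
move=> x /Mp x0; rewrite qw // y0 !mulr0 add0r addr0 edot_sym edotDZ edotZl edot_hl.
have -> : (x 0 ord0)^-1 * - ((a 0 ord0)^-1 * edot a x + -1 * x 0 ord0) =
    1 - (x 0 ord0)^-1 * (a 0 ord0)^-1 * edot a x.
  by field; rewrite a0 gt_eqF.
split=> [H|->]; last by rewrite mulr0 subr0.
have /eqP : (x 0 ord0)^-1 * (a 0 ord0)^-1 * edot a x = 0 by lra.
by rewrite !mulf_eq0 !invr_eq0 (negbTE a0) gt_eqF //= => /eqP.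
Qed.

End HyperbolicModel.

(** * Equations of the umbilic hypersurfaces *)

Section UmbilicInstances.
Context {R : realType} (n : nat) (kappa : R) (M : linear_model n kappa).
Local Notation A := (ambient n kappa).
Local Notation E := 'rV[R]_n.+2.
Local Notation X := (mX M).
Local Notation q := (bil (mQ M)).
Local Notation b := (bil (mB M)).
Local Notation Mk := (@Mk R n kappa).
Local Notation C := (cK kappa).
Local Notation S := (sK kappa).

Lemma q_kb z w : kappa != 0 -> q z w = kappa * b z w.
Proof. by move=> k0; exact: qb_neq0. Qed.

Lemma umbilic_form_hyperplane (N : set A) a rho : kappa != 0 -> 0 < rho ->
  q a a = 1 + kappa * rho -> N = [set x | Mk x /\ q a (X x) = 1] -> umbilic_form M N a rho.
Proof.
move=> k0 r0 qa NE; split=> //; last by move=> x; rewrite NE => -[].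
rewrite NE; apply/seteqP; split=> x /= [Mx H]; split=> //.
  apply: (mulfI k0); rewrite -q_kb // bilDl bilDr bilNr bilNl bilDr bilNr.
  rewrite (mQ_mX M Mx) (qC M (X x) a) H qa; ring.
have := congr1 (fun r => kappa * r) H; rewrite /= -q_kb // bilDl bilDr bilNr bilNl bilDr bilNr.
by rewrite (mQ_mX M Mx) (qC M (X x) a) qa; lra.
Qed.

Lemma cK_neq0 r : 0 < r -> (r%:E < Tk kappa)%E -> (2 * r)%:E != Tk kappa -> C r != 0.
Proof.
move=> r0 rT r2; have [k0|k0] := leP kappa 0; first by rewrite gt_eqF // cK_gt0.
have TE : Tk kappa = (pi / Num.sqrt kappa)%:E by rewrite /Tk k0.
have cT := cK_pi k0; have sT := sK_pi k0.
move: TE cT sT; set T := pi / _ => TE cT sT.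
rewrite TE lte_fin in rT; rewrite TE eqe in r2.
apply/eqP => C0; have S0 : S (2 * r) = 0.
  by rewrite mulr_natl mulr2n sKD C0 mul0r mulr0 addr0.
have [r2T|Tr2|/eqP] := ltgtP (2 * r) T; last by rewrite (negbTE r2).
  have := @sK_gt0 R kappa (2 * r); rewrite TE lte_fin S0 ltxx => H.
  by have : false by apply: H => //; rewrite mulr_gt0.
have := @sK_gt0 R kappa (2 * r - T); rewrite TE lte_fin subr_gt0 sKD cKN sKN sT S0.
rewrite oppr0 mulr0 mul0r addr0 ltxx => H.
by have : false by apply: H => //; lra.
Qed.

Lemma geodesic_sphereP c r x : Mk c -> geodesic_sphere c r x <->
  Mk x /\ exists xi, [/\ q (X c) xi = 0, b xi xi = 1 & X x = C r *: X c + S r *: xi].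
Proof.
move=> Mc; split=> [[u [Tu u1] <-]|[Mx [xi [qxi bxi xE]]]].
  have [Mx xE] := geodE M r Mc Tu u1; split=> //; exists ('D_u X c).
  have [_ qu] := (tangentMk M c u).1 Tu; split=> //.
  by rewrite -metricE.
have [u Tu uE] := quadric_path Mc qxi.
have u1 : metric c u u = 1 by rewrite (metricE M) // uE.
exists u => //; have [My yE] := geodE M r Mc Tu u1.
by apply: (X_inj (M := M)) => //; rewrite yE xE uE.
Qed.

Lemma umbilic_form_sphere c r : Mk c -> 0 < r -> (r%:E < Tk kappa)%E -> C r != 0 ->
  umbilic_form M (geodesic_sphere c r) ((C r)^-1 *: X c) ((S r / C r) ^+ 2).
Proof.
move=> Mc r0 rT C0; have S0 : 0 < S r := sK_gt0 r0 rT.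
have rho0 : 0 < (S r / C r) ^+ 2 by rewrite exprn_even_gt0 //= mulf_neq0 ?invr_eq0 // gt_eqF.
have CS := cK_sK kappa r; have q1 := mQ_mX M Mc.
have qa : q ((C r)^-1 *: X c) ((C r)^-1 *: X c) = 1 + kappa * (S r / C r) ^+ 2.
  rewrite bilZl bilZr q1 mulr1 expr_div_n.
  apply: (mulIf (expf_neq0 2 C0)).
  have -> : (1 + kappa * (S r ^+ 2 / C r ^+ 2)) * C r ^+ 2 = C r ^+ 2 + kappa * S r ^+ 2.
    by field.
  by rewrite CS -expr2 -exprMn mulVf // expr1n.
have [k0|k0] := eqVneq kappa 0; last first.
  apply: umbilic_form_hyperplane => //; apply/seteqP; split=> x.
    move=> /(geodesic_sphereP _ _ Mc)[Mx [xi [qxi bxi xE]]]; split=> //=.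
    by rewrite xE bilZl bilDr !bilZr qxi q1 mulr0 addr0 mulr1 mulVf.
  move=> [Mx]; rewrite bilZl => qx.
  have {}qx : q (X c) (X x) = C r by rewrite -[RHS]mulr1 -qx mulrA mulfV // mul1r.
  apply/(geodesic_sphereP _ _ Mc); split=> //.
  exists ((S r)^-1 *: (X x - C r *: X c)); split.
  - by rewrite bilZr bilDr bilNr bilZr q1 qx mulr1 subrr mulr0.
  - apply: (mulfI k0); rewrite -q_kb // bilZl bilZr bilDl bilDr bilDr !bilNl !bilNr !bilZl !bilZr.
    rewrite (mQ_mX M Mx) q1 (qC M (X x)) qx mulr1.
    have kE : (1 - C r ^+ 2) / S r ^+ 2 = kappa.
      by rewrite -CS addrC addKr mulfK // expf_neq0 // gt_eqF.
    rewrite mulr1 -[RHS]kE; move: (S r) S0 (C r) => s s0 c'.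
    by field; rewrite gt_eqF.
  - by rewrite scalerA mulfV ?gt_eqF // scale1r addrC subrK.
have kM (s : R) : kappa * s = 0 by rewrite k0 mul0r.
have C1 : C r = 1.
  have /eqP := CS; rewrite kM addr0 sqrf_eq1 => /orP[/eqP //|/eqP C1].
  have Cp : 0 < C r by apply: cK_gt0; rewrite k0.
  by move: Cp; rewrite C1 oppr_gt0 ltr10.
have Npt x : geodesic_sphere c r x <-> Mk x /\
    b (X x - (C r)^-1 *: X c) (X x - (C r)^-1 *: X c) = (S r / C r) ^+ 2.
  rewrite C1 invr1 scale1r mulr1; split.
    move=> /(geodesic_sphereP _ _ Mc)[Mx [xi [qxi bxi xE]]]; split=> //.
    by rewrite xE C1 scale1r addrC addKr bilZl bilZr bxi mulr1 expr2.
  move=> [Mx bx]; apply/(geodesic_sphereP _ _ Mc); split=> //.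
  exists ((S r)^-1 *: (X x - X c)); split.
  - by rewrite bilZr bilDr bilNr q1 (mQ_flat M k0 Mc Mx) subrr mulr0.
  - by rewrite bilZl bilZr bx expr2 mulKf ?mulVf ?gt_eqF.
  - by rewrite scalerA mulfV ?gt_eqF // C1 !scale1r addrC subrK.
split=> //; first by apply/seteqP; split=> x /Npt.
by move=> x /Npt[Mx _]; rewrite C1 invr1 scale1r (mQ_flat M k0 Mc Mx).
Qed.

End UmbilicInstances.

Section Isometries.
Context {R : realType} (n : nat) (kappa : R) (M : linear_model n kappa).
Local Notation A := (ambient n kappa).
Local Notation E := 'rV[R]_n.+2.
Local Notation X := (mX M).
Local Notation q := (bil (mQ M)).
Local Notation b := (bil (mB M)).
Local Notation Mk := (@Mk R n kappa).
Local Notation C := (cK kappa).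
Local Notation S := (sK kappa).
Hypothesis k0 : kappa < 0.
Variables (f : A -> A) (fI : Defs.isometry f).

Let oM : open Mk := open_Mk (ltW k0).

Lemma isometry_Ck k : Ck k Mk f.
Proof. by have [sf _ _] := fI; exact: ((smooth_on_open f oM).1 sf k). Qed.

Lemma isometry_Mk x : Mk x -> Mk (f x).
Proof. by have [_ [fM _ _] _] := fI; exact: fM. Qed.

Lemma isometry_metric x u w : Mk x ->
  metric (f x) ('D_u f x) ('D_w f x) = metric x u w.
Proof.
move=> Mx; have [_ _ fm] := fI; have ck := isometry_Ck.
have T z : tangent Mk x z := tangent_open z oM Mx.
by have := fm x u w Mx (T u) (T w); rewrite !(tdiff_open _ oM ck Mx).
Qed.

Lemma isometry_derive_surj x z : Mk x -> exists u, 'D_u f x = z.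
Proof.
move=> Mx; have df := Ck_differentiable oM (isometry_Ck 1) Mx.
pose D := \matrix_i 'D_(delta_mx 0 i) f x.
have DE (u : A) : 'D_u f x = u *m D.
  rewrite derive_sum_coord // mulmx_sum_row; apply: eq_bigr => i _.
  by rewrite rowK.
have uD : D \in unitmx.
  rewrite -row_free_unit -kermx_eq0; apply/eqP/row_matrixP => i; rewrite row0.
  apply: (metric_eq0 Mx); rewrite -isometry_metric // !DE -row_mul mulmx_ker row0.
  by rewrite /metric /edot big1 ?mulr0 // => j _; rewrite mxE mul0r.
by exists (z *m invmx D); rewrite DE mulmxKV.
Qed.

Lemma isometry_immersion : isometric_immersion M (fun x => X (f x)).
Proof.
have fM := isometry_Mk; have DM x : Mk x -> domX M x := Mk_domX M.
have Ck2 : Ck 2 Mk (fun x => X (f x)).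
  by apply: (Ck_comp oM (open_domX M) _ (Ck_mX M 2) (isometry_Ck 2)) => x /fM/DM.
have dF x u : Mk x -> 'D_u (fun x => X (f x)) x = 'D_('D_u f x) X (f x).
  move=> Mx; have d := Ck_is_derive u (isometry_Ck 1) Mx.
  by have [_ <-] := is_derive_comp_diff (X_differentiable M (fM _ Mx)) d.
have T x u : Mk x -> tangent Mk x u by exact: tangent_open.
have mE x u w : Mk x -> metric x u w =
    b ('D_u (fun x => X (f x)) x) ('D_w (fun x => X (f x)) x).
  by move=> Mx; rewrite !dF // -(metricE M) ?isometry_metric //; exact: fM.
split=> //.
- by exists Mk.
- by move=> x /fM; exact: mQ_mX.
- move=> x u z Mx _; rewrite dF //; have [_ qu] := (tangentMk M _ _).1 (T _ ('D_u f x) (fM _ Mx)).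
  by split=> //; exact: (mQ_tangent M _ (fM _ Mx) qu).
split; first by move=> x u w z Mx; exact: (koszul (ltW k0) (mB_sym M) oM _ Ck2 mE).
move=> x xi Mx qxi; have [w _ <-] := quadric_path (fM _ Mx) qxi.
have [u <-] := isometry_derive_surj w Mx.
by exists u; [exact: T|rewrite dF].
Qed.

Hypothesis qX_gt0 : forall x y, Mk x -> Mk y -> 0 < q (X x) (X y).

Lemma hyperbolic_geodesic x y : Mk x -> Mk y -> y = x \/
  exists u t, [/\ tangent Mk x u, metric x u u = 1 & y = geod x u t].
Proof.
move=> Mx My; have kN0 : kappa != 0 by rewrite lt_eqF.
have q1 := mQ_mX M Mx; have q2 := mQ_mX M My; pose c := q (X x) (X y).
have c0 : 0 < c by exact: qX_gt0.
pose xi := X y - c *: X x.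
have qxi : q (X x) xi = 0 by rewrite /xi bilDr bilNr bilZr q1 mulr1 subrr.
have qq : q xi xi = 1 - c ^+ 2.
  rewrite /xi bilDl !bilDr !bilNl !bilNr !bilZl !bilZr q1 q2 (qC M (X y)) -/c.
  by ring.
have kb : kappa * b xi xi = 1 - c ^+ 2 by rewrite -q_kb.
have [bxi|bxi] := eqVneq (b xi xi) 0.
  left; have xi0 := b_eq0 Mx qxi bxi.
  have c1 : c = 1.
    move: kb; rewrite bxi mulr0 => /esym/eqP; rewrite subr_eq0 eq_sym sqrf_eq1.
    by case/orP => /eqP // cN; move: c0; rewrite cN oppr_gt0 ltr10.
  apply: (X_inj (M := M)) => //; apply/eqP; rewrite -subr_eq0 -[X x]scale1r -c1.
  by rewrite -/xi xi0.
right; have b0 : 0 < b xi xi by rewrite lt_neqAle eq_sym bxi (b_ge0 Mx qxi).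
pose s := Num.sqrt (b xi xi); have s0 : 0 < s by rewrite sqrtr_gt0.
have s2 : s ^+ 2 = b xi xi by rewrite sqr_sqrtr // ltW.
have [t [Ct St]] : exists t : R^o, C t = c /\ S t = s.
  by apply: cK_sK_surj => //; rewrite s2 kb addrC subrK.
have qs : q (X x) (s^-1 *: xi) = 0 by rewrite bilZr qxi mulr0.
have [u Tu uE] := quadric_path Mx qs.
have u1 : metric x u u = 1.
  by rewrite (metricE M) // uE bilZl bilZr -s2 expr2 mulKf ?mulVf ?gt_eqF.
exists u, t; split=> //; have [Mg gE] := geodE M t Mx Tu u1.
apply: (X_inj (M := M)) => //; rewrite gE Ct St uE scalerA mulfV ?gt_eqF //.
by rewrite scale1r addrC subrK.
Qed.

Lemma q_frame (P xi eta : E) (al c s : R) : q P P = 1 -> q P xi = 0 -> q P eta = 0 ->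
  (forall z, q xi z = kappa * b xi z) ->
  q (al *: P + xi) (c *: P + s *: eta) = al * c + s * (kappa * b xi eta).
Proof.
move=> PP Pxi Peta xiE.
by rewrite bilDl !bilDr !bilZl !bilZr PP Peta (qC M xi P) Pxi xiE; ring.
Qed.

Lemma isometry_hyperplane (w : E) x0 : Mk x0 -> exists2 w', q w' w' = q w w &
  forall y, Mk y -> q w' (X (f y)) = q w (X y).
Proof.
move=> Mx; have fM := isometry_Mk Mx; have FI := isometry_immersion.
have [_ F1 Ft FmE _] := FI; have q1 := mQ_mX M Mx.
have [al alE] : {al | al = q w (X x0)} by exists (q w (X x0)).
have qx : q (X x0) (w - al *: X x0) = 0.
  by rewrite bilDr bilNr bilZr q1 mulr1 (qC M (X x0)) alE subrr.
have [u0 Tu0 uE] := quadric_path Mx qx.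
have [_ qu0] := (tangentMk M _ _).1 Tu0.
have wE : w = al *: X x0 + 'D_u0 X x0 by rewrite uE addrC subrK.
have Fx := F1 _ Mx; have [F0 _] := Ft x0 u0 0 Mx Tu0.
have Fk z := (Ft x0 u0 z Mx Tu0).2.
have Xk z : q ('D_u0 X x0) z = kappa * b ('D_u0 X x0) z by exact: (mQ_tangent M _ Mx qu0).
have bE u : b ('D_u0 (fun x => X (f x)) x0) ('D_u (fun x => X (f x)) x0) =
    b ('D_u0 X x0) ('D_u X x0) by rewrite -FmE // (metricE M).
exists (al *: X (f x0) + 'D_u0 (fun x => X (f x)) x0) => [|y My].
  have h1 := q_frame al al 1 q1 qu0 qu0 Xk; have h2 := q_frame al al 1 Fx F0 F0 Fk.
  rewrite !scale1r in h1 h2; rewrite h2 wE h1; congr (_ + _ * (_ * _)); exact: bE.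
have [->|[u [t [Tu u1 ->]]]] := hyperbolic_geodesic Mx My.
  by rewrite bilDl bilZl Fx mulr1 (qC M _ (X (f x0))) F0 addr0.
have [g g0 gu] := geodP M Mx Tu u1.
have FE := immersion_geodesic FI g; rewrite g0 gu in FE.
have {}FE := FE u1 t; rewrite FE; have [_ ->] := geodE M t Mx Tu u1.
have [Fu _] := Ft x0 u 0 Mx Tu; have [_ qu] := (tangentMk M _ _).1 Tu.
rewrite (q_frame al _ _ Fx F0 Fu Fk) [in RHS]wE (q_frame al _ _ q1 qu0 qu Xk).
by congr (_ + _ * (_ * _)); exact: bE.
Qed.

Lemma umbilic_form_isometry (w : E) (N0 : set A) : N0 `<=` Mk -> q w w < 1 ->
  (forall x, Mk x -> q w (X x) = 1 <-> N0 x) ->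
  exists a rho, umbilic_form M (f @` N0) a rho.
Proof.
move=> N0M w1 N0E; pose x0 : A := const_mx 1.
have Mx0 : Mk x0 by rewrite (MkE n (ltW k0)) => _; rewrite mxE.
have [w' ww wf] := isometry_hyperplane w Mx0.
have kN0 : kappa != 0 by rewrite lt_eqF.
exists w', ((q w w - 1) / kappa); apply: umbilic_form_hyperplane => //.
- by rewrite nmulr_lgt0 ?invr_lt0 // subr_lt0.
- by rewrite ww mulrC divfK // addrC subrK.
have [_ [fM fi fs] _] := fI.
apply/seteqP; split=> [_ [x Nx <-]|y [My qy]].
  have Mx := N0M _ Nx; split; first exact: fM.
  by rewrite wf //; apply/N0E.
have [x Mx xy] := fs y My; exists x => //; apply/N0E => //.
by rewrite -wf // xy.
Qed.

End Isometries.

Lemma exterior_sub (R : realType) (n : nat) (kappa : R) (N : set (ambient n kappa)) :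
  exterior N `<=` Mk (kappa := kappa) `\` N.
Proof.
move=> x [[p _ px] _]; have [t tx] := @filter_ex _ _ (at_right_proper_filter (0 : R)) _ px.
exact: connected_component_sub tx.
Qed.

Lemma umbilic_hypersurface_form (R : realType) (n : nat) (kappa : R)
    (N : set (ambient n kappa)) : umbilic_hypersurface N ->
  exists (M : linear_model n kappa) a rho, umbilic_form M N a rho.
Proof.
move=> [[c [r [Mc r0 rT rT2 ->]]]|[k0 NE]].
  have [M] : inhabited (linear_model n kappa).
    have [k0|k0|k0] := ltgtP kappa 0.
    - by have [M _] := hyperbolic_model n k0; exact: inhabits M.
    - exact: spherical_model.
    - exact: flat_model.
  exists M, ((cK kappa r)^-1 *: mX M c), ((sK kappa r / cK kappa r) ^+ 2).
  by apply: umbilic_form_sphere => //; exact: cK_neq0.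
have [M [qX [w w1 wN] Ha]] := hyperbolic_model n k0.
exists M; case: NE => [[f fI ->]|[f [a [fI a0 _ ->]]]].
  apply: (umbilic_form_isometry k0 fI qX _ w1 wN) => x /= x1.
  by rewrite (MkE n (ltW k0)) => _; rewrite x1.
have [w' w1' wN'] := Ha a a0.
apply: (umbilic_form_isometry k0 fI qX _ w1') => [x []//|x Mx].
by rewrite wN' //; split=> [|[]].
Qed.

Theorem theorem6 (R : realType) (n : nat) (kappa : R)
    (N : set (ambient n kappa)) (v : ambient n kappa -> ambient n kappa)
    (n_gt0 : (0 < n)%N)
    (umbN : umbilic_hypersurface N)
    (smooth_v : smooth_unit_field N v)
    (bif_v : bifoliating N v) :
  preserves_volume (exterior N) (billiard N v) <->
  (forall (p : ambient n kappa) (s : R), N p ->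
     (nabla_char_poly N v p).[- s] = (-1) ^+ n * (nabla_char_poly N v p).[s]).
Proof.
have [M [a [rho HN]]] := umbilic_hypersurface_form umbN; have [fol folN] := bif_v.
exact: (preserves_volume_parity HN smooth_v fol folN (fun x Ux => (exterior_sub Ux).2)).
Qed.
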